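(* Let $f(z)=z+a_2z^2+a_3z^3+\cdots\in\mathcal{C}_{\arcsin}$ and let $\gamma_1,\gamma_2,\gamma_3$ be the first three logarithmic coefficients of $f$. Then $$|\gamma_1|\le \frac{1}{2\pi},\qquad |\gamma_2|\le \frac{1}{6\pi},\qquad |\gamma_3|\le \frac{1}{12\pi}.$$ The estimates are sharp, i.e. for each of them there is a function in $\mathcal{C}_{\arcsin}$ for which equality holds.
   Context: Let $\Omega=\{z\in\mathbb{C}:|z|<1\}$. Let $\mathcal{A}$ be the family of analytic functions $f$ in $\Omega$ normalized by $f(z)=z+\sum_{n=2}^{\infty}a_nz^n$, and let $\mathcal{S}\subset\mathcal{A}$ be the subclass of univalent functions. A Schwarz function is an analytic $\omega:\Omega\to\mathbb{C}$ with $\omega(0)=0$ and $|\omega(z)|\le 1$ on $\Omega$. For analytic $g,h$ in $\Omega$, $g\prec h$ (subordination) means that there is a Schwarz function $\omega$ with $g(z)=h(\omega(z))$ for all $z\in\Omega$. With $\arcsin$ the principal branch ($\arcsin 0=0$), define $$\mathcal{C}_{\arcsin}=\left\{f\in\mathcal{S}:\ 1+\frac{zf''(z)}{f'(z)}\prec 1+\frac{2}{\pi}\arcsin z \text{ in } \Omega\right\}.$$ The logarithmic coefficients $\gamma_n$ of $f\in\mathcal{S}$ are defined by $\log\left(\frac{f(z)}{z}\right)=2\sum_{n=1}^{\infty}\gamma_nz^n$ with $\log 1=0$. Thus $\gamma_1=\frac12a_2$, $\gamma_2=\frac12\left(a_3-\frac12a_2^2\right)$, $\gamma_3=\frac12\left(a_4-a_2a_3+\frac13a_2^3\right)$.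 *)

(* Defs.v *)
From Stdlib Require Export Reals.
From Coquelicot Require Export Coquelicot.

Open Scope R_scope.
Open Scope C_scope.

Definition Omega (z : C) : Prop := (Cmod z < 1)%R.

(* Complex differentiability at every point of the open disc. *)
Definition analytic (f : C -> C) : Prop :=
  forall z : C, Omega z -> ex_derive (K := C_AbsRing) (V := C_NormedModule) f z.

Definition has_expansion (f : C -> C) (a : nat -> C) : Prop :=
  forall z : C, Omega z ->
    is_pseries (K := C_AbsRing) (V := C_NormedModule) a z (f z).

Definition class_A (f : C -> C) : Prop :=
  analytic f /\
  exists a : nat -> C, a 0%nat = 0 /\ a 1%nat = 1 /\ has_expansion f a.

Definition univalent (f : C -> C) : Prop :=
  forall z w : C, Omega z -> Omega w -> f z = f w -> z = w.

Definition class_S (f : C -> C) : Prop := class_A f /\ univalent f.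

Definition schwarz (omega : C -> C) : Prop :=
  analytic omega /\ omega 0 = 0 /\
  forall z : C, Omega z -> (Cmod (omega z) <= 1)%R.

Definition subordinate (g h : C -> C) : Prop :=
  exists omega : C -> C,
    schwarz omega /\ forall z : C, Omega z -> g z = h (omega z).

Definition Cexp (z : C) : C :=
  (exp (Re z) * cos (Im z), exp (Re z) * sin (Im z))%R.

(* Principal argument, with values in (-PI, PI]; the value at 0 is irrelevant. *)
Definition Carg (z : C) : R :=
  if Rlt_dec (Im z) 0 then (- acos (Re z / Cmod z))%R
  else acos (Re z / Cmod z).

Definition Clog (z : C) : C := (ln (Cmod z), Carg z).

(* Principal square root: nonnegative real part, cut along the negative reals. *)
Definition Csqrt (z : C) : C :=
  (sqrt ((Cmod z + Re z) / 2),
   if Rlt_dec (Im z) 0 then - sqrt ((Cmod z - Re z) / 2)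
   else sqrt ((Cmod z - Re z) / 2))%R.

(* Principal branch: arcsin z = -i Log (i z + sqrt (1 - z^2)). *)
Definition Carcsin (z : C) : C :=
  - Ci * Clog (Ci * z + Csqrt (1 - z * z)).

(* 1 + z f''(z) / f'(z) *)
Definition convexity_quotient (f : C -> C) (z : C) : C :=
  1 + z * C_derive (C_derive f) z / C_derive f z.

Definition class_C_arcsin (f : C -> C) : Prop :=
  class_S f /\
  subordinate (convexity_quotient f) (fun z : C => 1 + 2 / PI * Carcsin z).

(* log (f z / z) is the analytic logarithm on the disc that vanishes at 0, where
   f z / z extends by the value 1.  The entry gamma 0 is not used. *)
Definition log_coeffs (f : C -> C) (gamma : nat -> C) : Prop :=
  exists L : C -> C,
    analytic L /\ L 0 = 0 /\
    (forall z : C, Omega z -> z <> 0 -> Cexp (L z) = f z / z) /\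
    has_expansion L
      (fun n : nat => match n with O => 0 | S _ => 2 * gamma n end).

(* Main.v *)
Require Import Defs.
From Stdlib Require Import Reals Ranalysis5 Lra Lia Psatz.
From Coquelicot Require Import Coquelicot.

(* If [1 + z f''/f' = 1 + (2/PI) arcsin w] with [w = c1 z + c2 z^2 + ...] a Schwarz function,
   comparing coefficients gives [gamma1 = c1 / (2 PI)],
   [gamma2 = (c2 + c1^2 / (2 PI)) / (6 PI)] and
   [gamma3 = (c3 + c1 c2 / PI + c1^3 / 6) / (12 PI)]. For all [s], [t], Bessel's inequality for
   [(1 + s z + t z^2) w] on circles of radius tending to 1 gives
     [|c1|^2 + |c2 + s c1|^2 + |c3 + s c2 + t c1|^2 <= 1 + |s|^2 + |t|^2],
   and suitable [s], [t] proportional to [c1], [c1^2] bound the three brackets by 1.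
   Equality holds for [w = z], [z^2], [z^3]; the corresponding [f] has
   [|arg f'| < PI/2], hence is univalent.
   Holomorphic means complex differentiable with continuous derivative, so that
   Cauchy's formula follows by differentiating under the integral sign; [w] itself is
   holomorphic in this sense because [w = sin ((PI/2) z f''/f')] and [f'] does not vanish. *)

Open Scope C_scope.

(** * Complex derivatives *)

(** The bracket in gamma2 is the middle one for s = c1/(2 PI), t = 0; the bracket in gamma3 is the
    last one for s = c1/PI, t = c1^2/6. Since |c1| <= 1, the excess |s|^2 + |t|^2 on the right is a
    small multiple of |c1|^2, and the first term on the left pays for it; no parametrisation of the
    coefficients of Schwarz functions is required. The obstacle is regularity. The definition of a
    Schwarz function admits values on the unit circle, where the principal arcsine has branch
    points. The bounds therefore use only that [Carcsin] is a right inverse of [csin] on the whole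
    plane, vanishes at 0 and is bounded on the closed disc. Boundedness controls z f''/f' wherever
    f' is nonzero, and a differential inequality along radii then excludes zeros of f', about which
    the quotient itself, with its default value for division by 0, says nothing. Holomorphy of
    [Carcsin] on the open disc enters only for the extremal functions, where |arcsin z| <= 2|z|
    gives |arg f'| <= 4/PI < PI/2. *)

Definition cderiv (f : C -> C) (z l : C) : Prop :=
  is_derive (K := C_AbsRing) (V := C_NormedModule) f z l.

Definition ccont (f : C -> C) (z : C) : Prop :=
  continuous (T := AbsRing_UniformSpace C_AbsRing)
    (U := AbsRing_UniformSpace C_AbsRing) f z.

Definition holo (D : C -> Prop) (f : C -> C) : Prop :=
  exists f' : C -> C, forall z, D z -> cderiv f z (f' z) /\ ccont f' z.

Lemma cderivP f z l : cderiv f z l <->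
  forall eps : R, (0 < eps)%R -> exists delta : R, (0 < delta)%R /\
    forall w, (Cmod (w - z) < delta)%R ->
      (Cmod (f w - f z - (w - z) * l) <= eps * Cmod (w - z))%R.
Proof.
split.
- intros [_ H] eps He.
  destruct (H z (fun P HP => HP) (mkposreal eps He)) as [d Hd].
  exists d; split; [apply cond_pos | intros w Hw; exact (Hd w Hw)].
- intros H; split; [apply is_linear_scal_l |].
  intros x Hx eps.
  rewrite <- (is_filter_lim_locally_unique (V := AbsRing_NormedModule C_AbsRing) z x Hx).
  destruct (H eps (cond_pos eps)) as [d [Hd0 Hd]].
  exists (mkposreal d Hd0); intros w Hw; exact (Hd w Hw).
Qed.

Lemma ccontP f z : ccont f z <->
  forall eps : R, (0 < eps)%R -> exists delta : R, (0 < delta)%R /\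
    forall w, (Cmod (w - z) < delta)%R -> (Cmod (f w - f z) < eps)%R.
Proof.
unfold ccont, continuous; split.
- intros H eps He.
  destruct (proj1 (filterlim_locally _ _) H (mkposreal eps He)) as [d Hd].
  exists d; split; [apply cond_pos | intros w Hw; exact (Hd w Hw)].
- intros H; apply filterlim_locally; intros eps.
  destruct (H eps (cond_pos eps)) as [d [Hd0 Hd]].
  exists (mkposreal d Hd0); intros w Hw; exact (Hd w Hw).
Qed.

(* [C_NormedModule] and [AbsRing_NormedModule C_AbsRing] have the same norm but not
   definitionally the same uniform structure; the product rules of Coquelicot are
   stated for the latter. *)
Lemma cderiv_AbsRing f z l :
  cderiv f z l <-> is_derive (K := C_AbsRing) (V := AbsRing_NormedModule C_AbsRing) f z l.
Proof.
split; intros [_ H]; (split; [apply is_linear_scal_l | exact H]).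
Qed.

Lemma cderiv_ccont f z l : cderiv f z l -> ccont f z.
Proof.
intros H. apply cderiv_AbsRing in H.
apply (ex_derive_continuous (K := C_AbsRing) (V := AbsRing_NormedModule C_AbsRing)).
exists l; exact H.
Qed.

Lemma cderiv_ext_loc f g z l (r : R) : (0 < r)%R ->
  (forall w, (Cmod (w - z) < r)%R -> f w = g w) -> cderiv f z l -> cderiv g z l.
Proof.
intros Hr He; apply is_derive_ext_loc.
exists (mkposreal r Hr); intros w Hw; apply He; exact Hw.
Qed.

Lemma cderiv_ext f g z l : (forall w, f w = g w) -> cderiv f z l -> cderiv g z l.
Proof. intros He; apply is_derive_ext; exact He. Qed.

Lemma cderiv_id z : cderiv (fun w => w) z 1.
Proof. apply cderiv_AbsRing. exact (is_derive_id (K := C_AbsRing) z). Qed.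

Lemma cderiv_const c z : cderiv (fun _ => c) z 0.
Proof. exact (is_derive_const (K := C_AbsRing) (V := C_NormedModule) c z). Qed.

Lemma cderiv_plus f g z l m :
  cderiv f z l -> cderiv g z m -> cderiv (fun w => f w + g w) z (l + m).
Proof. intros Hf Hg; exact (is_derive_plus _ _ _ _ _ Hf Hg). Qed.

Lemma cderiv_mult f g z l m :
  cderiv f z l -> cderiv g z m -> cderiv (fun w => f w * g w) z (l * g z + f z * m).
Proof.
intros Hf Hg; apply cderiv_AbsRing in Hf; apply cderiv_AbsRing in Hg; apply cderiv_AbsRing.
exact (is_derive_mult (K := C_AbsRing) f g z l m Hf Hg Cmult_comm).
Qed.

Lemma cderiv_comp f g z l m :
  cderiv f (g z) l -> cderiv g z m -> cderiv (fun w => f (g w)) z (m * l).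
Proof.
intros Hf Hg; apply cderiv_AbsRing in Hg. exact (is_derive_comp f g z l m Hf Hg).
Qed.

Lemma cderiv_eq f z l m : l = m -> cderiv f z l -> cderiv f z m.
Proof. now intros ->. Qed.

Lemma cderiv_scal c f z l : cderiv f z l -> cderiv (fun w => c * f w) z (c * l).
Proof.
intros H; eapply cderiv_eq; [| exact (cderiv_mult (fun _ => c) f z _ _ (cderiv_const c z) H)].
cbv beta; ring.
Qed.

Lemma cderiv_unique f z l m : cderiv f z l -> cderiv f z m -> l = m.
Proof.
intros Hl Hm; rewrite <- (is_C_derive_unique _ _ _ Hl); apply is_C_derive_unique; exact Hm.
Qed.

Lemma ccont_const c z : ccont (fun _ => c) z.
Proof. exact (continuous_const (U := AbsRing_UniformSpace C_AbsRing) (V := AbsRing_UniformSpace C_AbsRing) c z). Qed.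

Lemma ccont_id z : ccont (fun w => w) z.
Proof. exact (continuous_id (U := AbsRing_UniformSpace C_AbsRing) z). Qed.

Lemma ccont_plus f g z : ccont f z -> ccont g z -> ccont (fun w => f w + g w) z.
Proof.
intros Hf Hg.
exact (continuous_plus (U := AbsRing_UniformSpace C_AbsRing) (V := AbsRing_NormedModule C_AbsRing) f g z Hf Hg).
Qed.

Lemma ccont_mult f g z : ccont f z -> ccont g z -> ccont (fun w => f w * g w) z.
Proof. intros Hf Hg; exact (continuous_mult (U := AbsRing_UniformSpace C_AbsRing) (K := C_AbsRing) f g z Hf Hg). Qed.

Lemma ccont_comp f g z : ccont f (g z) -> ccont g z -> ccont (fun w => f (g w)) z.
Proof. intros Hf Hg; exact (continuous_comp (U := AbsRing_UniformSpace C_AbsRing) (V := AbsRing_UniformSpace C_AbsRing) (W := AbsRing_UniformSpace C_AbsRing) g f z Hg Hf). Qed.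

Lemma ccont_ext_loc f g z (r : R) : (0 < r)%R ->
  (forall w, (Cmod (w - z) < r)%R -> f w = g w) -> ccont f z -> ccont g z.
Proof.
intros Hr He Hf; apply ccontP; intros eps Heps.
destruct (proj1 (ccontP f z) Hf eps Heps) as [d [Hd Hd']].
exists (Rmin d r); split; [apply Rmin_pos; assumption |].
assert (Hz : Cmod (z - z) = 0%R).
{ replace (z - z) with (RtoC 0) by ring. apply Cmod_0. }
intros w Hw; rewrite <- (He w), <- (He z).
- apply Hd'; apply Rlt_le_trans with (1 := Hw); apply Rmin_l.
- rewrite Hz; assumption.
- apply Rlt_le_trans with (1 := Hw); apply Rmin_r.
Qed.

Lemma Cmod_minus_sym (z w : C) : Cmod (z - w) = Cmod (w - z).
Proof. rewrite <- Cmod_opp; f_equal; ring. Qed.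

Lemma Cmod_triangle_minus (z w : C) : (Cmod z <= Cmod w + Cmod (z - w))%R.
Proof.
replace z with (w + (z - w)) at 1 by ring. apply Cmod_triangle.
Qed.

Lemma cderiv_inv (z : C) : z <> 0 -> cderiv Cinv z (- / (z * z)).
Proof.
intros Hz; apply cderivP; intros eps He.
assert (Hm : (0 < Cmod z)%R) by (apply Cmod_gt_0; exact Hz).
set (m := Cmod z) in *.
(* The remainder is (w - z)^2 / (w z^2). The first bound keeps |w| > m/2, and then |w - z| / (|w|
   m^2) is at most 2 |w - z| / m^3, which dictates the second. *)
exists (Rmin (m / 2) (eps * m ^ 3 / 2)); split.
{ apply Rmin_pos; [lra |].
  assert (0 < m ^ 3)%R by (apply pow_lt; exact Hm). nra. }
intros w Hw.
assert (H1 : (Cmod (w - z) < m / 2)%R) by (apply Rlt_le_trans with (1 := Hw); apply Rmin_l).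
assert (H2 : (Cmod (w - z) < eps * m ^ 3 / 2)%R) by (apply Rlt_le_trans with (1 := Hw); apply Rmin_r).
assert (H3 : (m / 2 < Cmod w)%R).
{ pose proof (Cmod_triangle_minus z w) as H. rewrite Cmod_minus_sym in H. fold m in H. lra. }
assert (Hw0 : w <> 0).
{ intros E; rewrite E, Cmod_0 in H3; lra. }
replace (/ w - / z - (w - z) * - / (z * z)) with ((w - z) * ((w - z) / (w * (z * z))))
  by (field; split; assumption).
rewrite Cmod_mult, Rmult_comm. apply Rmult_le_compat_r; [apply Cmod_ge_0 |].
rewrite Cmod_div by (repeat apply Cmult_neq_0; assumption).
rewrite !Cmod_mult. fold m.
assert (HP : (0 < Cmod w * (m * m))%R) by (apply Rmult_lt_0_compat; nra).
apply Rmult_le_reg_r with (1 := HP).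
unfold Rdiv; rewrite Rmult_assoc, Rinv_l by lra. rewrite Rmult_1_r.
apply Rle_trans with (eps * m ^ 3 / 2)%R; [lra |].
assert (0 < eps * (m * m))%R by nra. simpl; nra.
Qed.

Lemma holo_ccont D f z : holo D f -> D z -> ccont f z.
Proof. intros [f' H] Hz; apply (cderiv_ccont _ _ (f' z)), H, Hz. Qed.

Lemma holo_const D c : holo D (fun _ => c).
Proof. exists (fun _ => 0); intros z _; split; [apply cderiv_const | apply ccont_const]. Qed.

Lemma holo_id D : holo D (fun z => z).
Proof. exists (fun _ => 1); intros z _; split; [apply cderiv_id | apply ccont_const]. Qed.

Lemma holo_plus D f g : holo D f -> holo D g -> holo D (fun z => f z + g z).
Proof.
intros [f' Hf] [g' Hg]; exists (fun z => f' z + g' z); intros z Hz.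
split; [apply cderiv_plus | apply ccont_plus]; (apply Hf || apply Hg); exact Hz.
Qed.

Lemma holo_mult D f g : holo D f -> holo D g -> holo D (fun z => f z * g z).
Proof.
intros Hf Hg.
assert (Cf := fun z => holo_ccont D f z Hf); assert (Cg := fun z => holo_ccont D g z Hg).
destruct Hf as [f' Hf]; destruct Hg as [g' Hg].
exists (fun z => f' z * g z + f z * g' z); intros z Hz.
destruct (Hf z Hz), (Hg z Hz); split; [apply cderiv_mult; assumption |].
apply ccont_plus; apply ccont_mult; auto.
Qed.

Lemma holo_comp D E f g :
  holo E f -> holo D g -> (forall z, D z -> E (g z)) -> holo D (fun z => f (g z)).
Proof.
intros Hf Hg HDE.
assert (Cg := fun z => holo_ccont D g z Hg).
destruct Hf as [f' Hf]; destruct Hg as [g' Hg].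
exists (fun z => g' z * f' (g z)); intros z Hz.
destruct (Hf (g z) (HDE z Hz)), (Hg z Hz); split; [apply cderiv_comp; assumption |].
apply ccont_mult; [assumption |]. apply (ccont_comp f' g); auto.
Qed.

Lemma holo_inv : holo (fun z : C => z <> 0) Cinv.
Proof.
exists (fun z => - / (z * z)); intros z Hz; split; [apply cderiv_inv; exact Hz |].
assert (HI := cderiv_ccont _ _ _ (cderiv_inv z Hz)).
(* The radius |z| keeps [w] away from 0, so that the two forms of the derivative agree. *)
apply ccont_ext_loc with (f := fun w => - (1) * (/ w * / w)) (r := Cmod z).
- apply Cmod_gt_0, Hz.
- intros w Hw.
  assert (w <> 0).
  { intros E; rewrite E, Cmod_minus_sym in Hw.
    replace (z - 0) with z in Hw by ring. lra. }
  field. assumption.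
- apply ccont_mult; [apply ccont_const | apply ccont_mult; exact HI].
Qed.

Lemma holo_div D f g : holo D f -> holo D g -> (forall z, D z -> g z <> 0) ->
  holo D (fun z => f z / g z).
Proof.
intros Hf Hg Hn. apply holo_mult; [exact Hf |].
exact (holo_comp D _ Cinv g holo_inv Hg Hn).
Qed.

Lemma holo_scal D c f : holo D f -> holo D (fun z => c * f z).
Proof. intros Hf; apply holo_mult; [apply holo_const | exact Hf]. Qed.

Lemma holo_pow D n : holo D (fun z => z ^ n).
Proof.
induction n as [| n IH]; [exact (holo_const D 1) |].
exact (holo_mult _ _ _ (holo_id D) IH).
Qed.

Lemma Omega_ball z : Omega z -> exists r : R, (0 < r)%R /\
  forall w, (Cmod (w - z) < r)%R -> Omega w.
Proof.
intros Hz; exists (1 - Cmod z)%R; unfold Omega in *; split; [lra |].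
intros w Hw. pose proof (Cmod_triangle_minus w z). lra.
Qed.

Lemma holo_ext f g : (forall z, Omega z -> f z = g z) -> holo Omega f -> holo Omega g.
Proof.
intros He [f' Hf]; exists f'; intros z Hz. destruct (Hf z Hz) as [H1 H2]; split; [| exact H2].
destruct (Omega_ball z Hz) as [r [Hr Hr']].
apply cderiv_ext_loc with (f := f) (r := r); auto.
Qed.

Lemma holo_analytic f : holo Omega f -> analytic f.
Proof. intros [f' H] z Hz; exists (f' z); apply H, Hz. Qed.

(** * Real and imaginary parts; derivatives along real paths *)

Lemma Cmod_le_abs (z : C) : (Cmod z <= Rabs (Re z) + Rabs (Im z))%R.
Proof.
destruct z as [x y].
replace (x, y) with (RtoC x + Ci * RtoC y)
  by (unfold RtoC, Ci, Cplus, Cmult; simpl; f_equal; ring).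
apply Rle_trans with (1 := Cmod_triangle _ _).
rewrite Cmod_mult, Cmod_Ci, !Cmod_R. simpl.
replace (x + (0 * y - 1 * 0))%R with x by ring.
replace (0 + (0 * 0 + 1 * y))%R with y by ring. lra.
Qed.

Lemma im_le_Cmod (z : C) : (Rabs (Im z) <= Cmod z)%R.
Proof.
apply Rle_trans with (2 := Rmax_Cmod z). apply Rmax_r.
Qed.

(** Stated by components because the mean value theorem and the integrals are applied to real
    functions. *)
Definition pderiv (g : R -> C) (t : R) (v : C) : Prop :=
  is_derive (fun s => Re (g s)) t (Re v) /\ is_derive (fun s => Im (g s)) t (Im v).

Lemma is_deriveP (f : R -> R) (x l : R) : is_derive f x l <->
  forall eps : R, (0 < eps)%R -> exists delta : R, (0 < delta)%R /\
    forall y, (Rabs (y - x) < delta)%R ->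
      (Rabs (f y - f x - (y - x) * l) <= eps * Rabs (y - x))%R.
Proof.
split.
- intros [_ H] eps He.
  destruct (H x (fun P HP => HP) (mkposreal eps He)) as [d Hd].
  exists d; split; [apply cond_pos | intros w Hw; exact (Hd w Hw)].
- intros H; split; [apply is_linear_scal_l |].
  intros z Hz eps.
  rewrite <- (is_filter_lim_locally_unique (V := R_NormedModule) x z Hz).
  destruct (H eps (cond_pos eps)) as [d [Hd0 Hd]].
  exists (mkposreal d Hd0); intros w Hw; exact (Hd w Hw).
Qed.

Lemma pderivP (g : R -> C) (t : R) (v : C) : pderiv g t v <->
  forall eps : R, (0 < eps)%R -> exists delta : R, (0 < delta)%R /\
    forall s, (Rabs (s - t) < delta)%R ->
      (Cmod (g s - g t - RtoC (s - t) * v) <= eps * Rabs (s - t))%R.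
Proof.
assert (HRe : forall s, Re (g s - g t - RtoC (s - t) * v)
  = (Re (g s) - Re (g t) - (s - t) * Re v)%R).
{ intros s; unfold Re, RtoC; simpl; ring. }
assert (HIm : forall s, Im (g s - g t - RtoC (s - t) * v)
  = (Im (g s) - Im (g t) - (s - t) * Im v)%R).
{ intros s; unfold Im, RtoC; simpl; ring. }
split.
- intros [H1 H2] eps He.
  destruct (proj1 (is_deriveP _ _ _) H1 (eps / 2)%R ltac:(lra)) as [d1 [Hd1 K1]].
  destruct (proj1 (is_deriveP _ _ _) H2 (eps / 2)%R ltac:(lra)) as [d2 [Hd2 K2]].
  exists (Rmin d1 d2); split; [apply Rmin_pos; assumption |].
  intros s Hs. apply Rle_trans with (1 := Cmod_le_abs _). rewrite HRe, HIm.
  specialize (K1 s (Rlt_le_trans _ _ _ Hs (Rmin_l _ _))).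
  specialize (K2 s (Rlt_le_trans _ _ _ Hs (Rmin_r _ _))). lra.
- intros H; split; apply is_deriveP; intros eps He;
    destruct (H eps He) as [d [Hd K]]; exists d; (split; [exact Hd |]); intros s Hs;
    specialize (K s Hs).
  + rewrite <- HRe. apply Rle_trans with (2 := K). apply re_le_Cmod.
  + rewrite <- HIm. apply Rle_trans with (2 := K). apply im_le_Cmod.
Qed.

Lemma pderiv_comp f (g : R -> C) t l v :
  cderiv f (g t) l -> pderiv g t v -> pderiv (fun s => f (g s)) t (v * l).
Proof.
intros Hf Hg; apply pderivP; intros eps He.
set (B := (Cmod v + 1)%R).
assert (HB : (0 < B)%R) by (pose proof (Cmod_ge_0 v); unfold B; lra).
set (L := (Cmod l + 1)%R).
assert (HL : (0 < L)%R) by (pose proof (Cmod_ge_0 l); unfold L; lra).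
destruct (proj1 (cderivP _ _ _) Hf (eps / (2 * B))%R) as [d1 [Hd1 K1]].
{ apply Rdiv_lt_0_compat; lra. }
(* Half of [eps] goes to the error of [f], half to the error of [g] multiplied by [l]. The cap 1
   yields the Lipschitz estimate [G] with constant [B]. *)
destruct (proj1 (pderivP _ _ _) Hg (Rmin 1 (eps / (2 * L)))%R) as [d2 [Hd2 K2]].
{ apply Rmin_pos; [lra | apply Rdiv_lt_0_compat; lra]. }
exists (Rmin d2 (d1 / B)); split.
{ apply Rmin_pos; [assumption | apply Rdiv_lt_0_compat; assumption]. }
intros s Hs.
specialize (K2 s (Rlt_le_trans _ _ _ Hs (Rmin_l _ _))).
assert (Hs' := Rlt_le_trans _ _ _ Hs (Rmin_r _ _)).
set (h := Rabs (s - t)) in *.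
assert (Hh : (0 <= h)%R) by apply Rabs_pos.
assert (G : (Cmod (g s - g t) <= B * h)%R).
{ replace (g s - g t) with (RtoC (s - t) * v + (g s - g t - RtoC (s - t) * v)) by ring.
  apply Rle_trans with (1 := Cmod_triangle _ _).
  rewrite Cmod_mult, Cmod_R. fold h.
  assert (Rmin 1 (eps / (2 * L)) * h <= 1 * h)%R
    by (apply Rmult_le_compat_r; [assumption | apply Rmin_l]).
  unfold B; lra. }
assert (G1 : (Cmod (g s - g t) < d1)%R).
{ apply Rle_lt_trans with (1 := G).
  apply Rmult_lt_reg_r with (/ B)%R; [apply Rinv_0_lt_compat; exact HB |].
  replace (B * h * / B)%R with h by (field; lra). exact Hs'. }
specialize (K1 (g s) G1).
replace (f (g s) - f (g t) - RtoC (s - t) * (v * l))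
  with ((f (g s) - f (g t) - (g s - g t) * l) + (g s - g t - RtoC (s - t) * v) * l) by ring.
apply Rle_trans with (1 := Cmod_triangle _ _).
rewrite Cmod_mult.
assert (E1 : (eps / (2 * B) * Cmod (g s - g t) <= eps / 2 * h)%R).
{ replace (eps / 2 * h)%R with (eps / (2 * B) * (B * h))%R by (field; lra).
  apply Rmult_le_compat_l; [| exact G]. apply Rlt_le, Rdiv_lt_0_compat; lra. }
assert (E2 : (Cmod (g s - g t - RtoC (s - t) * v) * Cmod l <= eps / 2 * h)%R).
{ apply Rle_trans with (eps / (2 * L) * h * L)%R.
  - apply Rmult_le_compat; [apply Cmod_ge_0 | apply Cmod_ge_0 | |].
    + apply Rle_trans with (1 := K2). apply Rmult_le_compat_r; [exact Hh | apply Rmin_r].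
    + unfold L; lra.
  - right; field; lra. }
lra.
Qed.

Lemma pderiv_affine (z w : C) (t : R) : pderiv (fun s => z + RtoC s * w) t w.
Proof.
split; unfold Re, Im, RtoC; simpl; auto_derive; auto; ring.
Qed.

(** * Means over circles *)

Definition circ (r t : R) : C := (r * cos t, r * sin t)%R.

(** Normalised with respect to the angle, so Cauchy's kernel becomes zeta / (zeta - z) and the k-th
    Taylor coefficient is the mean of F / zeta^k. *)
Definition cmean (r : R) (G : C -> C) : C :=
  (/ (2 * PI) * RInt (fun t => Re (G (circ r t))) 0 (2 * PI),
   / (2 * PI) * RInt (fun t => Im (G (circ r t))) 0 (2 * PI))%R.

(** Continuity in the plane at the points of the circle, not merely along it, so that the rules for
    [ccont] apply. *)
Definition ccirc (r : R) (G : C -> C) : Prop :=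
  forall zeta, Cmod zeta = r -> ccont G zeta.

Lemma Cmod_circ r t : (0 <= r)%R -> Cmod (circ r t) = r.
Proof.
intros Hr; unfold Cmod, circ; simpl.
replace (r * cos t * (r * cos t * 1) + r * sin t * (r * sin t * 1))%R
  with (r² * ((sin t)² + (cos t)²))%R by (unfold Rsqr; ring).
rewrite sin2_cos2, Rmult_1_r. apply sqrt_Rsqr, Hr.
Qed.

Lemma pderiv_circ r t : pderiv (circ r) t (Ci * circ r t).
Proof.
split; unfold circ, Ci, Re, Im; simpl; auto_derive; auto; ring.
Qed.

Lemma path_cont (g : R -> C) t v : pderiv g t v ->
  forall eps : R, (0 < eps)%R -> exists delta : R, (0 < delta)%R /\
    forall s, (Rabs (s - t) < delta)%R -> (Cmod (g s - g t) < eps)%R.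
Proof.
intros Hg eps He.
destruct (proj1 (pderivP _ _ _) Hg 1%R ltac:(lra)) as [d [Hd K]].
set (B := (Cmod v + 1)%R).
assert (HB : (0 < B)%R) by (pose proof (Cmod_ge_0 v); unfold B; lra).
exists (Rmin d (eps / B)); split.
{ apply Rmin_pos; [exact Hd | apply Rdiv_lt_0_compat; assumption]. }
intros s Hs. specialize (K s (Rlt_le_trans _ _ _ Hs (Rmin_l _ _))).
assert (Hs' := Rlt_le_trans _ _ _ Hs (Rmin_r _ _)).
replace (g s - g t) with (RtoC (s - t) * v + (g s - g t - RtoC (s - t) * v)) by ring.
apply Rle_lt_trans with (1 := Cmod_triangle _ _).
rewrite Cmod_mult, Cmod_R.
apply Rle_lt_trans with (Rabs (s - t) * B)%R; [unfold B; lra |].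
apply Rmult_lt_reg_r with (/ B)%R; [apply Rinv_0_lt_compat; exact HB |].
rewrite Rmult_assoc, Rinv_r, Rmult_1_r by lra. exact Hs'.
Qed.

Lemma continuousP (f : R -> R) (x : R) :
  (forall eps : R, (0 < eps)%R -> exists delta : R, (0 < delta)%R /\
    forall y, (Rabs (y - x) < delta)%R -> (Rabs (f y - f x) < eps)%R) ->
  continuous f x.
Proof.
intros H; apply filterlim_locally; intros eps.
destruct (H eps (cond_pos eps)) as [d [Hd0 Hd]].
exists (mkposreal d Hd0); intros w Hw; exact (Hd w Hw).
Qed.

Lemma ccont_path F (g : R -> C) t v : ccont F (g t) -> pderiv g t v ->
  continuous (fun s => Re (F (g s))) t /\ continuous (fun s => Im (F (g s))) t.
Proof.
intros HF Hg.
split; apply continuousP; intros eps He;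
  destruct (proj1 (ccontP _ _) HF eps He) as [d1 [Hd1 K1]];
  destruct (path_cont g t v Hg d1 Hd1) as [d [Hd K]]; exists d; (split; [exact Hd |]);
  intros s Hs; specialize (K1 (g s) (K s Hs)).
- apply Rle_lt_trans with (2 := K1). apply (re_le_Cmod (F (g s) - F (g t))).
- apply Rle_lt_trans with (2 := K1). apply (im_le_Cmod (F (g s) - F (g t))).
Qed.

Lemma ccirc_continuous r G : (0 < r)%R -> ccirc r G -> forall t,
  continuous (fun s => Re (G (circ r s))) t /\ continuous (fun s => Im (G (circ r s))) t.
Proof.
intros Hr HG t. apply ccont_path with (Ci * circ r t); [| apply pderiv_circ].
apply HG, Cmod_circ; lra.
Qed.

Lemma ccirc_ex_RInt r G : (0 < r)%R -> ccirc r G ->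
  ex_RInt (fun t => Re (G (circ r t))) 0 (2 * PI) /\
  ex_RInt (fun t => Im (G (circ r t))) 0 (2 * PI).
Proof.
intros Hr HG; split; apply (ex_RInt_continuous (V := R_CompleteNormedModule));
  intros t _; apply (ccirc_continuous r G Hr HG t).
Qed.

Lemma cmean_ext r G H : (0 < r)%R -> (forall zeta, Cmod zeta = r -> G zeta = H zeta) ->
  cmean r G = cmean r H.
Proof.
intros Hr E; unfold cmean.
f_equal; f_equal; apply RInt_ext; intros t _; rewrite E; auto; apply Cmod_circ; lra.
Qed.

Lemma two_PI_pos : (0 < 2 * PI)%R.
Proof. pose proof PI_RGT_0; lra. Qed.

Lemma cmean_const r c : cmean r (fun _ => c) = c.
Proof.
pose proof two_PI_pos. unfold cmean. rewrite !RInt_const.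
unfold scal; simpl; unfold mult; simpl.
destruct c as [x y]; simpl; f_equal; field; apply PI_neq0.
Qed.

Lemma cmean_plus r G H : (0 < r)%R -> ccirc r G -> ccirc r H ->
  cmean r (fun z => G z + H z) = cmean r G + cmean r H.
Proof.
intros Hr HG HH.
destruct (ccirc_ex_RInt r G Hr HG), (ccirc_ex_RInt r H Hr HH).
apply injective_projections; simpl; rewrite <- Rmult_plus_distr_l; f_equal.
- rewrite <- (RInt_plus (V := R_CompleteNormedModule)) by assumption. reflexivity.
- rewrite <- (RInt_plus (V := R_CompleteNormedModule)) by assumption. reflexivity.
Qed.

Lemma RInt_lin (f g : R -> R) (x y a b : R) : ex_RInt f a b -> ex_RInt g a b ->
  RInt (fun t => x * f t + y * g t)%R a b = (x * RInt f a b + y * RInt g a b)%R.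
Proof.
intros Hf Hg. apply is_RInt_unique.
apply (is_RInt_plus (V := R_NormedModule));
  apply (is_RInt_scal (V := R_NormedModule)); apply (RInt_correct (V := R_CompleteNormedModule));
  assumption.
Qed.

Lemma cmean_scal r c G : (0 < r)%R -> ccirc r G ->
  cmean r (fun z => c * G z) = c * cmean r G.
Proof.
intros Hr HG. destruct (ccirc_ex_RInt r G Hr HG) as [H1 H2].
apply injective_projections; simpl.
- rewrite (RInt_ext _ (fun t => Re c * Re (G (circ r t)) + (- Im c) * Im (G (circ r t)))%R).
  + rewrite RInt_lin by assumption. unfold Re, Im; ring.
  + intros t _; unfold Re, Im; simpl; ring.
- rewrite (RInt_ext _ (fun t => Im c * Re (G (circ r t)) + Re c * Im (G (circ r t)))%R).
  + rewrite RInt_lin by assumption. unfold Re, Im; ring.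
  + intros t _; unfold Re, Im; simpl; ring.
Qed.

Lemma cmean_re_le r G H : (0 < r)%R -> ccirc r G -> ccirc r H ->
  (forall zeta, Cmod zeta = r -> (Re (G zeta) <= Re (H zeta))%R) ->
  (Re (cmean r G) <= Re (cmean r H))%R.
Proof.
intros Hr HG HH E. unfold cmean; simpl.
apply Rmult_le_compat_l; [apply Rlt_le, Rinv_0_lt_compat, two_PI_pos |].
apply RInt_le; [apply Rlt_le, two_PI_pos | exact (proj1 (ccirc_ex_RInt r G Hr HG))
  | exact (proj1 (ccirc_ex_RInt r H Hr HH)) |].
intros t _. apply E, Cmod_circ; lra.
Qed.

(** Rotating by 1, -1, i, -i bounds the two components separately. The lost factor 2 is harmless:
    the estimate only serves to make a geometric remainder tend to 0. *)
Lemma cmean_bound r G H : (0 < r)%R -> ccirc r G -> ccirc r H ->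
  (forall zeta, Cmod zeta = r -> (Cmod (G zeta) <= Re (H zeta))%R) ->
  (Cmod (cmean r G) <= 2 * Re (cmean r H))%R.
Proof.
intros Hr HG HH E.
assert (K : forall c : C, (Cmod c <= 1)%R -> (Re (c * cmean r G) <= Re (cmean r H))%R).
{ intros c Hc. rewrite <- cmean_scal by assumption.
  apply cmean_re_le; [exact Hr | | exact HH |].
  - intros z Hz; apply ccont_mult; [apply ccont_const | apply HG, Hz].
  - intros z Hz. apply Rle_trans with (1 := Rle_abs _).
    apply Rle_trans with (1 := re_le_Cmod _). rewrite Cmod_mult.
    rewrite <- (Rmult_1_l (Re (H z))).
    apply Rmult_le_compat; [apply Cmod_ge_0 | apply Cmod_ge_0 | exact Hc | apply E, Hz]. }
assert (K1 := K 1 ltac:(rewrite Cmod_1; lra)).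
assert (K2 := K (- (1)) ltac:(rewrite Cmod_opp, Cmod_1; lra)).
assert (K3 := K Ci ltac:(rewrite Cmod_Ci; lra)).
assert (K4 := K (- Ci) ltac:(rewrite Cmod_opp, Cmod_Ci; lra)).
clear K. revert K1 K2 K3 K4. generalize (cmean r H) (cmean r G); intros h g.
rewrite !re_mult. unfold Ci, Re, Im; simpl. intros K1 K2 K3 K4.
apply Rle_trans with (1 := Cmod_le_abs _). unfold Re, Im.
assert (Rabs (fst g) <= fst h)%R by (apply Rabs_le; lra).
assert (Rabs (snd g) <= fst h)%R by (apply Rabs_le; lra).
lra.
Qed.

(** Up to the factor i, z F'(z) is the derivative in t of [F (circ r t)], which takes the same value
    at 0 and at 2 PI. *)
Lemma cmean_deriv r F F' : (0 < r)%R ->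
  (forall zeta, Cmod zeta = r -> cderiv F zeta (F' zeta) /\ ccont F' zeta) ->
  cmean r (fun z => z * F' z) = 0.
Proof.
intros Hr HF.
assert (HG : ccirc r (fun z => Ci * (z * F' z))).
{ intros z Hz; apply ccont_mult; [apply ccont_const |].
  apply ccont_mult; [apply ccont_id | apply HF, Hz]. }
assert (HD : forall t, pderiv (fun s => F (circ r s)) t (Ci * (circ r t * F' (circ r t)))).
{ intros t. replace (Ci * (circ r t * F' (circ r t))) with (Ci * circ r t * F' (circ r t)) by ring.
  apply pderiv_comp; [| apply pderiv_circ].
  apply HF, Cmod_circ; lra. }
assert (E0 : circ r (2 * PI) = circ r 0).
{ unfold circ. rewrite cos_2PI, sin_2PI, cos_0, sin_0. reflexivity. }
assert (M : cmean r (fun z => Ci * (z * F' z)) = 0).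
{ unfold cmean. apply injective_projections; simpl.
  - rewrite (is_RInt_unique _ _ _ (minus (Re (F (circ r (2 * PI)))) (Re (F (circ r 0))))).
    + rewrite E0. unfold minus, plus, opp; simpl. ring.
    + apply (is_RInt_derive (V := R_CompleteNormedModule) (fun t => Re (F (circ r t))) (fun t => Re (Ci * (circ r t * F' (circ r t))))).
      * intros t _. apply HD.
      * intros t _. apply (ccirc_continuous r _ Hr HG t).
  - rewrite (is_RInt_unique _ _ _ (minus (Im (F (circ r (2 * PI)))) (Im (F (circ r 0))))).
    + rewrite E0. unfold minus, plus, opp; simpl. ring.
    + apply (is_RInt_derive (V := R_CompleteNormedModule) (fun t => Im (F (circ r t))) (fun t => Im (Ci * (circ r t * F' (circ r t))))).
      * intros t _. apply HD.
      * intros t _. apply (ccirc_continuous r _ Hr HG t). }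
rewrite cmean_scal in M.
- replace (cmean r (fun z => z * F' z)) with (- Ci * (Ci * cmean r (fun z => z * F' z))).
  + rewrite M; ring.
  + rewrite Cmult_assoc. replace (- Ci * Ci) with (RtoC 1); [ring |].
    unfold Ci, Cmult, Copp, RtoC; simpl; f_equal; ring.
- exact Hr.
- intros z Hz; apply ccont_mult; [apply ccont_id | apply HF, Hz].
Qed.

(** * Joint continuity, required for differentiation under the integral sign *)

Definition cont2 (g : R -> R -> C) (x y : R) : Prop :=
  continuity_2d_pt (fun u v => Re (g u v)) x y /\ continuity_2d_pt (fun u v => Im (g u v)) x y.

Lemma cont2_comp F g x y : ccont F (g x y) -> cont2 g x y -> cont2 (fun u v => F (g u v)) x y.
Proof.
intros HF [H1 H2].
assert (K : forall eps : posreal, locally_2d (fun u v => (Cmod (F (g u v) - F (g x y)) < eps)%R) x y).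
{ intros eps.
  destruct (proj1 (ccontP _ _) HF eps (cond_pos eps)) as [d [Hd K]].
  assert (Hd2 : (0 < d / 2)%R) by lra.
  destruct (H1 (mkposreal _ Hd2)) as [d1 K1].
  destruct (H2 (mkposreal _ Hd2)) as [d2 K2].
  exists (mkposreal (Rmin d1 d2) (Rmin_stable_in_posreal d1 d2)). simpl in *.
  intros u v Hu Hv. apply K. apply Rle_lt_trans with (1 := Cmod_le_abs _).
  specialize (K1 u v (Rlt_le_trans _ _ _ Hu (Rmin_l _ _)) (Rlt_le_trans _ _ _ Hv (Rmin_l _ _))).
  specialize (K2 u v (Rlt_le_trans _ _ _ Hu (Rmin_r _ _)) (Rlt_le_trans _ _ _ Hv (Rmin_r _ _))).
  change (Re (g u v - g x y)) with (Re (g u v) - Re (g x y))%R.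
  change (Im (g u v - g x y)) with (Im (g u v) - Im (g x y))%R. lra. }
split; intros eps; destruct (K eps) as [d Kd]; exists d; intros u v Hu Hv;
  (eapply Rle_lt_trans; [| exact (Kd u v Hu Hv)]).
- apply (re_le_Cmod (F (g u v) - F (g x y))).
- apply (im_le_Cmod (F (g u v) - F (g x y))).
Qed.

Lemma cont2_mult g h x y : cont2 g x y -> cont2 h x y -> cont2 (fun u v => g u v * h u v) x y.
Proof.
intros [H1 H2] [H3 H4]; split.
- apply continuity_2d_pt_ext with (fun u v => Re (g u v) * Re (h u v) - Im (g u v) * Im (h u v))%R.
  { intros; rewrite re_mult; ring. }
  apply continuity_2d_pt_minus; apply continuity_2d_pt_mult; assumption.
- apply continuity_2d_pt_ext with (fun u v => Re (g u v) * Im (h u v) + Im (g u v) * Re (h u v))%R.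
  { intros; rewrite im_mult; ring. }
  apply continuity_2d_pt_plus; apply continuity_2d_pt_mult; assumption.
Qed.

Lemma cont2_circ r x y : cont2 (fun _ t => circ r t) x y.
Proof.
split; unfold circ, Re, Im; simpl; apply continuity_2d_pt_mult;
  try apply continuity_2d_pt_const.
- apply (continuity_1d_2d_pt_comp cos (fun _ v => v)); [apply continuity_cos | apply continuity_2d_pt_id2].
- apply (continuity_1d_2d_pt_comp sin (fun _ v => v)); [apply continuity_sin | apply continuity_2d_pt_id2].
Qed.

Lemma cont2_segment z r x y : cont2 (fun u t => z + RtoC u * (circ r t - z)) x y.
Proof.
destruct (cont2_circ r x y) as [H1 H2]. split.
- apply continuity_2d_pt_ext with (fun u t => Re z + u * (Re (circ r t) - Re z))%R.
  { intros; unfold Re; simpl; ring. }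
  apply continuity_2d_pt_plus; [apply continuity_2d_pt_const |].
  apply continuity_2d_pt_mult; [apply continuity_2d_pt_id1 |].
  apply continuity_2d_pt_minus; [exact H1 | apply continuity_2d_pt_const].
- apply continuity_2d_pt_ext with (fun u t => Im z + u * (Im (circ r t) - Im z))%R.
  { intros; unfold Im; simpl; ring. }
  apply continuity_2d_pt_plus; [apply continuity_2d_pt_const |].
  apply continuity_2d_pt_mult; [apply continuity_2d_pt_id1 |].
  apply continuity_2d_pt_minus; [exact H2 | apply continuity_2d_pt_const].
Qed.

(** * Cauchy's formula *)

(** The parameter may leave [0, 1] by (1 - r)/4 on either side, which gives an open interval for
    differentiating in [u]. There |1 - u| + |u| <= 1 + (1 - r)/2, and r (1 + (1 - r)/2) < 1 because
    (1 - r)(2 - r) > 0. *)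
Lemma segment_Omega z r (u : R) zeta : (Cmod z < r)%R -> (r < 1)%R -> Cmod zeta = r ->
  (- ((1 - r) / 4) < u < 1 + (1 - r) / 4)%R -> Omega (z + RtoC u * (zeta - z)).
Proof.
intros Hz Hr Hzeta Hu. unfold Omega. pose proof (Cmod_ge_0 z).
replace (z + RtoC u * (zeta - z)) with (RtoC (1 - u) * z + RtoC u * zeta)
  by (rewrite RtoC_minus; ring).
apply Rle_lt_trans with (1 := Cmod_triangle _ _). rewrite !Cmod_mult, !Cmod_R, Hzeta.
assert (Hs : (Rabs (1 - u) + Rabs u <= 1 + (1 - r) / 2)%R).
{ unfold Rabs; destruct (Rcase_abs (1 - u)), (Rcase_abs u); lra. }
assert (Rabs (1 - u) * Cmod z <= Rabs (1 - u) * r)%R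
  by (apply Rmult_le_compat_l; [apply Rabs_pos | lra]).
assert ((Rabs (1 - u) + Rabs u) * r <= (1 + (1 - r) / 2) * r)%R
  by (apply Rmult_le_compat_r; lra).
nra.
Qed.

Lemma circ_neq z r zeta : (Cmod z < r)%R -> Cmod zeta = r -> zeta - z <> 0.
Proof.
intros Hz Hzeta E.
assert (zeta = z) by (rewrite <- (Cplus_0_r z), <- E; ring). subst zeta. lra.
Qed.

Lemma ccirc_kernel z r : (Cmod z < r)%R -> ccirc r (fun zeta => zeta / (zeta - z)).
Proof.
intros Hz zeta Hzeta.
apply ccont_mult; [apply ccont_id |].
apply (ccont_comp Cinv (fun w => w - z)).
- apply (cderiv_ccont _ _ _ (cderiv_inv _ (circ_neq z r zeta Hz Hzeta))).
- apply (ccont_plus (fun w => w) (fun _ => - z)); [apply ccont_id | apply ccont_const].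
Qed.

(* Moving the argument of [F] from the circle to [z] along segments does not change the
   integral: its derivative in the parameter [u] is the mean of
   [zeta * F' (z + u (zeta - z))], a derivative along the circle. *)
Lemma homotopy_re F z r : holo Omega F -> (Cmod z < r)%R -> (r < 1)%R ->
  Re (cmean r (fun zeta => F zeta * (zeta / (zeta - z)))) =
  Re (cmean r (fun zeta => F z * (zeta / (zeta - z)))).
Proof.
intros [F' HF] Hz Hr.
assert (Hr0 : (0 < r)%R) by (pose proof (Cmod_ge_0 z); lra).
set (e := ((1 - r) / 4)%R). assert (He : (0 < e)%R) by (unfold e; lra).
set (k := fun zeta => zeta / (zeta - z)).
set (f := fun u t => Re (F (z + RtoC u * (circ r t - z)) * k (circ r t))).
assert (HC : forall t, Cmod (circ r t) = r) by (intros t; apply Cmod_circ; lra).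
assert (HO : forall u t, (- e < u < 1 + e)%R -> Omega (z + RtoC u * (circ r t - z))).
{ intros u t Hu. apply segment_Omega with r; auto. }
(* The factor zeta - z produced by the chain rule cancels the denominator of the kernel. *)
set (df := fun u t => Re (circ r t * F' (z + RtoC u * (circ r t - z)))).
assert (Hd : forall u t, (- e < u < 1 + e)%R -> is_derive (fun v => f v t) u (df u t)).
{ intros u t Hu.
  assert (P : pderiv (fun v => F (z + RtoC v * (circ r t - z))) u
     ((circ r t - z) * F' (z + RtoC u * (circ r t - z)))).
  { apply pderiv_comp; [apply HF, HO, Hu | apply pderiv_affine]. }
  assert (P2 := pderiv_comp (fun w => k (circ r t) * w) _ u _ _
    (cderiv_scal (k (circ r t)) (fun w => w) _ _ (cderiv_id _)) P).
  destruct P2 as [P2 _].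
  apply (is_derive_ext (fun v => Re (k (circ r t) * F (z + RtoC v * (circ r t - z)))));
    [intros v; unfold f; f_equal; ring |].
  replace (df u t) with (Re ((circ r t - z) * F' (z + RtoC u * (circ r t - z)) * (k (circ r t) * 1)));
    [exact P2 |].
  unfold df, k; f_equal. field. apply circ_neq with r; auto. }
assert (Hcont : forall u, (- e < u < 1 + e)%R ->
  ccirc r (fun zeta => F (z + RtoC u * (zeta - z)) * k zeta)).
{ intros u Hu zeta Hzeta. apply ccont_mult; [| apply ccirc_kernel with r; assumption].
  apply (ccont_comp F (fun w => z + RtoC u * (w - z))).
  - apply (cderiv_ccont _ _ _ (proj1 (HF _ (segment_Omega z r u zeta Hz Hr Hzeta Hu)))).
  - apply ccont_plus; [apply ccont_const |]. apply ccont_mult; [apply ccont_const |].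
    apply (ccont_plus (fun w => w) (fun _ => - z)); [apply ccont_id | apply ccont_const]. }
assert (Hloc : forall u, (- e < u < 1 + e)%R -> locally u (fun v => (- e < v < 1 + e)%R)).
{ intros u Hu. apply (open_and _ _ (open_gt (- e)) (open_lt (1 + e))). exact Hu. }
set (phi := fun u => RInt (fun t => f u t) 0 (2 * PI)).
assert (Hphi : forall u, (- e < u < 1 + e)%R ->
  is_derive phi u (RInt (fun t => Derive (fun v => f v t) u) 0 (2 * PI))).
{ intros u Hu. apply is_derive_RInt_param.
  - apply filter_imp with (2 := Hloc u Hu). intros v Hv t _. exists (df v t). apply Hd, Hv.
  - intros t _. apply continuity_2d_pt_ext_loc with df.
    + destruct (Hloc u Hu) as [d Hd']. exists d. intros v s Hv _.
      symmetry; apply is_derive_unique, Hd, Hd', Hv.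
    + apply (cont2_mult (fun _ s => circ r s) (fun v s => F' (z + RtoC v * (circ r s - z)))).
      * apply cont2_circ.
      * apply (cont2_comp F' (fun v s => z + RtoC v * (circ r s - z))); [apply HF, HO, Hu | apply cont2_segment].
  - apply filter_imp with (2 := Hloc u Hu). intros v Hv.
    exact (proj1 (ccirc_ex_RInt r _ Hr0 (Hcont v Hv))). }
assert (H0 : forall u, (0 < u < 1)%R -> RInt (fun t => Derive (fun v => f v t) u) 0 (2 * PI) = 0%R).
{ intros u Hu.
  assert (Hu' : (- e < u < 1 + e)%R) by lra.
  assert (Hu0 : RtoC u <> 0) by (intros E; apply RtoC_inj in E; lra).
  (* F' (z + u (zeta - z)) is the derivative in zeta of F (z + u (zeta - z)) / u. This requires u <>
     0, but the mean value theorem below asks for the derivative only inside (0, 1). *)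
  assert (M := cmean_deriv r (fun zeta => / RtoC u * F (z + RtoC u * (zeta - z)))
    (fun zeta => F' (z + RtoC u * (zeta - z))) Hr0).
  rewrite (RInt_ext _ (fun t => df u t)) by (intros t _; apply is_derive_unique, Hd, Hu').
  unfold cmean in M. pose proof two_PI_pos.
  enough (E : (/ (2 * PI) * RInt (fun t => df u t) 0 (2 * PI) = 0)%R).
  { apply Rmult_integral in E. destruct E as [E | E]; [| exact E].
    pose proof (Rinv_0_lt_compat _ two_PI_pos). lra. }
  apply (f_equal Re) in M; [exact M |]. clear M.
  intros zeta Hzeta. assert (HO' := segment_Omega z r u zeta Hz Hr Hzeta Hu').
  destruct (HF _ HO') as [D1 D2].
  assert (Daff : cderiv (fun w => z + RtoC u * (w - z)) zeta (RtoC u)).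
  { apply cderiv_eq with (0 + RtoC u * (1 + 0)); [ring |].
    apply cderiv_plus; [apply cderiv_const |]. apply cderiv_scal.
    apply (cderiv_plus (fun w => w) (fun _ => - z)); [apply cderiv_id | apply cderiv_const]. }
  split.
  - apply cderiv_eq with (/ RtoC u * (RtoC u * F' (z + RtoC u * (zeta - z)))).
    { field. exact Hu0. }
    apply cderiv_scal. apply (cderiv_comp F (fun w => z + RtoC u * (w - z))); assumption.
  - apply (ccont_comp F' (fun w => z + RtoC u * (w - z))); [exact D2 |].
    exact (cderiv_ccont _ _ _ Daff). }
destruct (MVT_gen phi 0 1 (fun _ => 0%R)) as [c [_ Hc]].
- rewrite Rmin_left, Rmax_right by lra. intros u Hu.
  rewrite <- (H0 u Hu). apply Hphi; lra.
- rewrite Rmin_left, Rmax_right by lra. intros u Hu.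
  apply continuity_pt_filterlim.
  apply (ex_derive_continuous (K := R_AbsRing) (V := R_NormedModule)).
  eexists; apply Hphi; lra.
- assert (Hphi01 : phi 1%R = phi 0%R) by lra.
  apply (f_equal (Rmult (/ (2 * PI)))).
  replace (RInt (fun t => Re (F (circ r t) * (circ r t / (circ r t - z)))) 0 (2 * PI)) with (phi 1%R).
  + rewrite Hphi01. unfold phi, f. apply RInt_ext. intros t _. unfold k.
    repeat f_equal. ring.
  + unfold phi, f. apply RInt_ext. intros t _. unfold k. repeat f_equal. ring.
Qed.

(** The imaginary part is [homotopy_re] applied to -i F. The mean of the kernel stays unevaluated
    until [cmean_kernel]. *)
Lemma cauchy_homotopy F z r : holo Omega F -> (Cmod z < r)%R -> (r < 1)%R ->
  cmean r (fun zeta => F zeta * (zeta / (zeta - z))) =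
  F z * cmean r (fun zeta => zeta / (zeta - z)).
Proof.
intros HF Hz Hr.
assert (Hr0 : (0 < r)%R) by (pose proof (Cmod_ge_0 z); lra).
assert (HFc : ccirc r F).
{ intros w Hw. apply (holo_ccont Omega F w HF). unfold Omega; lra. }
assert (Hk := ccirc_kernel z r Hz).
assert (HG : ccirc r (fun zeta => F zeta * (zeta / (zeta - z)))).
{ intros w Hw. apply ccont_mult; auto. }
rewrite <- cmean_scal by assumption.
assert (E1 := homotopy_re F z r HF Hz Hr).
assert (E2 := homotopy_re (fun w => - Ci * F w) z r (holo_scal _ _ _ HF) Hz Hr).
rewrite (cmean_ext r _ (fun zeta => - Ci * (F zeta * (zeta / (zeta - z)))) Hr0) in E2
  by (intros; ring).
rewrite (cmean_ext r (fun zeta => - Ci * F z * (zeta / (zeta - z)))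
  (fun zeta => - Ci * (F z * (zeta / (zeta - z)))) Hr0) in E2 by (intros; ring).
rewrite !(cmean_scal r (- Ci)) in E2; try assumption.
- rewrite !re_mult in E2. unfold Ci, Re, Im in E1, E2.
  apply injective_projections; [exact E1 |]. simpl in E2. simpl. lra.
- intros w Hw. apply ccont_mult; [apply ccont_const | apply Hk, Hw].
Qed.

(** * Complex power series *)

Definition cseries (u : nat -> C) (l : C) : Prop :=
  is_series (K := C_AbsRing) (V := C_NormedModule) u l.

Definition expands (rd : R) (a : nat -> C) (F : C -> C) : Prop :=
  forall z, (Cmod z < rd)%R -> cseries (fun n => a n * z ^ n) (F z).

(** A stand-in for the radius of convergence: convergence implies it because terms are bounded, it
    implies convergence by comparison, and it visibly survives shifts, differentiation and
    integration of coefficients. *)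
Definition coef_bounded (rd : R) (a : nat -> C) : Prop :=
  forall rho : R, (0 < rho < rd)%R ->
    exists M : R, forall n, (Cmod (a n) * rho ^ n <= M)%R.

Lemma pow_n_Cpow (z : C) n : pow_n (K := C_Ring) z n = z ^ n.
Proof. induction n as [| n IH]; [reflexivity |]. simpl; rewrite IH; reflexivity. Qed.

Lemma is_pseries_cseries a z l :
  is_pseries (K := C_AbsRing) (V := C_NormedModule) a z l <-> cseries (fun n => a n * z ^ n) l.
Proof.
split; apply (is_series_ext (K := C_AbsRing) (V := C_NormedModule)); intros n.
- rewrite <- pow_n_Cpow. apply Cmult_comm.
- rewrite <- pow_n_Cpow. apply Cmult_comm.
Qed.

Lemma has_expansion_expands F a : has_expansion F a <-> expands 1 a F.
Proof.
split; intros H z Hz; apply is_pseries_cseries; apply H; exact Hz.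
Qed.

Lemma cseriesP u l : cseries u l <->
  forall eps : R, (0 < eps)%R -> exists N, forall n, (N <= n)%nat ->
    (Cmod (sum_n (G := C_AbelianMonoid) u n - l) < eps)%R.
Proof.
unfold cseries, is_series; split.
- intros H eps He.
  (* Balls of [C_NormedModule] control [Cmod] only up to the factor sqrt 2, which the halving
     absorbs. *)
  assert (He2 : (0 < eps / 2)%R) by lra.
  destruct (proj1 (filterlim_locally _ _) H (mkposreal _ He2)) as [N HN].
  exists N. intros n Hn. specialize (HN n Hn).
  apply C_NormedModule_mixin_compat2 in HN.
  apply Rlt_le_trans with (1 := HN). simpl.
  assert (sqrt 2 <= 2)%R.
  { rewrite <- (sqrt_Rsqr 2) at 2 by lra. apply sqrt_le_1_alt. unfold Rsqr; lra. }
  nra.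
- intros H. apply filterlim_locally. intros eps.
  destruct (H eps (cond_pos eps)) as [N HN]. exists N. intros n Hn.
  apply C_NormedModule_mixin_compat1. exact (HN n Hn).
Qed.

Lemma cseries_unique u l m : cseries u l -> cseries u m -> l = m.
Proof.
intros Hl Hm.
exact (filterlim_locally_unique (K := C_AbsRing) (V := C_NormedModule) _ l m Hl Hm).
Qed.

Lemma cseries_ext u v l : (forall n, u n = v n) -> cseries u l -> cseries v l.
Proof. intros E; apply is_series_ext; exact E. Qed.

Lemma cseries_plus u v l m : cseries u l -> cseries v m -> cseries (fun n => u n + v n) (l + m).
Proof. intros Hu Hv; exact (is_series_plus u v l m Hu Hv). Qed.

Lemma cseries_scal c u l : cseries u l -> cseries (fun n => c * u n) (c * l).
Proof. intros Hu; exact (is_series_scal c u l Hu). Qed.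

Lemma cseries_shift u l : cseries u l <-> cseries (fun n => u (S n)) (l - u 0%nat).
Proof.
split; intros H.
- apply (is_series_incr_1 (K := C_AbsRing) (V := C_NormedModule) u (l - u 0%nat)).
  replace (plus (G := C_NormedModule) (l - u 0%nat) (u 0%nat)) with l; [exact H |].
  change (l = l - u 0%nat + u 0%nat). ring.
- apply (is_series_decr_1 (K := C_AbsRing) (V := C_NormedModule)). exact H.
Qed.

Lemma cseries_terms_bounded u l : cseries u l -> exists M : R, forall n, (Cmod (u n) <= M)%R.
Proof.
intros H.
destruct (filterlim_bounded (K := C_AbsRing) (V := C_NormedModule) (sum_n u)) as [M HM].
{ exists l; exact H. }
change (forall n, Cmod (sum_n (G := C_AbelianMonoid) u n) <= M)%R in HM.
exists (2 * M)%R. intros [| n].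
- specialize (HM 0%nat). rewrite sum_O in HM. pose proof (Cmod_ge_0 (u 0%nat)). lra.
- replace (u (S n)) with (sum_n (G := C_AbelianMonoid) u (S n) + - sum_n (G := C_AbelianMonoid) u n).
  + apply Rle_trans with (1 := Cmod_triangle _ _). rewrite Cmod_opp.
    pose proof (HM n). pose proof (HM (S n)). lra.
  + rewrite sum_Sn. change (sum_n (G := C_AbelianMonoid) u n + u (S n) + - sum_n (G := C_AbelianMonoid) u n = u (S n)). ring.
Qed.

Lemma cseries_le u l (v : nat -> R) (S : R) : cseries u l ->
  (forall n, (Cmod (u n) <= v n)%R) -> is_series v S -> (Cmod l <= S)%R.
Proof.
intros Hu Huv Hv.
assert (Hs : forall n, (Cmod (sum_n (G := C_AbelianMonoid) u n) <= sum_n v n)%R).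
{ induction n as [| n IH].
  - rewrite !sum_O. apply Huv.
  - rewrite !sum_Sn. apply Rle_trans with (1 := Cmod_triangle _ _).
    apply Rplus_le_compat; [exact IH | apply Huv]. }
assert (HS : forall n, (sum_n v n <= S)%R).
{ apply is_lim_seq_incr_compare; [exact Hv |]. intros n. rewrite sum_Sn.
  unfold plus; simpl. pose proof (Huv (Datatypes.S n)). pose proof (Cmod_ge_0 (u (Datatypes.S n))). lra. }
apply le_epsilon. intros eps He.
destruct (proj1 (cseriesP u l) Hu eps He) as [N HN].
specialize (HN N (Nat.le_refl N)). specialize (Hs N). specialize (HS N).
pose proof (Cmod_triangle_minus l (sum_n (G := C_AbelianMonoid) u N)) as T.
rewrite Cmod_minus_sym in T. lra.
Qed.

Lemma expands_coef_bounded rd a F : expands rd a F -> coef_bounded rd a.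
Proof.
intros H rho Hrho.
destruct (cseries_terms_bounded _ _ (H rho ltac:(rewrite Cmod_R, Rabs_pos_eq; lra))) as [M HM].
exists M. intros n. specialize (HM n).
rewrite Cmod_mult, Cmod_pow, Cmod_R, Rabs_pos_eq in HM by lra. exact HM.
Qed.

Lemma ratio_bound (x rho : R) : (0 <= x < rho)%R -> (0 <= x / rho < 1)%R.
Proof.
intros H; split.
- apply Rmult_le_pos; [lra | apply Rlt_le, Rinv_0_lt_compat; lra].
- apply Rmult_lt_reg_r with rho; [lra |]. unfold Rdiv; rewrite Rmult_assoc, Rinv_l by lra. lra.
Qed.

(** Comparison with the geometric series of ratio |z| / rho, where rho lies halfway between |z| and
    [rd]. *)
Lemma coef_bounded_ex rd a z : coef_bounded rd a -> (Cmod z < rd)%R ->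
  exists l, cseries (fun n => a n * z ^ n) l.
Proof.
intros H Hz. pose proof (Cmod_ge_0 z) as Hz0.
set (rho := ((Cmod z + rd) / 2)%R).
destruct (H rho) as [M HM]; [unfold rho; lra |].
assert (Hq := ratio_bound (Cmod z) rho ltac:(unfold rho; lra)).
apply (ex_series_le (K := C_AbsRing) (V := C_CompleteNormedModule) _ (fun n => M * (Cmod z / rho) ^ n)%R).
- intros n. change (Cmod (a n * z ^ n) <= M * (Cmod z / rho) ^ n)%R.
  rewrite Cmod_mult, Cmod_pow.
  replace (Cmod (a n) * Cmod z ^ n)%R with (Cmod (a n) * rho ^ n * (Cmod z / rho) ^ n)%R.
  + apply Rmult_le_compat_r; [apply pow_le; lra | apply HM].
  + unfold Rdiv. rewrite Rpow_mult_distr, pow_inv.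
    field. apply pow_nonzero. unfold rho; lra.
- apply (ex_series_scal (K := R_AbsRing) (V := R_NormedModule)), ex_series_geom.
  rewrite Rabs_pos_eq; lra.
Qed.

(** A total function, so that a sum can be named before its convergence is established. *)
Definition csum (a : nat -> C) (z : C) : C :=
  (Series (fun n => Re (a n * z ^ n)), Series (fun n => Im (a n * z ^ n))).

Lemma csum_correct a z l : cseries (fun n => a n * z ^ n) l -> csum a z = l.
Proof.
intros H.
assert (HRe : forall u n, Re (sum_n (G := C_AbelianMonoid) u n) = sum_n (fun k => Re (u k)) n).
{ induction n as [| n IH]; [rewrite !sum_O; reflexivity |].
  rewrite !sum_Sn, <- IH. reflexivity. }
assert (HIm : forall u n, Im (sum_n (G := C_AbelianMonoid) u n) = sum_n (fun k => Im (u k)) n).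
{ induction n as [| n IH]; [rewrite !sum_O; reflexivity |].
  rewrite !sum_Sn, <- IH. reflexivity. }
pose proof (proj1 (cseriesP _ _) H) as K.
apply injective_projections; apply is_series_unique; apply filterlim_locally; intros eps;
  destruct (K eps (cond_pos eps)) as [N HN]; exists N; intros n Hn; specialize (HN n Hn);
  (eapply Rle_lt_trans; [| exact HN]).
- rewrite <- HRe. apply (re_le_Cmod (sum_n (G := C_AbelianMonoid) (fun k => a k * z ^ k) n - l)).
- rewrite <- HIm. apply (im_le_Cmod (sum_n (G := C_AbelianMonoid) (fun k => a k * z ^ k) n - l)).
Qed.

Lemma coef_bounded_expands rd a : coef_bounded rd a -> expands rd a (csum a).
Proof.
intros H z Hz. destruct (coef_bounded_ex rd a z H Hz) as [l Hl].
rewrite (csum_correct a z l Hl). exact Hl.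
Qed.

Definition dcoef (a : nat -> C) (n : nat) : C := RtoC (INR (S n)) * a (S n).

Definition pcoef (a : nat -> C) (n : nat) : C :=
  match n with O => 0 | S m => a m / RtoC (INR (S m)) end.

Lemma INR_S_neq0 n : RtoC (INR (S n)) <> 0.
Proof. intros E; apply RtoC_inj in E. apply (not_0_INR (S n)) in E; [exact E | lia]. Qed.

Lemma dcoef_pcoef a n : dcoef (pcoef a) n = a n.
Proof. unfold dcoef, pcoef. field. apply INR_S_neq0. Qed.

(* [(n + 1) q^n <= 1 + q + ... + q^n] *)
Lemma linear_geom_bound (q : R) n : (0 <= q < 1)%R -> (INR (S n) * q ^ n <= / (1 - q))%R.
Proof.
intros Hq.
assert (H : (INR (S n) * q ^ n <= sum_n (fun k => q ^ k) n)%R).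
{ induction n as [| n IH].
  - rewrite sum_O. simpl. lra.
  - rewrite sum_Sn.
    change (INR (S (S n)) * q ^ S n <= sum_n (fun k => q ^ k) n + q * q ^ n)%R.
    rewrite (S_INR (S n)). simpl pow.
    generalize dependent (sum_n (fun k => q ^ k)%R n). intros s IH.
    assert (0 <= q ^ n)%R by (apply pow_le; lra).
    assert (0 <= INR (S n))%R by apply pos_INR.
    assert (INR (S n) * (q * q ^ n) <= INR (S n) * q ^ n)%R.
    { apply Rmult_le_compat_l; [assumption |]. nra. }
    lra. }
apply Rle_trans with (1 := H).
apply is_lim_seq_incr_compare with (u := sum_n (fun k => q ^ k)%R).
- apply is_series_geom. rewrite Rabs_pos_eq; lra.
- intros m. rewrite sum_Sn. unfold plus; simpl.
  assert (0 <= q ^ m)%R by (apply pow_le; lra). nra.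
Qed.

(** The coefficients are bounded at a larger radius [s], and the factor n + 1 is absorbed by (rho /
    s)^n. *)
Lemma coef_bounded_deriv rd a : coef_bounded rd a -> coef_bounded rd (dcoef a).
Proof.
intros H rho Hrho. set (s := ((rho + rd) / 2)%R).
destruct (H s) as [M HM]; [unfold s; lra |].
assert (Hq := ratio_bound rho s ltac:(unfold s; lra)).
exists (M / s * / (1 - rho / s))%R. intros n. unfold dcoef.
assert (Hs : (0 < s)%R) by (unfold s; lra).
rewrite Cmod_mult, Cmod_R, Rabs_pos_eq by apply pos_INR.
replace (INR (S n) * Cmod (a (S n)) * rho ^ n)%R
  with (Cmod (a (S n)) * s ^ S n / s * (INR (S n) * (rho / s) ^ n))%R.
- assert (K := linear_geom_bound (rho / s) n Hq).
  apply Rmult_le_compat; [| | | exact K].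
  + apply Rmult_le_pos; [| apply Rlt_le, Rinv_0_lt_compat, Hs].
    apply Rmult_le_pos; [apply Cmod_ge_0 | apply pow_le; lra].
  + apply Rmult_le_pos; [apply pos_INR | apply pow_le; lra].
  + apply Rmult_le_compat_r; [apply Rlt_le, Rinv_0_lt_compat, Hs | apply HM].
- unfold Rdiv. rewrite Rpow_mult_distr, pow_inv. simpl pow.
  field. split; [apply pow_nonzero |]; lra.
Qed.

Lemma coef_bounded_shift rd a : coef_bounded rd a -> coef_bounded rd (fun n => a (S n)).
Proof.
intros H rho Hrho. destruct (H rho Hrho) as [M HM]. exists (M / rho)%R. intros n.
apply Rmult_le_reg_r with rho; [lra |]. unfold Rdiv. rewrite (Rmult_assoc M), Rinv_l, Rmult_1_r by lra.
apply Rle_trans with (2 := HM (S n)). simpl. right; ring.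
Qed.

Lemma coef_bounded_prim rd a : coef_bounded rd a -> coef_bounded rd (pcoef a).
Proof.
intros H rho Hrho. destruct (H rho Hrho) as [M HM]. exists (M * rho)%R.
assert (HM0 : (0 <= M)%R).
{ apply Rle_trans with (2 := HM 0%nat). apply Rmult_le_pos; [apply Cmod_ge_0 | simpl; lra]. }
intros [| n].
- simpl. rewrite Cmod_0. nra.
- change (pcoef a (S n)) with (a n / RtoC (INR (S n))).
  rewrite Cmod_div by apply INR_S_neq0. rewrite Cmod_R, Rabs_pos_eq by apply pos_INR.
  specialize (HM n).
  assert (Hn : (1 <= INR (S n))%R) by (rewrite S_INR; pose proof (pos_INR n); lra).
  apply Rle_trans with (Cmod (a n) * rho ^ S n)%R.
  + apply Rmult_le_compat_r; [apply pow_le; lra |].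
    apply Rmult_le_reg_r with (INR (S n)); [lra |].
    unfold Rdiv. rewrite Rmult_assoc, Rinv_l by lra. pose proof (Cmod_ge_0 (a n)). nra.
  + simpl pow. nra.
Qed.

(** If T is the first-order Taylor remainder of the n-th power, the next one is w T + (w - z)^2 n
    z^(n-1), and n^2 + n <= (n + 1)^2 closes the induction. The factor [rho ^ 2] on the left avoids
    the exponent n - 2. *)
Lemma pow_remainder_bound (z w : C) (rho : R) n :
  (0 < rho)%R -> (Cmod z <= rho)%R -> (Cmod w <= rho)%R ->
  (Cmod (w ^ n - z ^ n - (w - z) * (RtoC (INR n) * z ^ pred n)) * rho ^ 2
    <= INR n ^ 2 * rho ^ n * Cmod (w - z) ^ 2)%R.
Proof.
intros Hrho Hz Hw.
induction n as [| n IH].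
- replace (w ^ 0 - z ^ 0 - (w - z) * (RtoC (INR 0) * z ^ pred 0)) with (RtoC 0) by (simpl; ring).
  rewrite Cmod_0. simpl. lra.
- replace (w ^ S n - z ^ S n - (w - z) * (RtoC (INR (S n)) * z ^ pred (S n)))
    with (w * (w ^ n - z ^ n - (w - z) * (RtoC (INR n) * z ^ pred n))
      + (w - z) ^ 2 * (RtoC (INR n) * z ^ pred n)).
  2: { rewrite S_INR, RtoC_plus. destruct n as [| n]; simpl; ring. }
  set (T := w ^ n - z ^ n - (w - z) * (RtoC (INR n) * z ^ pred n)) in *.
  set (D := Cmod (w - z)) in *.
  assert (HD : (0 <= D ^ 2)%R) by apply pow2_ge_0.
  assert (H1 : (Cmod (w * T) * rho ^ 2 <= INR n ^ 2 * rho ^ S n * D ^ 2)%R).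
  { rewrite Cmod_mult. pose proof (Cmod_ge_0 T). pose proof (Cmod_ge_0 w).
    assert (0 <= Cmod T * rho ^ 2)%R by (apply Rmult_le_pos; [assumption | apply pow2_ge_0]).
    apply Rle_trans with (rho * (Cmod T * rho ^ 2))%R; [nra |].
    apply Rle_trans with (rho * (INR n ^ 2 * rho ^ n * D ^ 2))%R; [nra | simpl pow; right; ring]. }
  assert (H2 : (Cmod ((w - z) ^ 2 * (RtoC (INR n) * z ^ pred n)) * rho ^ 2
      <= INR n * rho ^ S n * D ^ 2)%R).
  { rewrite !Cmod_mult, !Cmod_pow, Cmod_R, Rabs_pos_eq by apply pos_INR. fold D.
    destruct n as [| n]; [simpl; lra |].
    simpl pred. assert (K : (Cmod z ^ n <= rho ^ n)%R)
      by (apply pow_incr; split; [apply Cmod_ge_0 | exact Hz]).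
    assert (0 <= INR (S n) * D ^ 2 * rho ^ 2)%R.
    { apply Rmult_le_pos; [apply Rmult_le_pos; [apply pos_INR | exact HD] | apply pow2_ge_0]. }
    apply Rle_trans with (INR (S n) * D ^ 2 * rho ^ 2 * rho ^ n)%R; [nra | simpl pow; right; ring]. }
  apply Rle_trans with ((Cmod (w * T) + Cmod ((w - z) ^ 2 * (RtoC (INR n) * z ^ pred n))) * rho ^ 2)%R.
  { apply Rmult_le_compat_r; [apply pow2_ge_0 | apply Cmod_triangle]. }
  rewrite Rmult_plus_distr_r.
  assert (0 <= rho ^ S n * D ^ 2)%R by (apply Rmult_le_pos; [apply pow_le; lra | exact HD]).
  rewrite S_INR. pose proof (pos_INR n). nra.
Qed.

(** With q = y^4, the bound n y^n <= 1/(1 - y) gives n^2 q^n <= (1 - y)^(-2) (y^2)^n. *)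
Lemma quadratic_geom_summable (q : R) : (0 <= q < 1)%R -> ex_series (fun n => INR n ^ 2 * q ^ n)%R.
Proof.
intros Hq. set (y := sqrt (sqrt q)).
assert (Hy : (y ^ 4 = q)%R).
{ unfold y. replace (sqrt (sqrt q) ^ 4)%R with ((sqrt (sqrt q) ^ 2) ^ 2)%R by ring.
  rewrite !pow2_sqrt; [reflexivity | lra | apply sqrt_pos]. }
assert (Hy0 : (0 <= y)%R) by apply sqrt_pos.
assert (Hy1 : (y < 1)%R).
{ apply Rnot_le_lt. intros H. assert (1 <= y ^ 4)%R by (apply pow_R1_Rle; exact H). lra. }
apply (ex_series_le (K := R_AbsRing) (V := R_CompleteNormedModule) _ (fun n => (/ (1 - y)) ^ 2 * (y ^ 2) ^ n)%R).
- intros n. change (norm (INR n ^ 2 * q ^ n)%R) with (Rabs (INR n ^ 2 * q ^ n)%R).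
  rewrite Rabs_pos_eq by (apply Rmult_le_pos; [apply pow2_ge_0 | apply pow_le; lra]).
  rewrite <- Hy. replace ((y ^ 4) ^ n)%R with ((y ^ n) ^ 2 * (y ^ 2) ^ n)%R.
  2: { rewrite <- !pow_mult, <- pow_add. f_equal. lia. }
  rewrite <- Rmult_assoc. apply Rmult_le_compat_r; [apply pow_le, pow2_ge_0 |].
  rewrite <- Rpow_mult_distr. apply pow_incr.
  assert (0 <= y ^ n)%R by (apply pow_le; lra).
  assert (K := linear_geom_bound y n ltac:(lra)). rewrite S_INR in K. pose proof (pos_INR n).
  split; nra.
- apply (ex_series_scal (K := R_AbsRing) (V := R_NormedModule)), ex_series_geom.
  rewrite Rabs_pos_eq by apply pow2_ge_0. nra.
Qed.

(** Termwise remainders add up to O(|w - z|^2). Two radii |z| < rho < s < rd are needed: [rho]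
    limits the points [w], [s] the coefficients, and rho / s makes the majorant summable. *)
Lemma expands_cderiv rd a F F1 z : expands rd a F -> expands rd (dcoef a) F1 ->
  (Cmod z < rd)%R -> cderiv F z (F1 z).
Proof.
intros HF HF1 Hz. pose proof (Cmod_ge_0 z) as Hz0.
set (rho := ((2 * Cmod z + rd) / 3)%R). set (s := ((Cmod z + 2 * rd) / 3)%R).
assert (Hrho : (Cmod z < rho < s)%R) by (unfold rho, s; lra).
assert (HsR : (s < rd)%R) by (unfold s; lra).
destruct (expands_coef_bounded rd a F HF s) as [M HM]; [lra |].
assert (Hq := ratio_bound rho s ltac:(lra)).
destruct (quadratic_geom_summable (rho / s) Hq) as [Q HQ].
set (B := (M * Q / rho ^ 2)%R).
assert (Hrho2 : (0 < rho ^ 2)%R) by (apply pow_lt; lra).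
assert (HB : forall w, (Cmod w < rho)%R ->
  (Cmod (F w - F z - (w - z) * F1 z) <= B * Cmod (w - z) ^ 2)%R).
{ intros w Hw.
  assert (HD : cseries (fun n => a n * (RtoC (INR n) * z ^ pred n)) (F1 z)).
  { apply cseries_shift. cbv beta.
    replace (F1 z - a 0%nat * (RtoC (INR 0) * z ^ pred 0)) with (F1 z).
    - apply cseries_ext with (2 := HF1 z Hz). intros n. unfold dcoef. simpl pred. ring.
    - simpl. ring. }
  assert (HS : cseries (fun n => a n * (w ^ n - z ^ n - (w - z) * (RtoC (INR n) * z ^ pred n)))
      (F w - F z - (w - z) * F1 z)).
  { replace (F w - F z - (w - z) * F1 z)
      with (F w + (- (1)) * F z + (- (w - z)) * F1 z) by ring.
    apply cseries_ext with (2 := cseries_plus _ _ _ _ (cseries_plus _ _ _ _ (HF w ltac:(lra))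
        (cseries_scal (- (1)) _ _ (HF z Hz))) (cseries_scal (- (w - z)) _ _ HD)).
    intros n. cbv beta. ring. }
  apply (cseries_le _ _ (fun n => (M / rho ^ 2 * Cmod (w - z) ^ 2) * (INR n ^ 2 * (rho / s) ^ n))%R
     _ HS).
  - intros n. rewrite Cmod_mult.
    assert (K := pow_remainder_bound z w rho n ltac:(lra) ltac:(lra) ltac:(lra)).
    set (T := Cmod (w ^ n - z ^ n - (w - z) * (RtoC (INR n) * z ^ pred n))) in *.
    apply Rmult_le_reg_r with (1 := Hrho2). rewrite Rmult_assoc.
    apply Rle_trans with (Cmod (a n) * (INR n ^ 2 * rho ^ n * Cmod (w - z) ^ 2))%R.
    { apply Rmult_le_compat_l; [apply Cmod_ge_0 | exact K]. }
    apply Rle_trans with (Cmod (a n) * s ^ n * (INR n ^ 2 * (rho / s) ^ n * Cmod (w - z) ^ 2))%R.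
    { right. unfold Rdiv; rewrite Rpow_mult_distr, pow_inv. field. apply pow_nonzero; lra. }
    apply Rle_trans with (M * (INR n ^ 2 * (rho / s) ^ n * Cmod (w - z) ^ 2))%R.
    { apply Rmult_le_compat_r; [| apply HM].
      apply Rmult_le_pos; [apply Rmult_le_pos |]; [apply pow2_ge_0 | apply pow_le; lra | apply pow2_ge_0]. }
    right. field. lra.
  - replace (B * Cmod (w - z) ^ 2)%R with (M / rho ^ 2 * Cmod (w - z) ^ 2 * Q)%R
      by (unfold B; field; lra).
    exact (is_series_scal (K := R_AbsRing) (V := R_NormedModule) _ _ _ HQ). }
(* The signs of [M] and [Q] are unknown; that of [B] is read off from the estimate at one point [w]
   different from [z]. *)
assert (HB0 : (0 <= B)%R).
{ assert (Hw1 : (Cmod z < rho)%R) by lra.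
  set (w := RtoC ((Cmod z + rho) / 2)).
  assert (Hw : Cmod w = ((Cmod z + rho) / 2)%R) by (unfold w; rewrite Cmod_R, Rabs_pos_eq; lra).
  assert (K := HB w ltac:(lra)). pose proof (Cmod_ge_0 (F w - F z - (w - z) * F1 z)).
  assert (0 < Cmod (w - z))%R.
  { pose proof (Cmod_triangle_minus w z). lra. }
  assert (0 < Cmod (w - z) ^ 2)%R by (apply pow_lt; assumption).
  apply Rnot_lt_le; intros HBn. nra. }
apply cderivP. intros eps He.
exists (Rmin (rho - Cmod z) (eps / (B + 1))). split.
{ apply Rmin_pos; [lra | apply Rdiv_lt_0_compat; lra]. }
intros w Hw.
assert (H1 := Rlt_le_trans _ _ _ Hw (Rmin_l _ _)).
assert (H2 := Rlt_le_trans _ _ _ Hw (Rmin_r _ _)).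
apply Rle_trans with (1 := HB w ltac:(pose proof (Cmod_triangle_minus w z); lra)).
pose proof (Cmod_ge_0 (w - z)).
simpl. rewrite Rmult_1_r, <- Rmult_assoc. apply Rmult_le_compat_r; [assumption |].
assert (Cmod (w - z) * (B + 1) < eps)%R.
{ apply Rmult_lt_reg_r with (/ (B + 1))%R; [apply Rinv_0_lt_compat; lra |].
  rewrite Rmult_assoc, Rinv_r, Rmult_1_r by lra. exact H2. }
nra.
Qed.

(** * Power series expansion of holomorphic functions *)

Lemma expands_coef_ext rd a b F : (forall n, a n = b n) -> expands rd a F -> expands rd b F.
Proof.
intros E H z Hz. apply cseries_ext with (2 := H z Hz). intros n. rewrite E. reflexivity.
Qed.

Lemma expands_0 rd a F : (0 < rd)%R -> expands rd a F -> F 0 = a 0%nat.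
Proof.
intros Hr H. apply cseries_unique with (fun n => a n * 0 ^ n).
- apply H. rewrite Cmod_0. exact Hr.
- apply is_pseries_cseries. exact (is_pseries_0 (K := C_AbsRing) (V := C_NormedModule) a).
Qed.

Lemma expands_deriv rd a F z : expands rd a F -> (Cmod z < rd)%R ->
  cderiv F z (csum (dcoef a) z).
Proof.
intros H Hz. apply expands_cderiv with rd a; [exact H | | exact Hz].
apply coef_bounded_expands, coef_bounded_deriv, (expands_coef_bounded rd a F H).
Qed.

Lemma expands_dcoef rd a F : expands rd a F -> expands rd (dcoef a) (csum (dcoef a)).
Proof.
intros H. apply coef_bounded_expands, coef_bounded_deriv, (expands_coef_bounded rd a F H).
Qed.

Lemma expands_ccont rd a F z : expands rd a F -> (Cmod z < rd)%R -> ccont F z.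
Proof.
intros H Hz. apply (cderiv_ccont _ _ _ (expands_deriv rd a F z H Hz)).
Qed.

Lemma expands_primitive rd a F : expands rd a F ->
  expands rd (pcoef a) (csum (pcoef a)) /\
  forall z, (Cmod z < rd)%R -> cderiv (csum (pcoef a)) z (F z).
Proof.
intros H.
assert (HP : expands rd (pcoef a) (csum (pcoef a))).
{ apply coef_bounded_expands, coef_bounded_prim, (expands_coef_bounded rd a F H). }
split; [exact HP |]. intros z Hz. apply expands_cderiv with rd (pcoef a); [exact HP | | exact Hz].
apply expands_coef_ext with a; [intros n; symmetry; apply dcoef_pcoef | exact H].
Qed.

(** Division by z on coefficients, which also settles the value of the quotient at 0. *)
Lemma expands_shift rd a F : (0 < rd)%R -> expands rd a F -> exists G,
  expands rd (fun n => a (S n)) G /\ forall z, (Cmod z < rd)%R -> F z = a 0%nat + z * G z.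
Proof.
intros Hr H. exists (csum (fun n => a (S n))).
assert (HG : expands rd (fun n => a (S n)) (csum (fun n => a (S n)))).
{ apply coef_bounded_expands, coef_bounded_shift, (expands_coef_bounded rd a F H). }
split; [exact HG |]. intros z Hz.
assert (K := proj1 (cseries_shift _ _) (H z Hz)).
assert (K2 := cseries_scal z _ _ (HG z Hz)).
assert (E : F z - a 0%nat * z ^ 0 = z * csum (fun n => a (S n)) z).
{ apply (cseries_unique _ _ _ K). apply cseries_ext with (2 := K2).
  intros n. simpl. ring. }
rewrite <- E. simpl. ring.
Qed.

(** * Taylor coefficients as means over circles *)

Lemma cderiv_pow n z : cderiv (fun w => w ^ S n) z (RtoC (INR (S n)) * z ^ n).
Proof.
induction n as [| n IH].
- apply cderiv_eq with (1 * 1 + z * 0); [simpl; ring |].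
  exact (cderiv_mult (fun w => w) (fun _ => 1) z 1 0 (cderiv_id z) (cderiv_const 1 z)).
- apply cderiv_eq with (1 * z ^ S n + z * (RtoC (INR (S n)) * z ^ n)).
  { rewrite (S_INR (S n)), RtoC_plus. simpl Cpow. ring. }
  exact (cderiv_mult (fun w => w) (fun w => w ^ S n) z _ _ (cderiv_id z) IH).
Qed.

Lemma ccirc_inv_pow r k : (0 < r)%R -> ccirc r (fun z => / z ^ k).
Proof.
intros Hr z Hz.
assert (Hz0 : z <> 0) by (apply Cmod_gt_0; lra).
apply (ccont_comp Cinv (fun w => w ^ k)).
- apply (cderiv_ccont _ _ _ (cderiv_inv _ (Cpow_nz z k Hz0))).
- exact (holo_ccont (fun _ => True) _ z (holo_pow _ k) I).
Qed.

(** z^-(k+1) is z times z^-(k+2), and the latter is a derivative off the origin. *)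
Lemma cmean_inv_pow r k : (0 < r)%R -> cmean r (fun z => / z ^ S k) = 0.
Proof.
intros Hr.
rewrite (cmean_ext r _ (fun z => z * / z ^ S (S k)) Hr).
- apply (cmean_deriv r (fun z => - / RtoC (INR (S k)) * / z ^ S k)); [exact Hr |].
  intros z Hz. assert (Hz0 : z <> 0) by (apply Cmod_gt_0; lra).
  split; [| apply (ccirc_inv_pow r (S (S k)) Hr z Hz)].
  eapply cderiv_eq; [| apply cderiv_scal, (cderiv_comp Cinv (fun w => w ^ S k));
    [apply cderiv_inv, Cpow_nz, Hz0 | apply cderiv_pow]].
  pose proof (INR_S_neq0 k). pose proof (Cpow_nz z k Hz0).
  simpl Cpow. field. auto.
- intros z Hz. assert (Hz0 : z <> 0) by (apply Cmod_gt_0; lra).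
  pose proof (Cpow_nz z k Hz0). simpl Cpow. field. auto.
Qed.

(** Termwise integration is avoided. Writing F = a0 + z G lowers k by one, at the cost of a mean of
    a negative power; for k = 0 the mean of z G vanishes because G has a primitive. *)
Lemma cmean_coef rd k : forall a F r, expands rd a F -> (0 < r < rd)%R ->
  cmean r (fun z => F z * / z ^ k) = a k.
Proof.
induction k as [| k IH]; intros a F r H Hr;
  destruct (expands_shift rd a F ltac:(lra) H) as [G [HG E]].
- rewrite (cmean_ext r _ (fun z => a 0%nat + z * G z)) by
    (try lra; intros z Hz; rewrite E by lra; simpl; field).
  rewrite cmean_plus.
  + rewrite cmean_const.
    destruct (expands_primitive rd _ G HG) as [_ HP].
    rewrite (cmean_deriv r (csum (pcoef (fun n => a (S n))))); [ring | lra |].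
    intros z Hz; split; [apply HP; lra | apply (expands_ccont rd _ G z HG); lra].
  + lra.
  + intros z Hz; apply ccont_const.
  + intros z Hz; apply ccont_mult; [apply ccont_id | apply (expands_ccont rd _ G z HG); lra].
- rewrite (cmean_ext r _ (fun z => a 0%nat * / z ^ S k + G z * / z ^ k)).
  + rewrite cmean_plus, cmean_scal, cmean_inv_pow, (IH _ G r HG Hr); try lra; try ring.
    * apply ccirc_inv_pow; lra.
    * intros z Hz; apply ccont_mult; [apply ccont_const | apply (ccirc_inv_pow r (S k)); lra].
    * intros z Hz; apply ccont_mult; [apply (expands_ccont rd _ G z HG); lra | apply (ccirc_inv_pow r k); lra].
  + lra.
  + intros z Hz. assert (Hz0 : z <> 0) by (apply Cmod_gt_0; lra).
    pose proof (Cpow_nz z k Hz0). rewrite E by lra. simpl Cpow. field. auto.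
Qed.

Lemma expands_unique rd a b F : (0 < rd)%R -> expands rd a F -> expands rd b F ->
  forall n, a n = b n.
Proof.
intros Hr Ha Hb n.
rewrite <- (cmean_coef rd n a F (rd / 2) Ha), <- (cmean_coef rd n b F (rd / 2) Hb) by lra. reflexivity.
Qed.

(** [G] need only be continuous on the circle. The finite geometric expansion of w / (w - z) leaves
    the remainder z^(n+1) w^-(n+1) w / (w - z), whose mean against [G] is O((|z| / r)^n). *)
Lemma cauchy_kernel_series r G z : (Cmod z < r)%R -> ccirc r G ->
  cseries (fun k => cmean r (fun w => G w * / w ^ k) * z ^ k)
    (cmean r (fun w => G w * (w / (w - z)))).
Proof.
intros Hz HG.
assert (Hr : (0 < r)%R) by (pose proof (Cmod_ge_0 z); lra).
set (H := fun w => G w * (w / (w - z))).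
assert (HH : ccirc r H).
{ intros w Hw. apply ccont_mult; [apply HG, Hw | apply (ccirc_kernel z r Hz w Hw)]. }
assert (Hpart : forall n, sum_n (G := C_AbelianMonoid) (fun k => cmean r (fun w => G w * / w ^ k) * z ^ k) n
  + z ^ S n * cmean r (fun w => H w * / w ^ S n) = cmean r H).
{ assert (Hstep : forall n, cmean r (fun w => H w * / w ^ n) =
    cmean r (fun w => G w * / w ^ n) + z * cmean r (fun w => H w * / w ^ S n)).
  { intros n. rewrite <- cmean_scal, <- cmean_plus.
    - apply cmean_ext; [exact Hr |]. intros w Hw.
      assert (Hw0 : w <> 0) by (apply Cmod_gt_0; lra).
      pose proof (Cpow_nz w n Hw0). pose proof (circ_neq z r w Hz Hw).
      unfold H. simpl Cpow. field. auto.
    - exact Hr.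
    - intros w Hw; apply ccont_mult; [apply HG, Hw | apply (ccirc_inv_pow r n Hr w Hw)].
    - intros w Hw; apply ccont_mult; [apply ccont_const |].
      apply ccont_mult; [apply HH, Hw | apply (ccirc_inv_pow r (S n) Hr w Hw)].
    - exact Hr.
    - intros w Hw; apply ccont_mult; [apply HH, Hw | apply (ccirc_inv_pow r (S n) Hr w Hw)]. }
  induction n as [| n IH].
  - rewrite sum_O. rewrite (cmean_ext r H (fun w => H w * / w ^ 0)), (Hstep 0%nat);
      [simpl Cpow; ring | exact Hr |].
    intros w _. simpl. field.
  - rewrite sum_Sn. rewrite <- IH. rewrite (Hstep (S n)).
    match goal with |- context [plus ?x ?y] => change (plus x y) with (x + y) end.
    simpl Cpow. ring. }
set (A := fun w => RtoC (Cmod (H w))).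
assert (HA : ccirc r A).
{ intros w Hw. apply ccontP. intros eps He.
  destruct (proj1 (ccontP _ _) (HH w Hw) eps He) as [d [Hd K]].
  exists d; split; [exact Hd |]. intros v Hv. specialize (K v Hv).
  unfold A. rewrite <- RtoC_minus, Cmod_R.
  pose proof (Cmod_triangle_minus (H v) (H w)).
  pose proof (Cmod_triangle_minus (H w) (H v)) as T. rewrite (Cmod_minus_sym (H w)) in T.
  apply Rle_lt_trans with (2 := K). apply Rabs_le. lra. }
set (B := (2 * Re (cmean r A))%R).
assert (HB : forall n, (Cmod (z ^ n * cmean r (fun w => H w * / w ^ n)%C) <= B * (Cmod z / r) ^ n)%R).
{ intros n. rewrite Cmod_mult, Cmod_pow.
  assert (K : (Cmod (cmean r (fun w => H w * / w ^ n)%C) <= 2 * Re (cmean r (fun w => RtoC (/ r ^ n) * A w)%C))%R).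
  { apply cmean_bound; [exact Hr | | |].
    - intros w Hw; apply ccont_mult; [apply HH, Hw | apply (ccirc_inv_pow r n Hr w Hw)].
    - intros w Hw; apply ccont_mult; [apply ccont_const | apply HA, Hw].
    - intros w Hw. assert (Hw0 : w <> 0) by (apply Cmod_gt_0; lra).
      rewrite Cmod_mult, Cmod_inv, Cmod_pow, Hw by (apply Cpow_nz, Hw0).
      unfold A. rewrite <- RtoC_mult. simpl. right; ring. }
  rewrite cmean_scal in K by assumption.
  replace (B * (Cmod z / r) ^ n)%R
    with (Cmod z ^ n * (2 * Re (RtoC (/ r ^ n) * cmean r A)))%R.
  - apply Rmult_le_compat_l; [apply pow_le, Cmod_ge_0 | exact K].
  - unfold B, Rdiv. rewrite Rpow_mult_distr, pow_inv, re_mult.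
    change (Re (RtoC (/ r ^ n))) with (/ r ^ n)%R. change (Im (RtoC (/ r ^ n))) with 0%R. ring. }
assert (Hq := ratio_bound (Cmod z) r ltac:(pose proof (Cmod_ge_0 z); lra)).
assert (HL : is_lim_seq (fun n => B * (Cmod z / r) ^ n)%R 0).
{ replace (Finite 0) with (Rbar_mult B 0) by (simpl; f_equal; ring).
  apply is_lim_seq_scal_l, is_lim_seq_geom. rewrite Rabs_pos_eq; lra. }
apply cseriesP. intros eps He.
destruct (proj1 (filterlim_locally _ _) HL (mkposreal eps He)) as [N HN].
exists N. intros n Hn. rewrite <- (Hpart n).
match goal with |- context [Cmod (?s - (?s + ?t))] => replace (s - (s + t)) with (- t) by ring end.
rewrite Cmod_opp. apply Rle_lt_trans with (1 := HB (S n)).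
specialize (HN (S n) ltac:(lia)).
change (Rabs (B * (Cmod z / r) ^ S n - 0) < eps)%R in HN.
rewrite Rminus_0_r in HN. apply Rle_lt_trans with (2 := HN). apply Rle_abs.
Qed.

Lemma expands_const rd c : expands rd (fun n => match n with O => c | S _ => 0 end) (fun _ => c).
Proof.
intros z _. apply cseries_shift. cbv beta iota.
replace (c - c * z ^ 0) with (RtoC 0) by (simpl; ring).
apply cseriesP. intros eps He. exists 0%nat. intros n _.
replace (sum_n (G := C_AbelianMonoid) (fun n => 0 * z ^ S n) n) with (RtoC 0).
- replace (0 - 0) with (RtoC 0) by ring. rewrite Cmod_0. exact He.
- induction n as [| n IH]; [rewrite sum_O; ring |].
  rewrite sum_Sn, <- IH. match goal with |- context [plus ?x ?y] => change (plus x y) with (x + y) end. ring.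
Qed.

(** For G = 1 the coefficients of [cauchy_kernel_series] are means of pure powers, so only the
    constant term 1 survives. *)
Lemma cmean_kernel r z : (Cmod z < r)%R -> cmean r (fun w => w / (w - z)) = 1.
Proof.
intros Hz. assert (Hr : (0 < r)%R) by (pose proof (Cmod_ge_0 z); lra).
assert (K := cauchy_kernel_series r (fun _ => 1) z Hz (fun w _ => ccont_const 1 w)).
rewrite (cmean_ext r _ (fun w => 1 * (w / (w - z))) Hr) by (intros; ring).
apply (cseries_unique _ _ _ K).
apply cseries_ext with (2 := expands_const r 1 z Hz).
intros n. rewrite (cmean_coef (2 * r) n _ _ r (expands_const (2 * r) 1)) by lra. reflexivity.
Qed.

Theorem holo_expands F : holo Omega F -> exists a, expands 1 a F.
Proof.
intros HF.
assert (Hloc : forall r, (0 < r < 1)%R -> expands r (fun k => cmean r (fun w => F w * / w ^ k)) F).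
{ intros r Hr z Hz.
  assert (HFc : ccirc r F).
  { intros w Hw. apply (holo_ccont Omega F w HF). unfold Omega; lra. }
  assert (K := cauchy_kernel_series r F z Hz HFc).
  rewrite cauchy_homotopy, cmean_kernel in K by (assumption || lra).
  rewrite Cmult_1_r in K. exact K. }
exists (fun k => cmean (1 / 2) (fun w => F w * / w ^ k)).
intros z Hz.
(* The coefficients are fixed at radius 1/2, while convergence at [z] requires a radius beyond |z|.
   Both expansions hold on the disc of radius 1/2, where uniqueness identifies them. *)
set (r := Rmax (1 / 2) ((1 + Cmod z) / 2)).
assert (Hr1 : (1 / 2 <= r)%R) by apply Rmax_l.
assert (Hr2 : ((1 + Cmod z) / 2 <= r)%R) by apply Rmax_r.
assert (Hr3 : (r < 1)%R) by (unfold r; apply Rmax_lub_lt; lra).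
apply cseries_ext with (2 := Hloc r ltac:(lra) z ltac:(lra)).
intros n. cbv beta. f_equal.
assert (E : expands (1 / 2) (fun k => cmean r (fun w => F w * / w ^ k)) F).
{ intros w Hw. apply Hloc; lra. }
exact (expands_unique (1 / 2) _ _ F ltac:(lra) E (Hloc (1 / 2)%R ltac:(lra)) n).
Qed.

Lemma expands_holo a F : expands 1 a F -> holo Omega F.
Proof.
intros H. exists (csum (dcoef a)). intros z Hz. split.
- exact (expands_deriv 1 a F z H Hz).
- exact (expands_ccont 1 _ _ z (expands_dcoef 1 a F H) Hz).
Qed.

Lemma expands_plus rd a b F G : expands rd a F -> expands rd b G ->
  expands rd (fun n => a n + b n) (fun z => F z + G z).
Proof.
intros HF HG z Hz. apply cseries_ext with (2 := cseries_plus _ _ _ _ (HF z Hz) (HG z Hz)).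
intros n. cbv beta. ring.
Qed.

Lemma expands_scal rd c a F : expands rd a F -> expands rd (fun n => c * a n) (fun z => c * F z).
Proof.
intros HF z Hz. apply cseries_ext with (2 := cseries_scal c _ _ (HF z Hz)).
intros n. cbv beta. ring.
Qed.

Lemma expands_incr rd a F : expands rd a F ->
  expands rd (fun n => match n with O => 0 | S m => a m end) (fun z => z * F z).
Proof.
intros HF z Hz. apply cseries_shift. cbv beta iota.
replace (z * F z - 0 * z ^ 0) with (z * F z) by ring.
apply cseries_ext with (2 := cseries_scal z _ _ (HF z Hz)).
intros n. cbv beta. simpl Cpow. ring.
Qed.

Lemma expands_ext rd a F G : (forall z, (Cmod z < rd)%R -> F z = G z) ->
  expands rd a F -> expands rd a G.
Proof. intros E H z Hz. rewrite <- (E z Hz). exact (H z Hz). Qed.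

(** No double series occurs: F G = a0 G + z (F1 G), where F1 G is holomorphic and so has an
    expansion. Uniqueness gives the coefficient of order n + 1 from that of F1 G of order n. *)
Lemma expands_mult_coef n : forall a b c F G,
  expands 1 a F -> expands 1 b G -> expands 1 c (fun z => F z * G z) ->
  c n = sum_n (G := C_AbelianMonoid) (fun k => a k * b (n - k)%nat) n.
Proof.
induction n as [| n IH]; intros a b c F G Ha Hb Hc.
- rewrite sum_O. rewrite <- (expands_0 1 c _ ltac:(lra) Hc).
  rewrite (expands_0 1 a F), (expands_0 1 b G); (assumption || lra || reflexivity).
- destruct (expands_shift 1 a F ltac:(lra) Ha) as [F1 [HF1 E]].
  destruct (holo_expands (fun z => F1 z * G z)) as [d Hd].
  { apply holo_mult; eapply expands_holo; eassumption. }
  assert (Hc2 := expands_plus 1 _ _ _ _ (expands_scal 1 (a 0%nat) b G Hb) (expands_incr 1 d _ Hd)).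
  assert (Ec : c (S n) = a 0%nat * b (S n) + d n).
  { refine (expands_unique 1 _ _ _ ltac:(lra) Hc (expands_ext 1 _ _ _ _ Hc2) (S n)).
    intros z Hz. cbv beta. rewrite (E z Hz). ring. }
  rewrite Ec, (IH _ _ _ _ _ HF1 Hb Hd).
  unfold sum_n.
  rewrite (sum_Sn_m (G := C_AbelianMonoid) (fun k => a k * b (S n - k)%nat) 0 (S n)) by lia.
  rewrite <- (sum_n_m_S (G := C_AbelianMonoid) (fun k => a k * b (S n - k)%nat) 0 n).
  reflexivity.
Qed.

(** * Exponential, logarithm and square root *)

Lemma Omega_0 : Omega 0.
Proof. unfold Omega; rewrite Cmod_0; lra. Qed.

Lemma Omega_convex z w (t : R) : Omega z -> Omega w -> (0 <= t <= 1)%R ->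
  Omega (z + RtoC t * (w - z)).
Proof.
unfold Omega; intros Hz Hw Ht.
replace (z + RtoC t * (w - z)) with (RtoC (1 - t) * z + RtoC t * w)
  by (rewrite RtoC_minus; ring).
apply Rle_lt_trans with (1 := Cmod_triangle _ _).
rewrite !Cmod_mult, !Cmod_R, !Rabs_pos_eq by lra.
pose proof (Cmod_ge_0 z). pose proof (Cmod_ge_0 w).
destruct (Req_dec t 0) as [-> | Ht0]; [lra |].
assert (t * Cmod w < t * 1)%R by (apply Rmult_lt_compat_l; lra).
assert ((1 - t) * Cmod z <= (1 - t) * 1)%R by (apply Rmult_le_compat_l; lra).
lra.
Qed.

(** The mean value theorem fails for complex values, hence the real part and the free factor [c]: c
    = 1 gives the real part, c = -i the imaginary part, and c = conj (w - z) gives univalence. *)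
Lemma complex_mvt F F' (c z w : C) : (forall u, Omega u -> cderiv F u (F' u)) ->
  Omega z -> Omega w -> exists t : R, (0 <= t <= 1)%R /\
    Re (c * (F w - F z)) = Re (c * ((w - z) * F' (z + RtoC t * (w - z)))).
Proof.
intros HF Hz Hw.
set (g := fun t : R => c * F (z + RtoC t * (w - z))).
assert (Hg : forall t, (0 <= t <= 1)%R ->
  is_derive (fun s => Re (g s)) t (Re (c * ((w - z) * F' (z + RtoC t * (w - z)))))).
{ intros t Ht.
  assert (P := pderiv_comp F (fun s => z + RtoC s * (w - z)) t _ _
    (HF _ (Omega_convex z w t Hz Hw Ht)) (pderiv_affine z (w - z) t)).
  assert (P2 := pderiv_comp (fun v => c * v) _ t _ _
    (cderiv_scal c (fun v => v) _ _ (cderiv_id _)) P).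
  destruct P2 as [P2 _]. unfold g.
  replace (c * ((w - z) * F' (z + RtoC t * (w - z))))
    with ((w - z) * F' (z + RtoC t * (w - z)) * (c * 1)) by ring. exact P2. }
destruct (MVT_gen (fun s => Re (g s)) 0 1
  (fun t => Re (c * ((w - z) * F' (z + RtoC t * (w - z)))))) as [t [Ht E]].
- rewrite Rmin_left, Rmax_right by lra. intros t Ht. apply Hg; lra.
- rewrite Rmin_left, Rmax_right by lra. intros t Ht. apply continuity_pt_filterlim.
  apply (ex_derive_continuous (K := R_AbsRing) (V := R_NormedModule)).
  eexists; apply Hg; lra.
- rewrite Rmin_left, Rmax_right in Ht by lra. exists t; split; [exact Ht |].
  rewrite Rminus_0_r, Rmult_1_r in E. rewrite <- E. unfold g.
  replace (z + RtoC 1 * (w - z)) with w by ring.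
  replace (z + RtoC 0 * (w - z)) with z by ring.
  replace (c * (F w - F z)) with (c * F w - c * F z) by ring. reflexivity.
Qed.

Lemma deriv0_const F : (forall z, Omega z -> cderiv F z 0) -> forall z, Omega z -> F z = F 0.
Proof.
intros HF z Hz.
destruct (complex_mvt F (fun _ => 0) 1 0 z HF Omega_0 Hz) as [t [_ E1]].
destruct (complex_mvt F (fun _ => 0) (- Ci) 0 z HF Omega_0 Hz) as [t' [_ E2]].
rewrite Cmult_0_r, Cmult_0_r in E1, E2. rewrite Cmult_1_l in E1.
rewrite re_mult in E2. unfold Ci, Re, Im in E1, E2. simpl in E1, E2.
apply injective_projections; lra.
Qed.

Lemma Cexp_plus z w : Cexp (z + w) = Cexp z * Cexp w.
Proof.
unfold Cexp. destruct z as [x y], w as [x' y']. unfold Re, Im, Cplus, Cmult; simpl.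
rewrite exp_plus, cos_plus, sin_plus. f_equal; ring.
Qed.

Lemma Cexp_0 : Cexp 0 = 1.
Proof.
unfold Cexp, Re, Im, RtoC; simpl. rewrite exp_0, cos_0, sin_0. f_equal; ring.
Qed.

Lemma Cexp_opp z : Cexp (- z) * Cexp z = 1.
Proof. rewrite <- Cexp_plus. replace (- z + z) with (RtoC 0) by ring. apply Cexp_0. Qed.

Lemma Cexp_neq0 z : Cexp z <> 0.
Proof.
intros E. assert (K := Cexp_opp z). rewrite E, Cmult_0_r in K.
apply C1_nz. symmetry. exact K.
Qed.

Lemma Cmod_Cexp z : Cmod (Cexp z) = exp (Re z).
Proof.
unfold Cmod, Cexp; simpl.
replace (_ + _)%R with ((exp (Re z))² * ((sin (Im z))² + (cos (Im z))²))%R by (unfold Rsqr; ring).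
rewrite sin2_cos2, Rmult_1_r. apply sqrt_Rsqr, Rlt_le, exp_pos.
Qed.

Lemma cderiv_Cexp_0 : cderiv Cexp 0 1.
Proof.
apply cderivP. intros eps He.
(* Each component of the remainder is at most 3 e |w|, so eps/8 suffices; e <= 1 is used for exp x
   <= 2. *)
set (e := Rmin 1 (eps / 8)).
assert (He0 : (0 < e)%R) by (apply Rmin_pos; lra).
assert (He1 : (e <= 1)%R) by apply Rmin_l.
assert (He2 : (e <= eps / 8)%R) by apply Rmin_r.
assert (D1 : is_derive exp 0%R 1%R) by (auto_derive; auto; rewrite exp_0; ring).
assert (D2 : is_derive cos 0%R 0%R) by (auto_derive; auto; rewrite sin_0; ring).
assert (D3 : is_derive sin 0%R 1%R) by (auto_derive; auto; rewrite cos_0; ring).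
destruct (proj1 (is_deriveP _ _ _) D1 e He0) as [d1 [Hd1 K1]].
destruct (proj1 (is_deriveP _ _ _) D2 e He0) as [d2 [Hd2 K2]].
destruct (proj1 (is_deriveP _ _ _) D3 e He0) as [d3 [Hd3 K3]].
set (d := Rmin (Rmin d1 d2) (Rmin d3 (e / 2))).
exists d; split; [repeat apply Rmin_pos; lra |].
assert (Hda : (d <= Rmin d1 d2)%R) by apply Rmin_l.
assert (Hdb : (d <= Rmin d3 (e / 2))%R) by apply Rmin_r.
pose proof (Rmin_l d1 d2). pose proof (Rmin_r d1 d2).
pose proof (Rmin_l d3 (e / 2)). pose proof (Rmin_r d3 (e / 2)).
intros w Hw. replace (w - 0) with w in * by ring.
pose proof (re_le_Cmod w) as Hx. pose proof (im_le_Cmod w) as Hy.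
set (x := Re w) in *. set (y := Im w) in *.
specialize (K1 x). specialize (K2 y). specialize (K3 y).
rewrite Rminus_0_r in K1, K2, K3. rewrite exp_0 in K1. rewrite cos_0 in K2. rewrite sin_0 in K3.
specialize (K1 ltac:(lra)). specialize (K2 ltac:(lra)). specialize (K3 ltac:(lra)).
rewrite Rmult_1_r in K1, K3. rewrite Rmult_0_r in K2. rewrite Rminus_0_r in K2, K3.
assert (E1 : (Rabs (exp x - 1) <= e)%R).
{ replace (exp x - 1)%R with ((exp x - 1 - x) + x)%R by ring.
  apply Rle_trans with (1 := Rabs_triang _ _). pose proof (Rabs_pos x). nra. }
assert (E2 : (0 < exp x <= 2)%R).
{ split; [apply exp_pos |]. pose proof (Rle_abs (exp x - 1)). lra. }
rewrite Cexp_0. apply Rle_trans with (1 := Cmod_le_abs _).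
assert (R1 : (Rabs (Re (Cexp w - 1 - w * 1)) <= 2 * e * Rabs y + e * Rabs x)%R).
{ replace (Re (Cexp w - 1 - w * 1)) with (exp x * (cos y - 1) + (exp x - 1 - x))%R
    by (unfold x, y, Cexp, Re, Im; simpl; ring).
  apply Rle_trans with (1 := Rabs_triang _ _). rewrite Rabs_mult, (Rabs_pos_eq (exp x)) by lra.
  pose proof (Rabs_pos (cos y - 1)). nra. }
assert (R2 : (Rabs (Im (Cexp w - 1 - w * 1)) <= 2 * e * Rabs y + e * Rabs y)%R).
{ replace (Im (Cexp w - 1 - w * 1)) with (exp x * (sin y - y) + (exp x - 1) * y)%R
    by (unfold x, y, Cexp, Re, Im; simpl; ring).
  apply Rle_trans with (1 := Rabs_triang _ _). rewrite !Rabs_mult, (Rabs_pos_eq (exp x)) by lra.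
  pose proof (Rabs_pos (sin y - y)). pose proof (Rabs_pos y). nra. }
pose proof (Cmod_ge_0 w). nra.
Qed.

Lemma cderiv_Cexp z : cderiv Cexp z (Cexp z).
Proof.
apply cderiv_ext with (f := fun w => Cexp z * Cexp (w + - z)).
{ intros w. rewrite <- Cexp_plus. f_equal. ring. }
assert (D := cderiv_plus (fun w => w) (fun _ => - z) z _ _ (cderiv_id z) (cderiv_const (- z) z)).
assert (D0 : cderiv Cexp (z + - z) 1).
{ replace (z + - z) with (RtoC 0) by ring. apply cderiv_Cexp_0. }
apply cderiv_eq with (2 := cderiv_scal (Cexp z) _ _ _ (cderiv_comp Cexp (fun w => w + - z) z _ _ D0 D)).
ring.
Qed.

Lemma holo_Cexp : holo (fun _ => True) Cexp.
Proof.
exists Cexp. intros z _. split; [apply cderiv_Cexp | apply (cderiv_ccont _ _ _ (cderiv_Cexp z))].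
Qed.

Lemma holo_exp D f : holo D f -> holo D (fun z => Cexp (f z)).
Proof. intros H. apply (holo_comp D (fun _ => True) Cexp f holo_Cexp H). auto. Qed.

Lemma holo_derivative F : holo Omega F -> exists F1, holo Omega F1 /\
  forall z, Omega z -> cderiv F z (F1 z).
Proof.
intros H. destruct (holo_expands F H) as [a Ha].
exists (csum (dcoef a)); split; [exact (expands_holo _ _ (expands_dcoef 1 a F Ha)) |].
intros z Hz; exact (expands_deriv 1 a F z Ha Hz).
Qed.

Lemma holo_primitive F : holo Omega F -> exists P, holo Omega P /\ P 0 = 0 /\
  forall z, Omega z -> cderiv P z (F z).
Proof.
intros H. destruct (holo_expands F H) as [a Ha].
destruct (expands_primitive 1 a F Ha) as [H1 H2].
exists (csum (pcoef a)); split; [exact (expands_holo _ _ H1) |]. split; [| exact H2].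
apply (expands_0 1 _ _ ltac:(lra) H1).
Qed.

(** exp(-P) Q has derivative 0 on the disc and equals 1 at the origin. *)
Lemma exp_primitive_unique P Q h : (forall z, Omega z -> cderiv P z (h z)) ->
  (forall z, Omega z -> cderiv Q z (h z * Q z)) -> P 0 = 0 -> Q 0 = 1 ->
  forall z, Omega z -> Cexp (P z) = Q z.
Proof.
intros HP HQ HP0 HQ0 z Hz.
assert (E : Cexp (- P z) * Q z = 1).
{ rewrite (deriv0_const (fun w => Cexp (- P w) * Q w)).
  - rewrite HP0, HQ0. replace (- 0) with (RtoC 0) by ring. rewrite Cexp_0. ring.
  - intros w Hw.
    assert (D : cderiv (fun u => - P u) w (- (1) * h w)).
    { apply cderiv_ext with (f := fun u => - (1) * P u); [intros; ring |].
      apply cderiv_scal, HP, Hw. }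
    apply cderiv_eq with (2 := cderiv_mult _ _ _ _ _
      (cderiv_comp Cexp (fun u => - P u) w _ _ (cderiv_Cexp _) D) (HQ w Hw)).
    cbv beta. ring.
  - exact Hz. }
rewrite <- (Cmult_1_r (Cexp (P z))), <- E, Cmult_assoc, (Cmult_comm (Cexp (P z))), Cexp_opp. ring.
Qed.

Lemma holo_log phi : holo Omega phi -> phi 0 = 1 -> (forall z, Omega z -> phi z <> 0) ->
  exists L, holo Omega L /\ L 0 = 0 /\ forall z, Omega z -> Cexp (L z) = phi z.
Proof.
intros H H0 Hn.
destruct (holo_derivative phi H) as [phi' [H1 H2]].
destruct (holo_primitive (fun z => phi' z / phi z)) as [L [HL [HL0 HL']]].
{ apply holo_div; assumption. }
exists L; split; [exact HL | split; [exact HL0 |]].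
apply (exp_primitive_unique L phi (fun z => phi' z / phi z)); try assumption.
intros z Hz. apply cderiv_eq with (2 := H2 z Hz). field. apply Hn, Hz.
Qed.

Lemma Cexp_Clog (u : C) : u <> 0 -> Cexp (Clog u) = u.
Proof.
intros Hu. assert (Hm : (0 < Cmod u)%R) by (apply Cmod_gt_0; exact Hu).
assert (Hmod : (Cmod u ^ 2 = Re u ^ 2 + Im u ^ 2)%R) by apply Cmod2_alt.
assert (Hb : (-1 <= Re u / Cmod u <= 1)%R).
{ pose proof (re_le_Cmod u) as K. apply Rabs_le_between in K.
  split; apply Rmult_le_reg_r with (1 := Hm); unfold Rdiv; rewrite Rmult_assoc, Rinv_l; lra. }
assert (Hs : sin (acos (Re u / Cmod u)) = (Rabs (Im u) / Cmod u)%R).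
{ rewrite sin_acos by exact Hb.
  replace (1 - (Re u / Cmod u)²)%R with ((Im u / Cmod u)²)%R.
  - rewrite sqrt_Rsqr_abs. unfold Rdiv. rewrite Rabs_mult, Rabs_inv, (Rabs_pos_eq (Cmod u)); [reflexivity | lra].
  - unfold Rsqr. apply Rmult_eq_reg_r with (Cmod u ^ 2)%R; [| apply pow_nonzero; lra].
    field_simplify; [lra | lra | lra]. }
change (Cexp (Clog u)) with (exp (ln (Cmod u)) * cos (Carg u), exp (ln (Cmod u)) * sin (Carg u))%R.
rewrite exp_ln by exact Hm. unfold Carg.
apply injective_projections; simpl; destruct (Rlt_dec (Im u) 0) as [Hi | Hi].
- rewrite cos_neg, cos_acos by exact Hb. unfold Re. field. lra.
- rewrite cos_acos by exact Hb. unfold Re. field. lra.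
- rewrite sin_neg, Hs, Rabs_left by exact Hi. unfold Im. field. lra.
- rewrite Hs, Rabs_pos_eq by lra. unfold Im. field. lra.
Qed.

Lemma Clog_Cexp v : (- PI < Im v < PI)%R -> Clog (Cexp v) = v.
Proof.
intros Hv. unfold Clog. rewrite Cmod_Cexp, ln_exp.
apply injective_projections; [reflexivity |]. simpl. unfold Carg. rewrite Cmod_Cexp.
pose proof (exp_pos (Re v)) as He.
replace (Re (Cexp v) / exp (Re v))%R with (cos (Im v))
  by (change (Re (Cexp v)) with (exp (Re v) * cos (Im v))%R; field; lra).
change (Im (Cexp v)) with (exp (Re v) * sin (Im v))%R. change (snd v) with (Im v).
destruct (Rlt_dec (exp (Re v) * sin (Im v)) 0) as [Hs | Hs].
- assert (Hi : (Im v < 0)%R).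
  { apply Rnot_le_lt. intros Hi. apply (Rlt_not_le _ _ Hs), Rmult_le_pos; [lra |]. apply sin_ge_0; lra. }
  rewrite <- cos_neg, acos_cos by lra. ring.
- assert (Hi : (0 <= Im v)%R).
  { apply Rnot_lt_le. intros Hi. apply Hs.
    assert (sin (Im v) < 0)%R by (apply sin_lt_0_var; lra). nra. }
  apply acos_cos; lra.
Qed.

Lemma Csqrt_square v : Csqrt v * Csqrt v = v.
Proof.
assert (Hmod : (Cmod v ^ 2 = Re v ^ 2 + Im v ^ 2)%R) by apply Cmod2_alt.
pose proof (re_le_Cmod v) as K. apply Rabs_le_between in K.
assert (H1 := sqrt_sqrt ((Cmod v + Re v) / 2) ltac:(lra)).
assert (H2 := sqrt_sqrt ((Cmod v - Re v) / 2) ltac:(lra)).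
assert (H3 : (sqrt ((Cmod v + Re v) / 2) * sqrt ((Cmod v - Re v) / 2) = Rabs (Im v) / 2)%R).
{ rewrite <- sqrt_mult by lra.
  replace ((Cmod v + Re v) / 2 * ((Cmod v - Re v) / 2))%R with ((Im v / 2)²)%R by (unfold Rsqr; nra).
  rewrite sqrt_Rsqr_abs. unfold Rdiv. rewrite Rabs_mult, (Rabs_pos_eq (/ 2)) by lra. reflexivity. }
unfold Csqrt. set (p := sqrt ((Cmod v + Re v) / 2)) in *. set (q := sqrt ((Cmod v - Re v) / 2)) in *.
unfold Re, Im in *.
apply injective_projections; simpl; destruct (Rlt_dec (snd v) 0) as [Hi | Hi].
- lra.
- lra.
- rewrite Rabs_left in H3 by exact Hi. lra.
- rewrite Rabs_pos_eq in H3 by lra. lra.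
Qed.

(** A positive real part singles out the principal root, so an analytic branch can be recognised as
    [Csqrt]. *)
Lemma Csqrt_unique s : (0 < Re s)%R -> Csqrt (s * s) = s.
Proof.
intros Hs. destruct s as [x y]. unfold Re in Hs; simpl in Hs.
assert (Hm : Cmod ((x, y) * (x, y)) = (x ^ 2 + y ^ 2)%R).
{ rewrite Cmod_mult. pose proof (Cmod2_alt (x, y)) as K. unfold Re, Im in K; simpl fst in K; simpl snd in K.
  rewrite <- K. ring. }
unfold Csqrt. rewrite Hm. unfold Re, Im; simpl.
replace ((x * (x * 1) + y * (y * 1) + (x * x - y * y)) / 2)%R with (x²)%R by (unfold Rsqr; field).
replace ((x * (x * 1) + y * (y * 1) - (x * x - y * y)) / 2)%R with (y²)%R by (unfold Rsqr; field).
rewrite !sqrt_Rsqr_abs, (Rabs_pos_eq x) by lra. f_equal.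
destruct (Rlt_dec (x * y + y * x) 0) as [Hi | Hi].
- rewrite Rabs_left by nra. ring.
- apply Rabs_pos_eq. nra.
Qed.

(** * Coefficient inequality for Schwarz functions *)

Definition cubic (u0 u1 u2 u3 z : C) : C := u0 + z * (u1 + z * (u2 + z * u3)).

Lemma expands_cubic u0 u1 u2 u3 : expands 1
  (fun n => match n with 0%nat => u0 | 1%nat => u1 | 2%nat => u2 | 3%nat => u3 | _ => 0 end)
  (cubic u0 u1 u2 u3).
Proof.
assert (K := fun c a F H => expands_plus 1 _ _ _ _ (expands_const 1 c) (expands_incr 1 a F H)).
apply expands_coef_ext with (2 := K u0 _ _ (K u1 _ _ (K u2 _ _ (expands_const 1 u3)))).
intros [| [| [| [| n]]]]; ring.
Qed.

Lemma expands_mult_coefs a b c F G H :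
  expands 1 a F -> expands 1 b G -> expands 1 c H -> (forall z, Omega z -> H z = F z * G z) ->
  c 0%nat = a 0%nat * b 0%nat /\
  c 1%nat = a 0%nat * b 1%nat + a 1%nat * b 0%nat /\
  c 2%nat = a 0%nat * b 2%nat + a 1%nat * b 1%nat + a 2%nat * b 0%nat /\
  c 3%nat = a 0%nat * b 3%nat + a 1%nat * b 2%nat + a 2%nat * b 1%nat + a 3%nat * b 0%nat.
Proof.
intros Ha Hb Hc E.
assert (K := fun n => expands_mult_coef n a b c F G Ha Hb (expands_ext 1 c _ _ E Hc)).
rewrite (K 0%nat), (K 1%nat), (K 2%nat), (K 3%nat), !sum_Sn, !sum_O.
repeat split.
Qed.

Lemma ccont_conj F z : ccont F z -> ccont (fun w => Cconj (F w)) z.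
Proof.
intros H. apply ccontP. intros eps He.
destruct (proj1 (ccontP _ _) H eps He) as [d [Hd K]].
exists d; split; [exact Hd |]. intros w Hw.
rewrite <- Cminus_conj, Cmod_conj. apply K, Hw.
Qed.

(* On the circle of radius [r], the conjugate of [z] is [r^2 / z]. *)
Lemma cmean_conj_cubic r g F u0 u1 u2 u3 : (0 < r < 1)%R -> expands 1 g F ->
  cmean r (fun z => Cconj (cubic u0 u1 u2 u3 z) * F z) =
  Cconj u0 * g 0%nat + RtoC (r ^ 2) * Cconj u1 * g 1%nat
  + RtoC (r ^ 4) * Cconj u2 * g 2%nat + RtoC (r ^ 6) * Cconj u3 * g 3%nat.
Proof.
intros Hr HF.
assert (Hc : forall c k, ccirc r (fun z => c * (F z * / z ^ k))).
{ intros c k z Hz. apply ccont_mult; [apply ccont_const |].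
  apply ccont_mult; [apply (expands_ccont 1 g F z HF); lra | apply (ccirc_inv_pow r k); lra]. }
assert (Hm : forall c k, cmean r (fun z => c * (F z * / z ^ k)) = c * g k).
{ intros c k. rewrite cmean_scal, (cmean_coef 1 k g F r HF); try lra; try reflexivity.
  intros z Hz. apply ccont_mult; [apply (expands_ccont 1 g F z HF); lra | apply (ccirc_inv_pow r k); lra]. }
rewrite (cmean_ext r _ (fun z =>
  Cconj u0 * (F z * / z ^ 0) + (RtoC (r ^ 2) * Cconj u1 * (F z * / z ^ 1)
  + (RtoC (r ^ 4) * Cconj u2 * (F z * / z ^ 2) + RtoC (r ^ 6) * Cconj u3 * (F z * / z ^ 3))))).
- assert (P2 : ccirc r (fun z => RtoC (r ^ 4) * Cconj u2 * (F z * / z ^ 2)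
    + RtoC (r ^ 6) * Cconj u3 * (F z * / z ^ 3))).
  { intros z Hz; apply ccont_plus; apply Hc, Hz. }
  assert (P1 : ccirc r (fun z => RtoC (r ^ 2) * Cconj u1 * (F z * / z ^ 1)
    + (RtoC (r ^ 4) * Cconj u2 * (F z * / z ^ 2) + RtoC (r ^ 6) * Cconj u3 * (F z * / z ^ 3)))).
  { intros z Hz; apply ccont_plus; [apply Hc, Hz | apply P2, Hz]. }
  rewrite (cmean_plus r _ _ (proj1 Hr) (Hc (Cconj u0) 0%nat) P1).
  rewrite (cmean_plus r _ _ (proj1 Hr) (Hc (RtoC (r ^ 2) * Cconj u1) 1%nat) P2).
  rewrite (cmean_plus r _ _ (proj1 Hr) (Hc (RtoC (r ^ 4) * Cconj u2) 2%nat)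
    (Hc (RtoC (r ^ 6) * Cconj u3) 3%nat)).
  rewrite !Hm. ring.
- lra.
- intros z Hz. assert (Hz0 : z <> 0) by (apply Cmod_gt_0; lra).
  assert (E : Cconj z = RtoC (r ^ 2) / z).
  { rewrite <- Hz, Cmod2_conj. field. exact Hz0. }
  unfold cubic. repeat (rewrite Cplus_conj || rewrite Cmult_conj). rewrite E.
  replace (r ^ 4)%R with (r ^ 2 * r ^ 2)%R by ring.
  replace (r ^ 6)%R with (r ^ 2 * r ^ 2 * r ^ 2)%R by ring.
  rewrite !RtoC_mult. field. exact Hz0.
Qed.

Lemma Re_conj_mult (z : C) : Re (Cconj z * z) = (Cmod z ^ 2)%R.
Proof. rewrite Cmod2_alt. destruct z; unfold Re, Im; simpl. ring. Qed.

Lemma Re_scal_conj_mult (x : R) (z : C) : Re (RtoC x * Cconj z * z) = (x * Cmod z ^ 2)%R.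
Proof. rewrite Cmod2_alt. destruct z; unfold Re, Im; simpl. ring. Qed.

Lemma conj_cross_bound (z w : C) : (2 * Re (Cconj z * w) <= Cmod z ^ 2 + Cmod w ^ 2)%R.
Proof.
rewrite !Cmod2_alt. destruct z as [a b], w as [c d]; unfold Re, Im; simpl.
pose proof (pow2_ge_0 (a - c)). pose proof (pow2_ge_0 (b - d)). nra.
Qed.

(* Multiplication by a Schwarz function contracts the mean square over circles;
   only the coefficients of order at most 3 of the product are kept. *)
Lemma bessel_cubic g F p0 p1 p2 : expands 1 g F -> g 0%nat = 0 ->
  (forall z, Omega z -> (Cmod (F z) <= Cmod (cubic p0 p1 p2 0 z))%R) ->
  (Cmod (g 1%nat) ^ 2 + Cmod (g 2%nat) ^ 2 + Cmod (g 3%nat) ^ 2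
    <= Cmod p0 ^ 2 + Cmod p1 ^ 2 + Cmod p2 ^ 2)%R.
Proof.
intros HF Hg0 HFP.
(* [q] is the Taylor polynomial of [F], so conj(q) F and |q|^2 have the same mean. Averaging 2 Re
   (conj(q) F) <= |q|^2 + |F|^2 <= |q|^2 + |P|^2 leaves mean |q|^2 <= mean |P|^2; the mean of |F|^2
   is never computed. *)
set (q := cubic 0 (g 1%nat) (g 2%nat) (g 3%nat)). set (P := cubic p0 p1 p2 0).
assert (Hq := expands_cubic 0 (g 1%nat) (g 2%nat) (g 3%nat)).
assert (HP := expands_cubic p0 p1 p2 0).
assert (HC : forall r a b f h, (0 < r < 1)%R -> expands 1 a f -> expands 1 b h ->
  ccirc r (fun z => Cconj (f z) * h z)).
{ intros r a b f h Hr Hf Hh z Hz. apply ccont_mult.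
  - apply ccont_conj, (expands_ccont 1 a f z Hf); lra.
  - apply (expands_ccont 1 b h z Hh); lra. }
set (A1 := (Cmod (g 1%nat) ^ 2)%R). set (A2 := (Cmod (g 2%nat) ^ 2)%R).
set (A3 := (Cmod (g 3%nat) ^ 2)%R).
assert (HA1 : (0 <= A1)%R) by apply pow2_ge_0. assert (HA2 : (0 <= A2)%R) by apply pow2_ge_0.
assert (HA3 : (0 <= A3)%R) by apply pow2_ge_0.
pose proof (pow2_ge_0 (Cmod p1)) as HB1. pose proof (pow2_ge_0 (Cmod p2)) as HB2.
assert (Main : forall r, (0 < r < 1)%R ->
  (r ^ 2 * A1 + r ^ 4 * A2 + r ^ 6 * A3
    <= Cmod p0 ^ 2 + r ^ 2 * Cmod p1 ^ 2 + r ^ 4 * Cmod p2 ^ 2)%R).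
{ intros r Hr.
  assert (M1 := cmean_conj_cubic r g F 0 (g 1%nat) (g 2%nat) (g 3%nat) Hr HF).
  assert (M2 := cmean_conj_cubic r _ _ 0 (g 1%nat) (g 2%nat) (g 3%nat) Hr Hq).
  assert (M3 := cmean_conj_cubic r _ _ p0 p1 p2 0 Hr HP).
  fold q in M1, M2. fold P in M3. cbv beta iota in M2, M3.
  assert (K : (Re (cmean r (fun z => 2 * (Cconj (q z) * F z))%C)
    <= Re (cmean r (fun z => Cconj (q z) * q z + Cconj (P z) * P z)%C))%R).
  { apply cmean_re_le.
    - lra.
    - intros z Hz. apply ccont_mult; [apply ccont_const | apply (HC r _ g q F Hr Hq HF z Hz)].
    - intros z Hz. apply ccont_plus; [apply (HC r _ _ q q Hr Hq Hq z Hz) | apply (HC r _ _ P P Hr HP HP z Hz)].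
    - intros z Hz.
      replace (Re (2 * (Cconj (q z) * F z))) with (2 * Re (Cconj (q z) * F z))%R
        by (unfold Re; simpl; ring).
      rewrite re_plus, !Re_conj_mult.
      apply Rle_trans with (1 := conj_cross_bound (q z) (F z)).
      apply Rplus_le_compat_l. apply pow_incr. split; [apply Cmod_ge_0 |].
      apply HFP. unfold Omega; lra. }
  rewrite cmean_scal, cmean_plus in K.
  2: lra.
  2: exact (HC r _ _ q q Hr Hq Hq).
  2: exact (HC r _ _ P P Hr HP HP).
  2: lra.
  2: exact (HC r _ g q F Hr Hq HF).
  rewrite M1, M2, M3 in K.
  assert (E : forall x, Re (2 * x) = (2 * Re x)%R) by (intros x; unfold Re; simpl; ring).
  rewrite E, Hg0, !re_plus, !Re_scal_conj_mult, !Re_conj_mult, !Cmod_0 in K.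
  fold A1 A2 A3 in K. lra. }
set (B := (Cmod p0 ^ 2 + Cmod p1 ^ 2 + Cmod p2 ^ 2)%R).
assert (HB : (0 <= B)%R) by (unfold B; pose proof (pow2_ge_0 (Cmod p0)); lra).
assert (Main' : forall r, (0 < r < 1)%R -> (r ^ 6 * (A1 + A2 + A3) <= B)%R).
{ intros r Hr. specialize (Main r Hr).
  assert (H2 : (0 <= r ^ 2 <= 1)%R) by nra.
  assert (H4 : (r ^ 4 = r ^ 2 * r ^ 2)%R) by ring.
  assert (H6 : (r ^ 6 = r ^ 2 * r ^ 2 * r ^ 2)%R) by ring.
  assert (H4' : (0 <= r ^ 4 <= r ^ 2)%R) by (rewrite H4; nra).
  assert (H6' : (0 <= r ^ 6 <= r ^ 4)%R) by (rewrite H6, H4; nra).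
  assert (r ^ 6 * A1 <= r ^ 2 * A1)%R by (apply Rmult_le_compat_r; lra).
  assert (r ^ 6 * A2 <= r ^ 4 * A2)%R by (apply Rmult_le_compat_r; lra).
  assert (r ^ 2 * Cmod p1 ^ 2 <= 1 * Cmod p1 ^ 2)%R by (apply Rmult_le_compat_r; lra).
  assert (r ^ 4 * Cmod p2 ^ 2 <= 1 * Cmod p2 ^ 2)%R by (apply Rmult_le_compat_r; lra).
  unfold B. lra. }
apply le_epsilon. intros eps He.
set (A := (A1 + A2 + A3)%R) in *. assert (HA : (0 <= A)%R) by (unfold A; lra).
(* The limit at radius 1 is taken with r = 1 - e: (1 - e)^6 >= 1 - 6 e, and the loss 6 e A is at
   most [eps]. *)
set (e := Rmin (1 / 2) (eps / (6 * (A + 1)))).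
assert (He0 : (0 < e)%R) by (apply Rmin_pos; [lra | apply Rdiv_lt_0_compat; lra]).
assert (He1 : (e <= 1 / 2)%R) by apply Rmin_l.
assert (He2 : (e * (6 * (A + 1)) <= eps)%R).
{ apply Rle_trans with (eps / (6 * (A + 1)) * (6 * (A + 1)))%R.
  - apply Rmult_le_compat_r; [lra | apply Rmin_r].
  - right; field; lra. }
specialize (Main' (1 - e)%R ltac:(lra)).
assert (Hp : (1 - 6 * e <= (1 - e) ^ 6)%R).
{ assert (Q2 : (1 - 2 * e <= (1 - e) ^ 2)%R) by nra.
  assert (Q3 : (1 - 3 * e <= (1 - e) ^ 3)%R) by (simpl pow in *; nra).
  replace ((1 - e) ^ 6)%R with ((1 - e) ^ 3 * (1 - e) ^ 3)%R by ring.
  assert (0 <= (1 - e) ^ 3)%R by (apply pow_le; lra).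
  destruct (Rle_dec (3 * e) 1) as [H3 | H3]; nra. }
assert ((1 - 6 * e) * A <= (1 - e) ^ 6 * A)%R by (apply Rmult_le_compat_r; assumption).
fold B. nra.
Qed.

Lemma schwarz_coef_bound w c s t : holo Omega w -> expands 1 c w -> w 0 = 0 ->
  (forall z, Omega z -> (Cmod (w z) <= 1)%R) ->
  (Cmod (c 1%nat) ^ 2 + Cmod (c 2%nat + s * c 1%nat) ^ 2
    + Cmod (c 3%nat + s * c 2%nat + t * c 1%nat) ^ 2 <= 1 + Cmod s ^ 2 + Cmod t ^ 2)%R.
Proof.
intros Hw Hc Hw0 Hb.
assert (HP := expands_cubic 1 s t 0).
destruct (holo_expands (fun z => cubic 1 s t 0 z * w z)) as [g Hg].
{ apply holo_mult; [apply (expands_holo _ _ HP) | exact Hw]. }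
assert (C0 : c 0%nat = 0) by (rewrite <- (expands_0 1 c w ltac:(lra) Hc); exact Hw0).
destruct (expands_mult_coefs _ _ _ _ _ _ HP Hc Hg (fun z _ => eq_refl)) as [G0 [G1 [G2 G3]]].
rewrite C0 in G0, G1, G2, G3.
assert (B := bessel_cubic g _ 1 s t Hg).
rewrite Cmod_1 in B. replace (1 ^ 2)%R with 1%R in B by ring.
replace (c 1%nat) with (g 1%nat) at 1 by (rewrite G1; ring).
replace (c 2%nat + s * c 1%nat) with (g 2%nat) by (rewrite G2; ring).
replace (c 3%nat + s * c 2%nat + t * c 1%nat) with (g 3%nat) by (rewrite G3; ring).
apply B; [rewrite G0; ring |].
intros z Hz. rewrite Cmod_mult. pose proof (Cmod_ge_0 (cubic 1 s t 0 z)). pose proof (Hb z Hz).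
pose proof (Cmod_ge_0 (w z)). nra.
Qed.

(** * Sine and arcsine *)

Definition csin (z : C) : C := (Cexp (Ci * z) - Cexp (- (Ci * z))) / (2 * Ci).
Definition ccos (z : C) : C := (Cexp (Ci * z) + Cexp (- (Ci * z))) / 2.

Lemma Ci_sq : Ci * Ci = - (1).
Proof. unfold Ci, Cmult, Copp, RtoC; simpl; f_equal; ring. Qed.

(** Only the square of the root matters, not its branch. Hence the argument of the logarithm never
    vanishes, and [csin_Carcsin] holds for every complex number. *)
Lemma arcsin_arg_inverse w : (Ci * w + Csqrt (1 - w * w)) * (Csqrt (1 - w * w) - Ci * w) = 1.
Proof.
set (s := Csqrt (1 - w * w)). assert (Hs : s * s = 1 - w * w) by apply Csqrt_square.
replace ((Ci * w + s) * (s - Ci * w)) with (s * s - Ci * Ci * (w * w)) by ring.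
rewrite Hs, Ci_sq. ring.
Qed.

Lemma arcsin_arg_neq0 w : Ci * w + Csqrt (1 - w * w) <> 0.
Proof.
intros E. assert (K := arcsin_arg_inverse w). rewrite E, Cmult_0_l in K.
apply C1_nz. symmetry. exact K.
Qed.

Lemma Cexp_Carcsin w : Cexp (Ci * Carcsin w) = Ci * w + Csqrt (1 - w * w).
Proof.
unfold Carcsin.
replace (Ci * (- Ci * Clog (Ci * w + Csqrt (1 - w * w))))
  with (- (Ci * Ci) * Clog (Ci * w + Csqrt (1 - w * w))) by ring.
rewrite Ci_sq. replace (- - (1) * Clog (Ci * w + Csqrt (1 - w * w)))
  with (Clog (Ci * w + Csqrt (1 - w * w))) by ring.
apply Cexp_Clog, arcsin_arg_neq0.
Qed.

Lemma csin_Carcsin w : csin (Carcsin w) = w.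
Proof.
unfold csin. rewrite Cexp_Carcsin.
assert (K := Cexp_opp (Ci * Carcsin w)). rewrite Cexp_Carcsin in K.
assert (K2 := arcsin_arg_inverse w).
set (u := Ci * w + Csqrt (1 - w * w)) in *.
assert (E : Cexp (- (Ci * Carcsin w)) = Csqrt (1 - w * w) - Ci * w).
{ transitivity (Cexp (- (Ci * Carcsin w)) * (u * (Csqrt (1 - w * w) - Ci * w))).
  - rewrite K2. ring.
  - rewrite Cmult_assoc, K. ring. }
rewrite !E. unfold u. pose proof Ci_nz. field. auto.
Qed.

(** For |w| <= 1 the argument of the logarithm and its inverse have modulus at most 3 <= e^2, so the
    real part of the logarithm lies in [-2, 2]; its imaginary part is at most PI in absolute value.
    The circle |w| = 1 is included. *)
Lemma Carcsin_bounded : exists M : R, (0 < M)%R /\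
  forall w, (Cmod w <= 1)%R -> (Cmod (Carcsin w) <= M)%R.
Proof.
exists (2 + PI)%R. split; [pose proof PI_RGT_0; lra |]. intros w Hw.
set (s := Csqrt (1 - w * w)).
assert (Hs : (Cmod s <= 2)%R).
{ assert (Hs : s * s = 1 - w * w) by apply Csqrt_square.
  apply (f_equal Cmod) in Hs. rewrite Cmod_mult in Hs.
  assert (Cmod (1 - w * w) <= 1 + 1)%R.
  { apply Rle_trans with (1 := Cmod_triangle _ _). rewrite Cmod_opp, Cmod_mult, Cmod_1.
    pose proof (Cmod_ge_0 w). nra. }
  pose proof (Cmod_ge_0 s). nra. }
assert (Hu := arcsin_arg_neq0 w). assert (Hinv := arcsin_arg_inverse w).
unfold Carcsin. fold s in Hu, Hinv |- *. set (u := Ci * w + s) in *.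
assert (Hiw : (Cmod (Ci * w) <= 1)%R) by (rewrite Cmod_mult, Cmod_Ci; lra).
assert (Hu1 : (Cmod u <= 3)%R).
{ apply Rle_trans with (1 := Cmod_triangle _ _). lra. }
assert (Hu2 : (Cmod (s - Ci * w) <= 3)%R).
{ apply Rle_trans with (1 := Cmod_triangle _ _). rewrite Cmod_opp. lra. }
apply (f_equal Cmod) in Hinv. rewrite Cmod_mult, Cmod_1 in Hinv.
assert (Hm : (0 < Cmod u)%R) by (apply Cmod_gt_0; exact Hu).
assert (He : (3 <= exp 2)%R) by (pose proof (exp_ineq1_le 2); lra).
rewrite Cmod_mult, Cmod_opp, Cmod_Ci, Rmult_1_l.
apply Rle_trans with (1 := Cmod_le_abs _). unfold Clog, Re, Im; simpl.
apply Rplus_le_compat.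
- apply Rabs_le. split.
  + apply Rle_trans with (ln (exp (-2))); [rewrite ln_exp; lra |].
    apply ln_le; [apply exp_pos |].
    assert (E : (exp (-2) * exp 2 = 1)%R).
    { rewrite <- exp_plus. replace (-2 + 2)%R with 0%R by ring. apply exp_0. }
    pose proof (exp_pos (-2)). pose proof (Cmod_ge_0 (s - Ci * w)). nra.
  + rewrite <- (ln_exp 2) at 1. apply ln_le; lra.
- pose proof (acos_bound (Re u / Cmod u)) as Hb. unfold Carg.
  destruct (Rlt_dec (Im u) 0); apply Rabs_le; lra.
Qed.

Lemma cderiv_Cexp_scal c A z a : cderiv A z a ->
  cderiv (fun w => Cexp (c * A w)) z (c * a * Cexp (c * A z)).
Proof.
intros H. exact (cderiv_comp Cexp (fun w => c * A w) z _ _ (cderiv_Cexp _) (cderiv_scal c A z a H)).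
Qed.

Lemma cderiv_csin A z a : cderiv A z a -> cderiv (fun w => csin (A w)) z (a * ccos (A z)).
Proof.
intros H.
assert (K := cderiv_plus _ _ _ _ _
  (cderiv_scal (/ (2 * Ci)) _ _ _ (cderiv_Cexp_scal Ci A z a H))
  (cderiv_scal (- / (2 * Ci)) _ _ _ (cderiv_Cexp_scal (- Ci) A z a H))).
assert (E : forall w, - Ci * w = - (Ci * w)) by (intros; ring).
pose proof Ci_nz.
refine (cderiv_ext _ _ z _ _ (cderiv_eq _ z _ _ _ K)).
- intros w. cbv beta. rewrite !E. unfold csin. field. auto.
- rewrite !E. unfold ccos. field. auto.
Qed.

Lemma cderiv_ccos A z a : cderiv A z a -> cderiv (fun w => ccos (A w)) z (- (1) * (a * csin (A z))).
Proof.
intros H.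
assert (K := cderiv_plus _ _ _ _ _
  (cderiv_scal (/ 2) _ _ _ (cderiv_Cexp_scal Ci A z a H))
  (cderiv_scal (/ 2) _ _ _ (cderiv_Cexp_scal (- Ci) A z a H))).
assert (E : forall w, - Ci * w = - (Ci * w)) by (intros; ring).
pose proof Ci_nz.
refine (cderiv_ext _ _ z _ _ (cderiv_eq _ z _ _ _ K)).
- intros w. cbv beta. rewrite !E. unfold ccos. field. auto.
- rewrite !E. unfold csin. rewrite <- Ci_sq. field. auto.
Qed.

Lemma holo_csin A : holo Omega A -> holo Omega (fun z => csin (A z)).
Proof.
intros H. unfold csin. pose proof Ci_nz.
apply holo_mult; [| apply holo_const].
apply holo_plus; [apply holo_exp, holo_scal, H |].
apply holo_ext with (fun z => - (1) * Cexp (- Ci * A z)).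
- intros z _. replace (- Ci * A z) with (- (Ci * A z)) by ring. ring.
- apply holo_scal, holo_exp, holo_scal, H.
Qed.

Lemma holo_ccos A : holo Omega A -> holo Omega (fun z => ccos (A z)).
Proof.
intros H. unfold ccos.
apply holo_mult; [| apply holo_const].
apply holo_plus; [apply holo_exp, holo_scal, H |].
apply holo_ext with (fun z => Cexp (- Ci * A z)).
- intros z _. f_equal. ring.
- apply holo_exp, holo_scal, H.
Qed.

Lemma ccos_0 : ccos 0 = 1.
Proof.
unfold ccos. replace (- (Ci * 0)) with (RtoC 0) by ring. rewrite Cmult_0_r, Cexp_0.
field.
Qed.

Lemma csin_0 : csin 0 = 0.
Proof.
unfold csin. replace (- (Ci * 0)) with (RtoC 0) by ring. rewrite Cmult_0_r, Cexp_0.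
pose proof Ci_nz. field. auto.
Qed.

Lemma dcoef_values a : dcoef a 0 = a 1%nat /\ dcoef a 1 = 2 * a 2%nat /\
  dcoef a 2 = 3 * a 3%nat /\ dcoef a 3 = 4 * a 4%nat.
Proof.
unfold dcoef.
replace (INR 1) with 1%R by (simpl; ring). replace (INR 2) with 2%R by (simpl; ring).
replace (INR 3) with 3%R by (simpl; ring). replace (INR 4) with 4%R by (simpl; ring).
repeat split; ring.
Qed.

(** Composition of series is bypassed by the system (sin A)' = A' cos A, (cos A)' = -A' sin A, which
    determines the coefficients successively. *)
Lemma csin_coefs A al c : expands 1 al A -> A 0 = 0 -> expands 1 c (fun z => csin (A z)) ->
  c 1%nat = al 1%nat /\ c 2%nat = al 2%nat /\
  c 3%nat = al 3%nat - al 1%nat * al 1%nat * al 1%nat / 6.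
Proof.
intros HA HA0 Hc.
destruct (holo_expands (fun z => ccos (A z))) as [k Hk].
{ apply holo_ccos, (expands_holo _ _ HA). }
assert (k0 : k 0%nat = 1).
{ rewrite <- (expands_0 1 k _ ltac:(lra) Hk), HA0. apply ccos_0. }
assert (c0 : c 0%nat = 0).
{ rewrite <- (expands_0 1 c _ ltac:(lra) Hc), HA0. apply csin_0. }
assert (dA := expands_deriv 1 al A). assert (HdA := expands_dcoef 1 al A HA).
assert (E1 : forall z, Omega z -> csum (dcoef c) z = csum (dcoef al) z * ccos (A z)).
{ intros z Hz. apply cderiv_unique with (1 := expands_deriv 1 c _ z Hc Hz).
  apply cderiv_csin, dA; assumption. }
assert (E2 : forall z, Omega z -> - (1) * csum (dcoef k) z = csum (dcoef al) z * csin (A z)).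
{ intros z Hz. rewrite (cderiv_unique _ _ _ _ (expands_deriv 1 k _ z Hk Hz)
    (cderiv_ccos A z _ (dA z HA Hz))). ring. }
destruct (expands_mult_coefs _ _ _ _ _ _ HdA Hk (expands_dcoef 1 c _ Hc) E1) as [P0 [P1 [P2 _]]].
destruct (expands_mult_coefs _ _ _ _ _ _ HdA Hc
  (expands_scal 1 (- (1)) _ _ (expands_dcoef 1 k _ Hk)) E2) as [Q0 [Q1 [Q2 _]]].
destruct (dcoef_values al) as [a0 [a1 [a2 _]]]. destruct (dcoef_values c) as [d0 [d1 [d2 _]]].
destruct (dcoef_values k) as [e0 [e1 [e2 _]]].
rewrite a0, a1, a2, d0, d1, d2 in *. rewrite e0, e1, e2 in *. rewrite k0, c0 in *.
assert (c1 : c 1%nat = al 1%nat) by (rewrite P0; ring).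
assert (k1 : k 1%nat = 0).
{ replace (k 1%nat) with (- (1) * (- (1) * k 1%nat)) by ring. rewrite Q0. ring. }
assert (c2 : c 2%nat = al 2%nat).
{ replace (c 2%nat) with (/ 2 * (2 * c 2%nat)) by (field). rewrite P1, k1. field. }
assert (k2 : k 2%nat = - (al 1%nat * al 1%nat) / 2).
{ replace (k 2%nat) with (- / 2 * (- (1) * (2 * k 2%nat))) by (field).
  rewrite Q1, c1. field. }
repeat split; [exact c1 | exact c2 |].
replace (c 3%nat) with (/ 3 * (3 * c 3%nat)) by (field).
rewrite P2, k1, k2. field.
Qed.

(* If [f1] vanished at [z], the function [|f1(tz)|^2 exp(2Mt/d)] of [t], which is
   nondecreasing on [d, 1] and positive at [d], would vanish at 1. *)
Lemma nonvanishing_of_log_deriv_bound (f1 f2 : C -> C) (M : R) : (0 < M)%R -> f1 0 = 1 ->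
  (forall z, Omega z -> cderiv f1 z (f2 z)) ->
  (forall z, Omega z -> f1 z <> 0 -> (Cmod (z * f2 z) <= M * Cmod (f1 z))%R) ->
  forall z, Omega z -> f1 z <> 0.
Proof.
intros HM H0 Hd Hb z Hz.
destruct (proj1 (ccontP _ _) (cderiv_ccont _ _ _ (Hd 0 Omega_0)) 1%R ltac:(lra)) as [e [He K]].
(* At d z continuity keeps [f1] within distance less than 1 of its value 1, hence nonzero. Starting
   at d > 0 matters because the hypothesis at t z bounds t |z f2 (t z)|, and t is divided out. *)
set (d := Rmin 1 (e / 2)).
assert (Hd0 : (0 < d)%R) by (apply Rmin_pos; lra).
assert (Hd1 : (d <= 1)%R) by apply Rmin_l.
assert (Hd2 : (d <= e / 2)%R) by apply Rmin_r.
assert (HO : forall t, (0 <= t <= 1)%R -> Omega (RtoC t * z)).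
{ intros t Ht. assert (K' := Omega_convex 0 z t Omega_0 Hz Ht).
  replace (0 + RtoC t * (z - 0)) with (RtoC t * z) in K' by ring. exact K'. }
assert (Hfd : f1 (RtoC d * z)%C <> 0).
{ intros E. specialize (K (RtoC d * z)). rewrite E, H0 in K.
  replace (0 - 1) with (- (1)) in K by ring. rewrite Cmod_opp, Cmod_1 in K.
  apply (Rlt_irrefl 1), K. replace (RtoC d * z - 0) with (RtoC d * z) by ring.
  rewrite Cmod_mult, Cmod_R, Rabs_pos_eq by lra. unfold Omega in Hz.
  pose proof (Cmod_ge_0 z). nra. }
set (N := fun t => (Re (f1 (RtoC t * z)%C) ^ 2 + Im (f1 (RtoC t * z)%C) ^ 2)%R).
set (N' := fun t => (2 * (Re (f1 (RtoC t * z)%C) * Re (z * f2 (RtoC t * z)%C)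
   + Im (f1 (RtoC t * z)%C) * Im (z * f2 (RtoC t * z)%C)))%R).
assert (HN : forall t, N t = (Cmod (f1 (RtoC t * z)%C) ^ 2)%R).
{ intros t. unfold N. rewrite Cmod2_alt. reflexivity. }
assert (HdN : forall t, (0 <= t <= 1)%R -> is_derive N t (N' t)).
{ intros t Ht.
  assert (P := pderiv_comp f1 (fun s => 0 + RtoC s * z) t (f2 (RtoC t * z)%C) z).
  cbv beta in P. replace (0 + RtoC t * z) with (RtoC t * z) in P by ring.
  destruct (P (Hd _ (HO t Ht)) (pderiv_affine 0 z t)) as [P1 P2].
  apply (is_derive_ext (fun s => (Re (f1 (0 + RtoC s * z)%C) ^ 2 + Im (f1 (0 + RtoC s * z)%C) ^ 2)%R)).
  { intros s. unfold N. replace (0 + RtoC s * z) with (RtoC s * z) by ring. reflexivity. }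
  replace (N' t) with (plus
    (INR 2 * Re (z * f2 (RtoC t * z)%C) * Re (f1 (0 + RtoC t * z)%C) ^ pred 2)%R
    (INR 2 * Im (z * f2 (RtoC t * z)%C) * Im (f1 (0 + RtoC t * z)%C) ^ pred 2)%R).
  - apply (is_derive_plus (K := R_AbsRing) (V := R_NormedModule)); apply is_derive_pow; assumption.
  - unfold N', plus; simpl Hierarchy.plus. replace (0 + RtoC t * z) with (RtoC t * z) by ring.
    simpl. ring. }
assert (HN' : forall t, (d <= t <= 1)%R -> (- (2 * M / d) * N t <= N' t)%R).
{ intros t Ht.
  (* At a zero of [f1] the hypothesis gives nothing, but there both [N] and [N'] vanish. *)
  destruct (Ceq_dec (f1 (RtoC t * z)%C) 0) as [E | E].
  - unfold N, N'. rewrite E. simpl. right; ring.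
  - specialize (Hb _ (HO t ltac:(lra)) E).
    set (F := f1 (RtoC t * z)%C) in *. set (G := z * f2 (RtoC t * z)%C).
    assert (HG : (d * Cmod G <= M * Cmod F)%R).
    { replace (RtoC t * z * f2 (RtoC t * z)%C) with (RtoC t * G) in Hb by (unfold G; ring).
      rewrite Cmod_mult, Cmod_R, Rabs_pos_eq in Hb by lra. pose proof (Cmod_ge_0 G). nra. }
    assert (HFG : (- (Cmod F * Cmod G) <= Re F * Re G + Im F * Im G)%R).
    { replace (Re F * Re G + Im F * Im G)%R with (Re (Cconj F * G))
        by (unfold Re, Im; simpl; ring).
      pose proof (re_le_Cmod (Cconj F * G)) as R1. rewrite Cmod_mult, Cmod_conj in R1.
      apply Rabs_le_between in R1. lra. }
    rewrite HN. fold F. unfold N'. fold F. fold G.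
    assert (HX : (Cmod F * Cmod G <= M / d * Cmod F ^ 2)%R).
    { apply Rmult_le_reg_l with (1 := Hd0).
      replace (d * (M / d * Cmod F ^ 2))%R with (M * Cmod F * Cmod F)%R by (field; lra).
      pose proof (Cmod_ge_0 F). nra. }
    replace (- (2 * M / d) * Cmod F ^ 2)%R with (-2 * (M / d * Cmod F ^ 2))%R by (field; lra).
    lra. }
set (W := fun t => (N t * exp (2 * M / d * t))%R).
assert (HW : forall t, (0 <= t <= 1)%R ->
  is_derive W t ((N' t + 2 * M / d * N t) * exp (2 * M / d * t))%R).
{ intros t Ht.
  replace ((N' t + 2 * M / d * N t) * exp (2 * M / d * t))%R
    with (plus (mult (N' t) (exp (2 * M / d * t))%R)
      (mult (N t) (2 * M / d * exp (2 * M / d * t))%R))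
    by (unfold plus, mult; simpl; ring).
  refine (is_derive_mult (K := R_AbsRing) N (fun s => exp (2 * M / d * s))%R t _ _ (HdN t Ht) _ Rmult_comm).
  auto_derive; [auto | ring]. }
destruct (MVT_gen W d 1 (fun t => (N' t + 2 * M / d * N t) * exp (2 * M / d * t))%R) as [t [Ht E]].
- rewrite Rmin_left, Rmax_right by lra. intros t Ht. apply HW; lra.
- rewrite Rmin_left, Rmax_right by lra. intros t Ht. apply continuity_pt_filterlim.
  apply (ex_derive_continuous (K := R_AbsRing) (V := R_NormedModule)).
  eexists; apply HW; lra.
- rewrite Rmin_left, Rmax_right in Ht by lra. specialize (HN' t Ht).
  pose proof (exp_pos (2 * M / d * t)).
  assert (HW1 : (0 <= W 1 - W d)%R).
  { rewrite E. apply Rmult_le_pos; [apply Rmult_le_pos |]; lra. }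
  assert (HWd : (0 < W d)%R).
  { apply Rmult_lt_0_compat; [| apply exp_pos]. rewrite HN. apply pow_lt, Cmod_gt_0, Hfd. }
  intros E0. unfold W at 1 in HW1. rewrite HN, Cmult_1_l, E0, Cmod_0 in HW1. lra.
Qed.

(** * Logarithmic coefficients and their bounds *)

Lemma C_derive_on_disc f f1 : (forall z, Omega z -> cderiv f z (f1 z)) ->
  forall z, Omega z -> C_derive f z = f1 z.
Proof. intros H z Hz. apply is_C_derive_unique, H, Hz. Qed.

Lemma C_derive2_on_disc f f1 f2 : (forall z, Omega z -> cderiv f z (f1 z)) ->
  (forall z, Omega z -> cderiv f1 z (f2 z)) ->
  forall z, Omega z -> C_derive (C_derive f) z = f2 z.
Proof.
intros H1 H2. apply C_derive_on_disc. intros z Hz.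
destruct (Omega_ball z Hz) as [r [Hr K]].
apply cderiv_ext_loc with (f := f1) (r := r); [exact Hr | | apply H2, Hz].
intros w Hw. symmetry. apply C_derive_on_disc with (1 := H1), K, Hw.
Qed.

Lemma two_over_PI_neq0 : 2 / RtoC PI <> 0.
Proof.
assert (HP : RtoC PI <> 0) by (intros E; apply RtoC_inj in E; exact (PI_neq0 E)).
intros E. apply C1_nz. replace (RtoC 1) with (2 / RtoC PI * (RtoC PI / 2)) by (field; exact HP).
rewrite E. ring.
Qed.

Lemma Carcsin_0 : Carcsin 0 = 0.
Proof.
unfold Carcsin. replace (Ci * 0 + Csqrt (1 - 0 * 0)) with (RtoC 1).
- replace (RtoC 1) with (Cexp 0) by apply Cexp_0.
  rewrite Clog_Cexp; [ring |]. pose proof PI_RGT_0. unfold Im; simpl. lra.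
- replace (1 - 0 * 0) with (1 * 1) by ring. rewrite Csqrt_unique; [ring |]. simpl. lra.
Qed.

(** Once f' is known not to vanish, the coefficients are compared in the division-free equation z
    f'' = (2/PI) A f' with A = arcsin(omega). *)
Lemma convexity_coefs f omega : class_A f -> schwarz omega ->
  (forall z, Omega z -> convexity_quotient f z = 1 + 2 / PI * Carcsin (omega z)) ->
  exists a c, expands 1 a f /\ a 0%nat = 0 /\ a 1%nat = 1 /\ holo Omega omega /\ expands 1 c omega /\
    2 * a 2%nat = 2 / PI * c 1%nat /\
    6 * a 3%nat = 2 / PI * (c 1%nat * (2 * a 2%nat) + c 2%nat) /\
    12 * a 4%nat = 2 / PI * (c 1%nat * (3 * a 3%nat) + c 2%nat * (2 * a 2%nat) + c 3%nat
      + c 1%nat * c 1%nat * c 1%nat / 6).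
Proof.
intros [_ [a [a0 [a1 Ha]]]] [_ [Hw0 Hw1]] Hq.
apply has_expansion_expands in Ha.
set (f1 := csum (dcoef a)). set (f2 := csum (dcoef (dcoef a))).
assert (H1 : expands 1 (dcoef a) f1) by exact (expands_dcoef 1 a f Ha).
assert (H2 : expands 1 (dcoef (dcoef a)) f2) by exact (expands_dcoef 1 _ _ H1).
assert (D1 : forall z, Omega z -> cderiv f z (f1 z)) by (intros z; apply (expands_deriv 1 a f z Ha)).
assert (D2 : forall z, Omega z -> cderiv f1 z (f2 z)) by (intros z; apply (expands_deriv 1 _ f1 z H1)).
destruct (dcoef_values a) as [v0 [v1 [v2 v3]]].
assert (f1_0 : f1 0 = 1) by (rewrite (expands_0 1 _ _ ltac:(lra) H1), v0; exact a1).
assert (Q : forall z, Omega z -> z * f2 z / f1 z = 2 / PI * Carcsin (omega z)).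
{ intros z Hz. specialize (Hq z Hz). unfold convexity_quotient in Hq.
  rewrite (C_derive_on_disc f f1 D1 z Hz), (C_derive2_on_disc f f1 f2 D1 D2 z Hz) in Hq.
  replace (z * f2 z / f1 z) with (1 + z * f2 z / f1 z - 1) by ring. rewrite Hq. ring. }
destruct Carcsin_bounded as [M [HM HB]].
assert (Hp : (0 < Cmod (2 / PI))%R) by apply Cmod_gt_0, two_over_PI_neq0.
assert (Hn : forall z, Omega z -> f1 z <> 0).
{ apply (nonvanishing_of_log_deriv_bound f1 f2 (Cmod (2 / PI) * M)%R).
  - apply Rmult_lt_0_compat; assumption.
  - exact f1_0.
  - exact D2.
  - intros z Hz Hf.
    replace (z * f2 z) with (z * f2 z / f1 z * f1 z) by (field; exact Hf).
    rewrite (Q z Hz), !Cmod_mult. apply Rmult_le_compat_r; [apply Cmod_ge_0 |].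
    apply Rmult_le_compat_l; [lra |]. apply HB, Hw1, Hz. }
assert (HPI : RtoC PI <> 0) by (intros E; apply RtoC_inj in E; exact (PI_neq0 E)).
set (A := fun z => Carcsin (omega z)).
assert (HA : holo Omega A).
{ apply holo_ext with (fun z => PI / 2 * (z * f2 z / f1 z)).
  - intros z Hz. rewrite (Q z Hz). unfold A. field. exact HPI.
  - apply holo_scal, holo_div; [| exact (expands_holo _ _ H1) | exact Hn].
    apply holo_mult; [apply holo_id | exact (expands_holo _ _ H2)]. }
assert (Hw : holo Omega omega).
{ apply holo_ext with (fun z => csin (A z)); [intros z _; apply csin_Carcsin |].
  apply holo_csin, HA. }
destruct (holo_expands A HA) as [al Hal]. destruct (holo_expands omega Hw) as [c Hc].
exists a, c. do 3 (split; [assumption |]). split; [exact Hw |]. split; [exact Hc |].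
assert (A0 : A 0 = 0) by (unfold A; rewrite Hw0; apply Carcsin_0).
assert (al0 : al 0%nat = 0) by (rewrite <- (expands_0 1 al A ltac:(lra) Hal); exact A0).
destruct (csin_coefs A al c Hal A0) as [c1 [c2 c3]].
{ apply expands_ext with (2 := Hc). intros z _. symmetry. apply csin_Carcsin. }
destruct (expands_mult_coefs _ _ _ _ _ (fun z => z * f2 z) (expands_scal 1 (2 / PI) al A Hal) H1
  (expands_incr 1 _ f2 H2)) as [_ [E1 [E2 E3]]].
{ intros z Hz. cbv beta. unfold A. rewrite <- (Q z Hz). field. apply Hn, Hz. }
destruct (dcoef_values (dcoef a)) as [w0 [w1 [w2 _]]].
rewrite w0, v0, v1, al0, a1 in E1. rewrite w1, v0, v1, v2, al0, a1 in E2.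
rewrite w2, v0, v1, v2, v3, al0, a1 in E3.
rewrite c3, c2, c1. set (p := 2 / PI) in *.
repeat split.
- rewrite E1. ring.
- replace (6 * a 3%nat) with (2 * (3 * a 3%nat)) by ring. rewrite E2. ring.
- replace (12 * a 4%nat) with (3 * (4 * a 4%nat)) by ring. rewrite E3. field.
Qed.

(** Differentiating f = z exp(L) gives f' = exp(L) (1 + z L'), where exp(L) has the coefficients of
    f shifted by one. *)
Lemma log_coeffs_eq f gamma a : expands 1 a f -> a 0%nat = 0 -> a 1%nat = 1 -> log_coeffs f gamma ->
  2 * a 2%nat = 2 * gamma 1%nat + a 2%nat /\
  3 * a 3%nat = 4 * gamma 2%nat + a 2%nat * (2 * gamma 1%nat) + a 3%nat /\
  4 * a 4%nat = 6 * gamma 3%nat + a 2%nat * (4 * gamma 2%nat) + a 3%nat * (2 * gamma 1%nat) + a 4%nat.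
Proof.
intros Ha a0 a1 [L [_ [L0 [HL Hl]]]].
apply has_expansion_expands in Hl. set (l := fun n => match n with O => RtoC 0 | S _ => 2 * gamma n end) in Hl.
assert (HLh := expands_holo _ _ Hl).
set (L1 := csum (dcoef l)).
assert (HL1 : expands 1 (dcoef l) L1) by exact (expands_dcoef 1 l L Hl).
destruct (holo_expands (fun z => Cexp (L z)) (holo_exp _ _ HLh)) as [e He].
assert (Ef : forall z, Omega z -> f z = z * Cexp (L z)).
{ intros z Hz. destruct (Ceq_dec z 0) as [-> | Hz0].
  - rewrite (expands_0 1 a f ltac:(lra) Ha), a0. ring.
  - rewrite (HL z Hz Hz0). field. exact Hz0. }
assert (Ea := expands_unique 1 _ _ f ltac:(lra) Ha
  (expands_ext 1 _ _ f (fun z Hz => eq_sym (Ef z Hz)) (expands_incr 1 e _ He))).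
assert (Df : forall z, Omega z -> csum (dcoef a) z = Cexp (L z) * (1 + z * L1 z)).
{ intros z Hz. apply cderiv_unique with (1 := expands_deriv 1 a f z Ha Hz).
  destruct (Omega_ball z Hz) as [r [Hr K]].
  apply cderiv_ext_loc with (f := fun w => w * Cexp (L w)) (r := r); [exact Hr | |].
  - intros w Hw. symmetry. apply Ef, K, Hw.
  - refine (cderiv_eq _ z _ _ _ (cderiv_mult (fun w => w) (fun w => Cexp (L w)) z _ _ (cderiv_id z)
      (cderiv_comp Cexp L z _ _ (cderiv_Cexp _) (expands_deriv 1 l L z Hl Hz)))).
    unfold L1. ring. }
destruct (expands_mult_coefs _ _ _ _ _ _ He
  (expands_plus 1 _ _ _ _ (expands_const 1 1) (expands_incr 1 _ L1 HL1))
  (expands_dcoef 1 a f Ha) Df) as [_ [E1 [E2 E3]]].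
cbv beta iota in E1, E2, E3.
destruct (dcoef_values a) as [v0 [v1 [v2 v3]]]. destruct (dcoef_values l) as [u0 [u1 [u2 _]]].
rewrite u0, v1 in E1. rewrite u0, u1, v2 in E2. rewrite u0, u1, u2, v3 in E3.
rewrite <- (Ea 1%nat), <- (Ea 2%nat) in E1. rewrite <- (Ea 1%nat), <- (Ea 2%nat), <- (Ea 3%nat) in E2.
rewrite <- (Ea 1%nat), <- (Ea 2%nat), <- (Ea 3%nat), <- (Ea 4%nat) in E3.
rewrite a1 in E1, E2, E3. unfold l in E1, E2, E3.
split; [| split].
- rewrite E1; ring.
- rewrite E2; ring.
- rewrite E3; ring.
Qed.

(** [omega] is explicit so that the same formulas evaluate the extremal functions, where it is a
    known power. *)
Lemma class_log_coeffs f omega gamma : class_A f -> schwarz omega ->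
  (forall z, Omega z -> convexity_quotient f z = 1 + 2 / PI * Carcsin (omega z)) ->
  log_coeffs f gamma ->
  exists c, holo Omega omega /\ expands 1 c omega /\
    gamma 1%nat = RtoC (1 / (2 * PI)) * c 1%nat /\
    gamma 2%nat = RtoC (1 / (6 * PI)) * (c 2%nat + RtoC (/ (2 * PI)) * c 1%nat * c 1%nat) /\
    gamma 3%nat = RtoC (1 / (12 * PI)) *
      (c 3%nat + RtoC (/ PI) * c 1%nat * c 2%nat + / 6 * c 1%nat * c 1%nat * c 1%nat).
Proof.
intros HA Hw Hq Hg.
destruct (convexity_coefs f omega HA Hw Hq) as [a [c [Ha [a0 [a1 [Hwh [Hc [E1 [E2 E3]]]]]]]]].
destruct (log_coeffs_eq f gamma a Ha a0 a1 Hg) as [G1 [G2 G3]].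
exists c. split; [exact Hwh |]. split; [exact Hc |].
assert (HPI : RtoC PI <> 0) by (intros E; apply RtoC_inj in E; exact (PI_neq0 E)).
assert (Hp := PI_RGT_0).
rewrite (RtoC_inv PI PI_neq0).
rewrite !RtoC_div, !RtoC_inv, !RtoC_mult by (apply Rgt_not_eq; lra).
assert (A2 : a 2%nat = c 1%nat / PI).
{ replace (a 2%nat) with (/ 2 * (2 * a 2%nat)) by field. rewrite E1. field. exact HPI. }
assert (A3 : a 3%nat = (c 1%nat * (2 * a 2%nat) + c 2%nat) / (3 * PI)).
{ replace (a 3%nat) with (/ 6 * (6 * a 3%nat)) by field. rewrite E2. field. exact HPI. }
assert (A4 : a 4%nat = (c 1%nat * (3 * a 3%nat) + c 2%nat * (2 * a 2%nat) + c 3%nat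
      + c 1%nat * c 1%nat * c 1%nat / 6) / (6 * PI)).
{ replace (a 4%nat) with (/ 12 * (12 * a 4%nat)) by field. rewrite E3. field. exact HPI. }
assert (g1 : gamma 1%nat = a 2%nat / 2).
{ replace (gamma 1%nat) with ((2 * gamma 1%nat + a 2%nat - a 2%nat) / 2) by field.
  rewrite <- G1. field. }
assert (g2 : gamma 2%nat = (2 * a 3%nat - a 2%nat * a 2%nat) / 4).
{ replace (gamma 2%nat) with ((4 * gamma 2%nat + a 2%nat * (2 * gamma 1%nat) + a 3%nat
    - a 2%nat * (2 * gamma 1%nat) - a 3%nat) / 4) by field.
  rewrite <- G2, g1. field. }
assert (g3 : gamma 3%nat = (3 * a 4%nat - a 2%nat * (4 * gamma 2%nat) - a 3%nat * a 2%nat) / 6).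
{ replace (gamma 3%nat) with ((6 * gamma 3%nat + a 2%nat * (4 * gamma 2%nat)
    + a 3%nat * (2 * gamma 1%nat) + a 4%nat - a 2%nat * (4 * gamma 2%nat)
    - a 3%nat * (2 * gamma 1%nat) - a 4%nat) / 6) by field.
  rewrite <- G3, g1. field. }
rewrite g3, g2, g1, A4, A3, A2.
split; [| split]; field; exact HPI.
Qed.

Lemma schwarz_functional_bounds w c : holo Omega w -> expands 1 c w -> w 0 = 0 ->
  (forall z, Omega z -> (Cmod (w z) <= 1)%R) ->
  (Cmod (c 1%nat) <= 1)%R /\
  (Cmod (c 2%nat + RtoC (/ (2 * PI)) * c 1%nat * c 1%nat) <= 1)%R /\
  (Cmod (c 3%nat + RtoC (/ PI) * c 1%nat * c 2%nat + / 6 * c 1%nat * c 1%nat * c 1%nat) <= 1)%R.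
Proof.
intros Hw Hc H0 Hb.
assert (K := fun s t => schwarz_coef_bound w c s t Hw Hc H0 Hb).
assert (HPI : (0 < / PI < 1 / 2)%R).
{ pose proof PI2_3_2. pose proof PI_RGT_0. split; [apply Rinv_0_lt_compat; lra |].
  apply Rmult_lt_reg_r with PI; [lra |]. rewrite Rinv_l by lra. lra. }
assert (HPI2 : (/ (2 * PI) = / PI / 2)%R) by (field; apply PI_neq0).
assert (Hsq : forall x, (0 <= x)%R -> (x ^ 2 <= 1)%R -> (x <= 1)%R) by (intros; nra).
set (x := Cmod (c 1%nat)). assert (Hx : (0 <= x)%R) by apply Cmod_ge_0.
assert (Hx1 : (x <= 1)%R).
{ apply Hsq; [exact Hx |]. specialize (K 0 0). rewrite Cmod_0 in K. fold x in K.
  pose proof (pow2_ge_0 (Cmod (c 2%nat + 0 * c 1%nat))).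
  pose proof (pow2_ge_0 (Cmod (c 3%nat + 0 * c 2%nat + 0 * c 1%nat))). lra. }
assert (Hx2 : (0 <= x ^ 2 <= 1)%R) by nra.
split; [exact Hx1 | split; (apply Hsq; [apply Cmod_ge_0 |])].
- specialize (K (RtoC (/ (2 * PI)) * c 1%nat) 0).
  rewrite Cmod_0, Cmod_mult, Cmod_R, Rabs_pos_eq in K by (rewrite HPI2; lra). fold x in K.
  pose proof (pow2_ge_0 (Cmod (c 3%nat + RtoC (/ (2 * PI)) * c 1%nat * c 2%nat + 0 * c 1%nat))).
  rewrite Rpow_mult_distr in K.
  assert ((/ (2 * PI)) ^ 2 * x ^ 2 <= 1 * x ^ 2)%R.
  { apply Rmult_le_compat_r; [lra |]. rewrite HPI2. nra. }
  lra.
(* Here |s|^2 + |t|^2 <= (1/4 + 1/36) |c1|^2, using 1/PI < 1/2 and |c1| <= 1. *)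
- specialize (K (RtoC (/ PI) * c 1%nat) (/ 6 * c 1%nat * c 1%nat)).
  assert (E6 : (/ 6)%C = RtoC (/ 6)) by (rewrite RtoC_inv; [reflexivity | lra]).
  rewrite E6 in K |- *.
  rewrite !Cmod_mult, !Cmod_R, !Rabs_pos_eq in K by lra. fold x in K.
  pose proof (pow2_ge_0 (Cmod (c 2%nat + RtoC (/ PI) * c 1%nat * c 1%nat))).
  rewrite Rpow_mult_distr in K.
  assert ((/ PI) ^ 2 * x ^ 2 <= 1 / 4 * x ^ 2)%R by (apply Rmult_le_compat_r; [lra | nra]).
  assert ((/ 6 * x * x) ^ 2 <= 1 / 36 * x ^ 2)%R by nra.
  lra.
Qed.

(** * Extremal functions *)

(** The intermediate value theorem along the radius from 0 to [z]. *)
Lemma Re_pos_connected F : holo Omega F -> (0 < Re (F 0))%R ->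
  (forall z, Omega z -> Re (F z) <> 0%R) -> forall z, Omega z -> (0 < Re (F z))%R.
Proof.
intros HF H0 Hn z Hz. apply Rnot_le_lt. intros Hle.
set (g := fun t => (- Re (F (0 + RtoC t * (z - 0))%C))%R).
destruct (IVT_interv g 0 1) as [t [Ht E]].
- intros t Ht. apply continuity_pt_filterlim.
  assert (K := holo_ccont _ F _ HF (Omega_convex 0 z t Omega_0 Hz Ht)).
  apply (continuous_opp (V := R_NormedModule)).
  exact (proj1 (ccont_path F (fun t => 0 + RtoC t * (z - 0)) t _ K (pderiv_affine 0 (z - 0) t))).
- lra.
- unfold g. replace (0 + RtoC 0 * (z - 0)) with (RtoC 0) by ring. lra.
- unfold g. replace (0 + RtoC 1 * (z - 0)) with z by ring. specialize (Hn z Hz). lra.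
- apply (Hn _ (Omega_convex 0 z t Omega_0 Hz Ht)). unfold g in E. lra.
Qed.

Lemma Cexp_half_square z : Cexp (/ 2 * z) * Cexp (/ 2 * z) = Cexp z.
Proof. rewrite <- Cexp_plus. f_equal. field. Qed.

(* On the disc the principal values in [Carcsin] are given by the analytic branches
   of the square root and the logarithm taking the value 1, respectively 0, at 0. *)
Lemma Carcsin_disc : holo Omega Carcsin /\
  forall z, Omega z -> (- (PI / 2) < Re (Carcsin z) < PI / 2)%R.
Proof.
assert (Hsq : forall z, Omega z -> (Cmod (z * z) < 1)%R).
{ intros z Hz. rewrite Cmod_mult. unfold Omega in Hz. pose proof (Cmod_ge_0 z). nra. }
destruct (holo_log (fun z => 1 - z * z)) as [L [HL [L0 EL]]].
{ apply holo_plus; [apply holo_const |].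
  apply holo_ext with (fun z => - (1) * (z * z)); [intros; ring |].
  apply holo_scal, holo_mult; apply holo_id. }
{ ring. }
{ intros z Hz E. specialize (Hsq z Hz). replace (z * z) with (RtoC 1) in Hsq.
  - rewrite Cmod_1 in Hsq. lra.
  - replace (z * z) with (1 - (1 - z * z)) by ring. rewrite E. ring. }
set (s := fun z => Cexp (/ 2 * L z)).
assert (Hs : holo Omega s) by (apply holo_exp, holo_scal, HL).
assert (Hs0 : s 0 = 1) by (unfold s; rewrite L0, Cmult_0_r; apply Cexp_0).
assert (Hss : forall z, Omega z -> s z * s z = 1 - z * z).
{ intros z Hz. unfold s. rewrite Cexp_half_square. apply EL, Hz. }
(* A purely imaginary s would make Re (1 - z^2) = Re (s^2) nonpositive, against |z^2| < 1. *)
assert (Hspos : forall z, Omega z -> (0 < Re (s z))%R).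
{ apply Re_pos_connected; [exact Hs | rewrite Hs0; simpl; lra |].
  intros z Hz E. specialize (Hss z Hz). specialize (Hsq z Hz).
  pose proof (re_le_Cmod (z * z)) as K. apply Rabs_le_between in K.
  apply (f_equal Re) in Hss. rewrite re_mult, E in Hss.
  replace (Re (1 - z * z)) with (1 - Re (z * z))%R in Hss by (unfold Re; simpl; ring).
  pose proof (pow2_ge_0 (Im (s z))). lra. }
set (u := fun z => Ci * z + s z).
assert (Hu : holo Omega u) by (apply holo_plus; [apply holo_scal, holo_id | exact Hs]).
assert (Huv : forall z, Omega z -> u z * (s z - Ci * z) = 1).
{ intros z Hz. unfold u.
  replace ((Ci * z + s z) * (s z - Ci * z)) with (s z * s z - Ci * Ci * (z * z)) by ring.
  rewrite (Hss z Hz), Ci_sq. ring. }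
assert (Hun : forall z, Omega z -> u z <> 0).
{ intros z Hz E. specialize (Huv z Hz). rewrite E, Cmult_0_l in Huv.
  apply C1_nz. symmetry. exact Huv. }
(* u and s - i z are mutually inverse, so their real parts have the same sign, and these add up to 2
   Re s > 0. *)
assert (Hupos : forall z, Omega z -> (0 < Re (u z))%R).
{ intros z Hz. apply Rnot_le_lt. intros Hle.
  assert (E : RtoC (Cmod (u z) ^ 2) * (s z - Ci * z) = Cconj (u z)).
  { rewrite Cmod2_conj. transitivity (Cconj (u z) * (u z * (s z - Ci * z))); [ring |].
    rewrite (Huv z Hz). ring. }
  apply (f_equal Re) in E. rewrite re_conj, re_scal_l in E.
  assert (Hm : (0 < Cmod (u z) ^ 2)%R) by (apply pow_lt, Cmod_gt_0, Hun, Hz).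
  assert (E2 : (Re (u z) + Re (s z - Ci * z) = 2 * Re (s z))%R).
  { unfold u, Re; simpl; ring. }
  specialize (Hspos z Hz). nra. }
destruct (holo_log u Hu) as [l [Hl [l0 El]]].
{ unfold u. rewrite Hs0. ring. }
{ exact Hun. }
(* Since exp(l) = u has positive real part, Im l starts at 0 and can never reach PI/2 or -PI/2. *)
assert (Hlim : forall z, Omega z -> cos (Im (l z)) <> 0%R).
{ intros z Hz E. specialize (Hupos z Hz). rewrite <- (El z Hz) in Hupos.
  unfold Cexp in Hupos. rewrite E in Hupos. simpl in Hupos. lra. }
pose proof PI_RGT_0 as HP.
assert (Hl1 : forall z, Omega z -> (0 < Re (RtoC (PI / 2) + Ci * l z))%R).
{ apply Re_pos_connected.
  - apply holo_plus; [apply holo_const | apply holo_scal, Hl].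
  - rewrite l0. simpl. lra.
  - intros z Hz E. apply (Hlim z Hz). replace (Im (l z)) with (PI / 2)%R; [apply cos_PI2 |].
    unfold Re in E; simpl in E. unfold Im. lra. }
assert (Hl2 : forall z, Omega z -> (0 < Re (RtoC (PI / 2) + - Ci * l z))%R).
{ apply Re_pos_connected.
  - apply holo_plus; [apply holo_const | apply holo_scal, Hl].
  - rewrite l0. simpl. lra.
  - intros z Hz E. apply (Hlim z Hz). replace (Im (l z)) with (- (PI / 2))%R; [rewrite cos_neg; apply cos_PI2 |].
    unfold Re in E; simpl in E. unfold Im. lra. }
assert (HIm : forall z, Omega z -> (- (PI / 2) < Im (l z) < PI / 2)%R).
{ intros z Hz. specialize (Hl1 z Hz). specialize (Hl2 z Hz).
  unfold Re in Hl1, Hl2; simpl in Hl1, Hl2. unfold Im. lra. }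
assert (E : forall z, Omega z -> - Ci * l z = Carcsin z).
{ intros z Hz. unfold Carcsin.
  rewrite <- (Hss z Hz), (Csqrt_unique _ (Hspos z Hz)).
  change (Ci * z + s z) with (u z). rewrite <- (El z Hz), Clog_Cexp; [reflexivity |].
  specialize (HIm z Hz). lra. }
split.
- apply holo_ext with (1 := E). apply holo_scal, Hl.
- intros z Hz. rewrite <- (E z Hz). specialize (HIm z Hz).
  replace (Re (- Ci * l z)) with (Im (l z)) by (unfold Re, Im; simpl; ring). exact HIm.
Qed.

(** * A linear bound for the arcsine from lower bounds for the sine *)

Lemma sin_ge_half x : (0 <= x <= PI / 2)%R -> (x / 2 <= sin x)%R.
Proof.
intros Hx.
(* Five terms of the alternating series for PI/4 suffice: then x^2 <= 3 on [0, PI/2], and x - x^3/6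
   >= x/2. *)
assert (HPI : (PI <= 17 / 5)%R).
{ pose proof (proj2 (PI_ineq 2)) as K. unfold tg_alt, PI_tg in K. simpl in K. lra. }
assert (K := proj1 (pre_sin_bound x 0 ltac:(lra) ltac:(lra))).
unfold sin_approx, sin_term in K. simpl in K.
assert (x * (1 - x * x / 6) <= sin x)%R.
{ apply Rle_trans with (2 := K). right. field. }
assert (x * x <= 3)%R by nra. nra.
Qed.

Lemma sinh_ge x : (0 <= x)%R -> (x <= sinh x)%R.
Proof.
intros Hx.
destruct (MVT_gen sinh 0 x cosh) as [c [_ E]].
- intros y _. apply is_derive_Reals. apply derivable_pt_lim_sinh.
- intros y _. apply derivable_continuous_pt. eexists; apply derivable_pt_lim_sinh.
- rewrite sinh_0 in E.
  assert (1 <= cosh c)%R.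
  { unfold cosh. pose proof (exp_pos c). assert (exp c * exp (- c) = 1)%R
      by (rewrite <- exp_plus; replace (c + - c)%R with 0%R by ring; apply exp_0).
    pose proof (exp_pos (- c)). pose proof (pow2_ge_0 (exp c - 1)). nra. }
  nra.
Qed.

Lemma csin_eq z : csin z = (sin (Re z) * cosh (Im z), cos (Re z) * sinh (Im z))%R.
Proof.
unfold csin. destruct z as [x y].
replace (Ci * (x, y)) with ((- y)%R, x) by (unfold Ci, Cmult; simpl; f_equal; ring).
replace (- ((- y)%R, x)) with (y, (- x)%R) by (unfold Copp; simpl; f_equal; ring).
unfold Cexp, Re, Im; simpl. rewrite cos_neg, sin_neg. unfold cosh, sinh.
replace (2 * Ci) with (0%R, 2%R) by (unfold Ci, Cmult; simpl; f_equal; ring).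
unfold Cdiv, Cinv, Cmult, Cminus, Cplus, Copp; simpl. f_equal; field.
Qed.

(** |sin(x + i y)|^2 = sin(x)^2 + sinh(y)^2, compared term by term with x^2/4 and y^2. The crude
    factor 2 is enough because it leads to 4/PI < PI/2. *)
Lemma csin_lower_bound z : (- (PI / 2) <= Re z <= PI / 2)%R -> (Cmod z <= 2 * Cmod (csin z))%R.
Proof.
intros Hz.
assert (H : (Cmod z ^ 2 <= (2 * Cmod (csin z)) ^ 2)%R).
{ rewrite Rpow_mult_distr, (Cmod2_alt z), csin_eq.
  set (x := Re z) in *. set (y := Im z).
  rewrite Cmod2_alt.
  change (x ^ 2 + y ^ 2 <= 2 ^ 2 * ((sin x * cosh y) ^ 2 + (cos x * sinh y) ^ 2))%R.
  assert (E : ((sin x * cosh y) ^ 2 + (cos x * sinh y) ^ 2 = sin x ^ 2 + sinh y ^ 2)%R).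
  { assert (C1 : (cosh y ^ 2 = 1 + sinh y ^ 2)%R).
    { unfold cosh, sinh. assert (E1 : (exp y * exp (- y) = 1)%R)
        by (rewrite <- exp_plus; replace (y + - y)%R with 0%R by ring; apply exp_0). nra. }
    assert (C2 : (cos x ^ 2 = 1 - sin x ^ 2)%R) by (pose proof (sin2_cos2 x) as K; unfold Rsqr in K; lra).
    rewrite !Rpow_mult_distr, C1, C2. ring. }
  assert (Hx : (x ^ 2 <= 4 * sin x ^ 2)%R).
  { destruct (Rle_dec 0 x) as [Hx | Hx].
    - pose proof (sin_ge_half x ltac:(lra)). nra.
    - pose proof (sin_ge_half (- x) ltac:(lra)) as K. rewrite sin_neg in K. nra. }
  assert (Hy : (y ^ 2 <= sinh y ^ 2)%R).
  { destruct (Rle_dec 0 y) as [Hy | Hy].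
    - pose proof (sinh_ge y Hy). nra.
    - pose proof (sinh_ge (- y) ltac:(lra)) as K.
      replace (sinh (- y)) with (- sinh y)%R in K
        by (unfold sinh; rewrite Ropp_involutive; field). nra. }
  rewrite E. pose proof (pow2_ge_0 (sinh y)). lra. }
pose proof (Cmod_ge_0 z). pose proof (Cmod_ge_0 (csin z)).
apply Rnot_lt_le. intros Hlt. nra.
Qed.

Lemma Carcsin_le z : Omega z -> (Cmod (Carcsin z) <= 2 * Cmod z)%R.
Proof.
intros Hz. rewrite <- (csin_Carcsin z) at 2. apply csin_lower_bound.
pose proof (proj2 Carcsin_disc z Hz). lra.
Qed.

(** Extends to the origin, by continuity, an estimate obtained after dividing by z. *)
Lemma bound_at_0 h (B : R) : holo Omega h ->
  (forall z, Omega z -> z <> 0 -> (Cmod (h z) <= B)%R) -> (Cmod (h 0) <= B)%R.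
Proof.
intros Hh HB. apply le_epsilon. intros eps He.
destruct (proj1 (ccontP _ _) (holo_ccont _ h 0 Hh Omega_0) eps He) as [d [Hd K]].
set (w := RtoC (Rmin (d / 2) (1 / 2))).
assert (Hm : (0 < Rmin (d / 2) (1 / 2))%R) by (apply Rmin_pos; lra).
assert (Hw : Cmod w = Rmin (d / 2) (1 / 2)) by (unfold w; rewrite Cmod_R; apply Rabs_pos_eq; lra).
pose proof (Rmin_l (d / 2) (1 / 2)). pose proof (Rmin_r (d / 2) (1 / 2)).
assert (K1 := K w). replace (w - 0) with w in K1 by ring. specialize (K1 ltac:(lra)).
assert (K2 := HB w ltac:(unfold Omega; lra) ltac:(apply Cmod_gt_0; lra)).
pose proof (Cmod_triangle_minus (h 0) (h w)) as T. rewrite Cmod_minus_sym in T. lra.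
Qed.

(* Noshiro-Warschawski *)
Lemma univalent_of_Re_deriv_pos f F : (forall z, Omega z -> cderiv f z (F z)) ->
  (forall z, Omega z -> (0 < Re (F z))%R) -> univalent f.
Proof.
intros Hf HF z w Hz Hw E.
destruct (complex_mvt f F (Cconj (w - z)) z w Hf Hz Hw) as [t [Ht K]].
specialize (HF _ (Omega_convex z w t Hz Hw Ht)).
set (v := F (z + RtoC t * (w - z))) in *.
replace (f w - f z) with (RtoC 0) in K by (rewrite E; ring).
replace (Cconj (w - z) * ((w - z) * v)) with (RtoC (Cmod (w - z) ^ 2) * v) in K
  by (rewrite Cmod2_conj; ring).
rewrite Cmult_0_r, re_scal_l in K. simpl Re in K at 1.
destruct (Ceq_dec (w - z) 0) as [E0 | E0].
- replace w with (z + (w - z)) by ring. rewrite E0. ring.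
- assert (0 < Cmod (w - z) ^ 2)%R by (apply pow_lt, Cmod_gt_0, E0). nra.
Qed.

(** f(z)/z has no zero: at 0 its value is 1, and elsewhere f(z) = 0 = f(0) would contradict
    univalence. *)
Lemma log_coeffs_exist f : class_S f -> exists gamma, log_coeffs f gamma.
Proof.
intros [[_ [a [a0 [a1 Ha]]]] Hinj]. apply has_expansion_expands in Ha.
destruct (expands_shift 1 a f ltac:(lra) Ha) as [phi [Hphi Ef]].
rewrite a0 in Ef.
destruct (holo_log phi (expands_holo _ _ Hphi)) as [L [HL [L0 EL]]].
{ rewrite (expands_0 1 _ _ ltac:(lra) Hphi). exact a1. }
{ intros z Hz E. assert (z = 0).
  { apply Hinj; [exact Hz | exact Omega_0 |]. rewrite (Ef z Hz), (Ef 0 Omega_0), E. ring. }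
  subst z. rewrite (expands_0 1 _ _ ltac:(lra) Hphi), a1 in E. exact (C1_nz E). }
destruct (holo_expands L HL) as [l Hl].
assert (l0 : l 0%nat = 0) by (rewrite <- (expands_0 1 l L ltac:(lra) Hl); exact L0).
exists (fun n => l n / 2). exists L.
split; [exact (holo_analytic L HL) |]. split; [exact L0 |]. split.
- intros z Hz Hz0. rewrite (EL z Hz), (Ef z Hz). field. exact Hz0.
- apply has_expansion_expands. apply expands_coef_ext with (2 := Hl).
  intros [| n]; [exact l0 | field].
Qed.

Lemma Omega_pow n z : Omega z -> Omega (z ^ S n).
Proof.
unfold Omega. rewrite Cmod_pow. intros Hz. pose proof (Cmod_ge_0 z).
assert (Cmod z ^ n <= 1)%R.
{ rewrite <- (pow1 n). apply pow_incr. lra. }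
pose proof (pow_le _ n (Cmod_ge_0 z)). simpl. nra.
Qed.

Lemma schwarz_pow n : schwarz (fun z => z ^ S n).
Proof.
split; [apply holo_analytic, holo_pow |]. split; [simpl; ring |].
intros z Hz. apply Rlt_le, Omega_pow, Hz.
Qed.

(* [f' = exp g] with [g] the primitive of [(2/PI) arcsin(z^(n+1)) / z]. *)
Lemma extremal_function n : exists f, class_S f /\
  forall z, Omega z -> convexity_quotient f z = 1 + 2 / PI * Carcsin (z ^ S n).
Proof.
assert (HPI : RtoC PI <> 0) by (intros E; apply RtoC_inj in E; exact (PI_neq0 E)).
assert (HP3 : (3 < PI)%R) by (pose proof PI2_3_2; lra).
set (q := fun z => 2 / PI * Carcsin (z ^ S n)).
assert (Hq : holo Omega q).
{ apply holo_scal. apply (holo_comp Omega Omega Carcsin (fun z => z ^ S n)).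
  - apply Carcsin_disc.
  - apply holo_pow.
  - intros z; apply Omega_pow. }
assert (Hq0 : q 0 = 0).
{ unfold q. replace (0 ^ S n) with (RtoC 0) by (simpl; ring). rewrite Carcsin_0. ring. }
assert (Hqb : forall z, Omega z -> (Cmod (q z) <= 4 / PI * Cmod z)%R).
{ intros z Hz. unfold q. rewrite Cmod_mult.
  replace (Cmod (2 / PI)) with (2 / PI)%R.
  - assert (K := Carcsin_le _ (Omega_pow n z Hz)). rewrite Cmod_pow in K.
    assert (Cmod z ^ S n <= Cmod z)%R.
    { assert (Cmod z ^ n <= 1)%R.
      { rewrite <- (pow1 n). apply pow_incr. unfold Omega in Hz. pose proof (Cmod_ge_0 z). lra. }
      simpl. pose proof (Cmod_ge_0 z). nra. }
    assert (0 < / PI)%R by (apply Rinv_0_lt_compat; lra).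
    replace (4 / PI * Cmod z)%R with (2 / PI * (2 * Cmod z))%R by (field; lra).
    apply Rmult_le_compat_l; [unfold Rdiv; lra | lra].
  - rewrite <- RtoC_div, Cmod_R, Rabs_pos_eq; [reflexivity | | lra].
    apply Rlt_le, Rdiv_lt_0_compat; lra. }
destruct (holo_expands q Hq) as [b Hb].
assert (b0 : b 0%nat = 0) by (rewrite <- (expands_0 1 b q ltac:(lra) Hb); exact Hq0).
destruct (expands_shift 1 b q ltac:(lra) Hb) as [h [Hh Eq]]. rewrite b0 in Eq.
assert (Hhh := expands_holo _ _ Hh).
assert (Hhb : forall z, Omega z -> (Cmod (h z) <= 4 / PI)%R).
{ assert (Hn0 : forall z, Omega z -> z <> 0 -> (Cmod (h z) <= 4 / PI)%R).
  { intros z Hz Hz0. assert (Hm : (0 < Cmod z)%R) by (apply Cmod_gt_0, Hz0).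
    apply Rmult_le_reg_r with (1 := Hm). rewrite Rmult_comm, <- Cmod_mult.
    replace (z * h z) with (q z) by (rewrite (Eq z Hz); ring). apply Hqb, Hz. }
  intros z Hz. destruct (Ceq_dec z 0) as [-> | Hz0]; [apply bound_at_0; assumption | auto]. }
destruct (holo_primitive h Hhh) as [g [Hg [g0 Dg]]].
(* The mean value theorem along the radius gives |Im (g z)| <= sup |h| <= 4/PI, and 4/PI < PI/2
   because PI^2 > 8. So f' = exp(g) stays in the right half-plane. *)
assert (HIm : forall z, Omega z -> (- (PI / 2) < Im (g z) < PI / 2)%R).
{ intros z Hz.
  destruct (complex_mvt g h (- Ci) 0 z Dg Omega_0 Hz) as [t [Ht E]].
  assert (K := Hhb _ (Omega_convex 0 z t Omega_0 Hz Ht)).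
  set (v := h (0 + RtoC t * (z - 0))) in *.
  rewrite g0 in E.
  replace (Re (- Ci * (g z - 0))) with (Im (g z)) in E by (unfold Re, Im; simpl; ring).
  rewrite E.
  assert (Hb1 : (Cmod (- Ci * ((z - 0) * v)) <= 4 / PI)%R).
  { rewrite !Cmod_mult, Cmod_opp, Cmod_Ci. replace (z - 0) with z by ring.
    unfold Omega in Hz. pose proof (Cmod_ge_0 z). pose proof (Cmod_ge_0 v). nra. }
  assert (Hb2 : (4 / PI < PI / 2)%R).
  { apply Rmult_lt_reg_r with PI; [lra |]. unfold Rdiv at 1. rewrite Rmult_assoc, Rinv_l by lra. nra. }
  pose proof (re_le_Cmod (- Ci * ((z - 0) * v))) as R1. apply Rabs_le_between in R1. lra. }
set (F := fun z => Cexp (g z)).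
assert (HF : holo Omega F) by (apply holo_exp, Hg).
assert (HFpos : forall z, Omega z -> (0 < Re (F z))%R).
{ intros z Hz. unfold F, Cexp; simpl. apply Rmult_lt_0_compat; [apply exp_pos |].
  apply cos_gt_0; apply HIm, Hz. }
assert (DF : forall z, Omega z -> cderiv F z (h z * F z)).
{ intros z Hz. exact (cderiv_comp Cexp g z _ _ (cderiv_Cexp _) (Dg z Hz)). }
destruct (holo_primitive F HF) as [f [Hf [f0 Df]]].
exists f. split; [split; [split |] |].
- exact (holo_analytic f Hf).
- destruct (holo_expands f Hf) as [a Ha]. exists a.
  split; [rewrite <- (expands_0 1 a f ltac:(lra) Ha); exact f0 |].
  split; [| apply has_expansion_expands; exact Ha].
  rewrite <- (proj1 (dcoef_values a)), <- (expands_0 1 _ _ ltac:(lra) (expands_dcoef 1 a f Ha)).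
  rewrite (cderiv_unique _ _ _ _ (expands_deriv 1 a f 0 Ha Omega_0) (Df 0 Omega_0)).
  unfold F. rewrite g0. apply Cexp_0.
- exact (univalent_of_Re_deriv_pos f F Df HFpos).
- intros z Hz. unfold convexity_quotient.
  rewrite (C_derive_on_disc f F Df z Hz), (C_derive2_on_disc f F _ Df DF z Hz).
  change (2 / PI * Carcsin (z ^ S n)) with (q z). rewrite (Eq z Hz). field.
  apply Cexp_neq0.
Qed.

(** The indices n = 0, 1, 2 serve the first, second and third bound respectively. *)
Lemma extremal_log_coeffs n : exists f gamma c, class_C_arcsin f /\ log_coeffs f gamma /\
  expands 1 c (fun z => z ^ S n) /\
  gamma 1%nat = RtoC (1 / (2 * PI)) * c 1%nat /\
  gamma 2%nat = RtoC (1 / (6 * PI)) * (c 2%nat + RtoC (/ (2 * PI)) * c 1%nat * c 1%nat) /\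
  gamma 3%nat = RtoC (1 / (12 * PI)) *
    (c 3%nat + RtoC (/ PI) * c 1%nat * c 2%nat + / 6 * c 1%nat * c 1%nat * c 1%nat).
Proof.
destruct (extremal_function n) as [f [Hf Hq]].
destruct (log_coeffs_exist f Hf) as [gamma Hg].
destruct (class_log_coeffs f _ gamma (proj1 Hf) (schwarz_pow n) Hq Hg) as [c [_ [Hc H]]].
exists f, gamma, c. split; [| auto].
split; [exact Hf |]. exists (fun z => z ^ S n). split; [apply schwarz_pow | exact Hq].
Qed.

Theorem theorem3p2 :
  (forall (f : C -> C) (gamma : nat -> C),
     class_C_arcsin f -> log_coeffs f gamma ->
     (Cmod (gamma 1%nat) <= 1 / (2 * PI))%R /\
     (Cmod (gamma 2%nat) <= 1 / (6 * PI))%R /\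
     (Cmod (gamma 3%nat) <= 1 / (12 * PI))%R) /\
  (exists (f : C -> C) (gamma : nat -> C),
     class_C_arcsin f /\ log_coeffs f gamma /\
     Cmod (gamma 1%nat) = (1 / (2 * PI))%R) /\
  (exists (f : C -> C) (gamma : nat -> C),
     class_C_arcsin f /\ log_coeffs f gamma /\
     Cmod (gamma 2%nat) = (1 / (6 * PI))%R) /\
  (exists (f : C -> C) (gamma : nat -> C),
     class_C_arcsin f /\ log_coeffs f gamma /\
     Cmod (gamma 3%nat) = (1 / (12 * PI))%R).
Proof.
pose proof PI_RGT_0 as HP.
assert (Hpos : forall k : R, (0 < k)%R -> (0 < 1 / (k * PI))%R).
{ intros k Hk. apply Rdiv_lt_0_compat; [lra | apply Rmult_lt_0_compat; assumption]. }
assert (Hmod : forall (k : R) (x : C), (0 < k)%R -> x = 1 ->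
  Cmod (RtoC (1 / (k * PI)) * x) = (1 / (k * PI))%R).
{ intros k x Hk ->. rewrite Cmult_1_r, Cmod_R, Rabs_pos_eq; [reflexivity | apply Rlt_le, Hpos, Hk]. }
(* [c] is only known to be some expansion of z^(n+1); uniqueness against [expands_cubic] gives its
   values. *)
assert (Hcoef : forall n u1 u2 u3 c, (forall z, z ^ S n = cubic 0 u1 u2 u3 z) ->
  expands 1 c (fun z => z ^ S n) -> c 1%nat = u1 /\ c 2%nat = u2 /\ c 3%nat = u3).
{ intros n u1 u2 u3 c E Hc.
  assert (K := expands_unique 1 _ _ _ ltac:(lra) (expands_ext 1 c _ _ (fun z _ => E z) Hc)
    (expands_cubic 0 u1 u2 u3)).
  exact (conj (K 1%nat) (conj (K 2%nat) (K 3%nat))). }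
split; [| split; [| split]].
- intros f gamma [[HA _] [omega [Hw Hq]]] Hg.
  destruct (class_log_coeffs f omega gamma HA Hw Hq Hg) as [c [Hwh [Hc [-> [-> ->]]]]].
  destruct Hw as [_ [Hw0 Hw1]].
  destruct (schwarz_functional_bounds omega c Hwh Hc Hw0 Hw1) as [B1 [B2 B3]].
  rewrite !Cmod_mult, !(Cmod_R (1 / _)), !Rabs_pos_eq by (apply Rlt_le, Hpos; lra).
  assert (M : forall k x : R, (0 < k)%R -> (x <= 1)%R -> (1 / (k * PI) * x <= 1 / (k * PI))%R).
  { intros k x Hk Hx. pose proof (Hpos k Hk). nra. }
  repeat split; apply M; (assumption || lra || rewrite <- ?Cmod_mult; assumption).
- destruct (extremal_log_coeffs 0) as [f [gamma [c [Hf [Hg [Hc [E1 _]]]]]]].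
  destruct (Hcoef 0%nat 1 0 0 c) as [c1 _]; [intros z; unfold cubic; simpl; ring | exact Hc |].
  exists f, gamma. split; [exact Hf |]. split; [exact Hg |].
  rewrite E1. apply Hmod; [lra | exact c1].
- destruct (extremal_log_coeffs 1) as [f [gamma [c [Hf [Hg [Hc [_ [E2 _]]]]]]]].
  destruct (Hcoef 1%nat 0 1 0 c) as [c1 [c2 _]]; [intros z; unfold cubic; simpl; ring | exact Hc |].
  exists f, gamma. split; [exact Hf |]. split; [exact Hg |].
  rewrite E2. apply Hmod; [lra | rewrite c1, c2; ring].
- destruct (extremal_log_coeffs 2) as [f [gamma [c [Hf [Hg [Hc [_ [_ E3]]]]]]]].
  destruct (Hcoef 2%nat 0 0 1 c) as [c1 [c2 c3]]; [intros z; unfold cubic; simpl; ring | exact Hc |].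
  exists f, gamma. split; [exact Hf |]. split; [exact Hg |].
  rewrite E3. apply Hmod; [lra | rewrite c1, c2, c3; ring].
Qed.
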